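(* For $\alpha\in\mathbb{R}$ let $$u_0(x)=u_0^\omega(x)=\sum_{n\ge0}\frac{g_n(\omega)}{\sqrt{1+|n|^{2\alpha}}}e^{inx},\qquad x\in\mathbb{T}=\mathbb{R}/2\pi\mathbb{Z},$$ where $\{g_n\}_{n\ge0}$ is a family of independent standard complex-valued Gaussian random variables on a probability space $(\Omega,\mathcal{F},P)$. Let $\Pi$ be the Szegő projector, $\Pi(f)=\sum_{n\ge0}\widehat f(n)e^{inx}$, let $$\mathcal{N}(u_1,u_2,u_3)(t)=\int_0^t\Pi(u_1\overline{u_2}u_3)(t')\,dt',$$ and let $z(t)=u_0-i\,\mathcal{N}(u_0,u_0,u_0)(t)$ be the second iterate for the cubic Szegő equation $iu_t=\Pi(|u|^2u)$, $u|_{t=0}=u_0$. (a) Let $\alpha\in(\frac12,1]$. Then for $s\ge\alpha-\frac12$ we have $$\big\|\mathcal{N}(u_0,u_0,u_0)\big\|_{C([-T,T];H^s_+)}=\infty\quad\text{a.s.}$$ for any $T>0$. In particular, even with $\alpha=1$, the second iterate $z(t)$ for the cubic Szegő equation is a.s. unbounded in $H^{\frac12}_+$. (b) Let $\alpha>\frac12$. Then the second iterate $z(t)$ for the cubic Szegő equation is a.s. bounded in $H^s_+$ with $s<\alpha-\frac12-\varepsilon$ for any $\varepsilon>0$.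
   Context: $H^s_+(\mathbb{T}):=\Pi(H^s(\mathbb{T}))$ is the subspace of the Sobolev space $H^s(\mathbb{T})$ of elements whose Fourier coefficients vanish at negative frequencies, with the $H^s$ norm. In $\mathcal{N}(u_0,u_0,u_0)$ the function $u_0$ is regarded as constant in time. The norm of $C([-T,T];H^s_+)$ is $\sup_{|t|\le T}\|\cdot(t)\|_{H^s}$, with value $\infty$ if this supremum is infinite (in particular if the function does not take values in $H^s$). ''$z(t)$ is a.s. bounded (unbounded) in $H^s_+$'' means that almost surely the $C([-T,T];H^s_+)$ norm of $z$ is finite (infinite) for $T>0$. The datum $u_0$ belongs a.s. to $H^{s}_+(\mathbb{T})$ for every $s<\alpha-\frac12$ but not to $H_+^{\alpha-\frac12}(\mathbb{T})$. *)

(* Defs.v *)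
From HB Require Import structures.
From mathcomp Require Import all_boot all_order all_algebra.
From mathcomp Require Import finmap.
From mathcomp Require Import all_classical all_reals all_analysis.
From mathcomp Require Import complex.

Set Implicit Arguments.
Unset Strict Implicit.
Unset Printing Implicit Defensive.

Import Order.TTheory GRing.Theory Num.Theory.
Import numFieldNormedType.Exports.

Local Open Scope classical_set_scope.
Local Open Scope ring_scope.
Local Open Scope complex_scope.

Section ComplexIntegral.
Variable R : realType.
Implicit Types (D : set R) (f : R -> R[i]).

Definition cmeasurable_fun D f :=
  measurable_fun D (fun x => complex.Re (f x)) /\ measurable_fun D (fun x => complex.Im (f x)).

Definition cintegral D f : R[i] :=
  (\int[@lebesgue_measure R]_(x in D) complex.Re (f x)) +i*
  (\int[@lebesgue_measure R]_(x in D) complex.Im (f x)).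

Definition cintegral_oriented (a b : R) f : R[i] :=
  if a <= b then cintegral `[a, b] f else - cintegral `[b, a] f.

End ComplexIntegral.

(* A function on the torus R/2piZ is a function on R of which only the values on
   [0, 2pi] are used. *)
Section Torus.
Variable R : realType.

Definition torus : set R := `[0, 2 * pi].

Definition expi (n : int) (x : R) : R[i] :=
  cos (n%:~R * x) +i* sin (n%:~R * x).

Definition fourier_coef (f : R -> R[i]) (n : int) : R[i] :=
  ((2 * pi)^-1)%:C * cintegral torus (fun x => f x * expi (- n) x).

(* A periodic distribution is given by the family of its Fourier coefficients. *)
Definition distr := int -> R[i].

Definition fourier_partial_sum (c : distr) (N : nat) (x : R) : R[i] :=
  \sum_(k < N.+1) c k%:Z * expi k%:Z x +
  \sum_(k < N) c (- k.+1%:Z) * expi (- k.+1%:Z) x.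

Definition is_fourier_sum (c : distr) (f : R -> R[i]) : Prop :=
  cmeasurable_fun torus f /\
  (\int[@lebesgue_measure R]_(x in torus)
     ((Normc.normc (f x - fourier_partial_sum c N x)) ^+ 2)%:E)%E
    @[N --> \oo] --> 0%E.

(* The function represented by c: the sum in L^2 of its Fourier series, which
   exists exactly when c is square-summable and is unique up to equality almost
   everywhere (the value is meaningless if c is not square-summable). *)
Definition fun_of_distr (c : distr) : R -> R[i] :=
  xget (fun=> 0) [set f | is_fourier_sum c f].

Definition szego_proj (c : distr) : distr := fun n => if 0 <= n then c n else 0.

(* The pointwise product u1 * conj u2 * u3, which is a distribution as soon as
   it is integrable on the torus. *)
Definition cubic_prod (u1 u2 u3 : distr) : distr :=
  fourier_coef (fun x =>
    fun_of_distr u1 x * conjc (fun_of_distr u2 x) * fun_of_distr u3 x).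

(* The integral in time is taken coefficientwise, i.e. in the weak sense. *)
Definition duhamel (u1 u2 u3 : R -> distr) (t : R) : distr := fun n =>
  cintegral_oriented 0 t
    (fun t' => szego_proj (cubic_prod (u1 t') (u2 t') (u3 t')) n).

Definition second_iterate (u0 : distr) (t : R) : distr := fun n =>
  u0 n - (0 +i* 1) * duhamel (fun=> u0) (fun=> u0) (fun=> u0) t n.

Definition sobolev_norm (s : R) (c : distr) : \bar R :=
  sqrte (\esum_(n in [set: int])
    ((1 + n%:~R ^+ 2) `^ s * (Normc.normc (c n)) ^+ 2)%:E).

Definition sobolev_plus (s : R) : set distr :=
  [set c | (sobolev_norm s c < +oo)%E /\ forall n : int, n < 0 -> c n = 0].

(* The norm of C([-T, T]; H^s_+): a supremum, infinite in particular if v leaves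
   H^s_+. Continuity in time is not tested: it is automatic for polynomials in t
   with values in H^s_+, such as the iterates of a time-independent datum. *)
Definition Csobolev_norm (T s : R) (v : R -> distr) : \bar R :=
  if `[< forall t, t \in `[- T, T] -> sobolev_plus s (v t) >]
  then ereal_sup [set sobolev_norm s (v t) | t in `[- T, T]]
  else +oo%E.

End Torus.

Section Randomness.
Context {d : measure_display} {Omega : measurableType d} {R : realType}.
Variable P : probability Omega R.

(* The Borel structure of the complex plane is that of R * R. *)
Definition ReIm (X : Omega -> R[i]) (w : Omega) : R * R := (complex.Re (X w), complex.Im (X w)).

(* Density exp (- |z| ^ 2) / pi: the real and imaginary parts are independent
   centered Gaussians of variance 1/2, so that E |X| ^ 2 = 1. *)
Definition std_complex_gaussian (X : Omega -> R[i]) : Prop :=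
  measurable_fun [set: Omega] (ReIm X) /\
  forall A : set (R * R), measurable A ->
    P (ReIm X @^-1` A) =
    (normal_prob (0 : R) (Num.sqrt 2)^-1 \x normal_prob (0 : R) (Num.sqrt 2)^-1)%E
      A.

Definition independent (X : nat -> Omega -> R[i]) : Prop :=
  forall (J : {fset nat}) (A : nat -> set (R * R)),
    (forall n, measurable (A n)) ->
    P (\bigcap_(n in [set` J]) (ReIm (X n) @^-1` A n)) =
    (\prod_(n <- J) P (ReIm (X n) @^-1` A n))%E.

Definition random_datum (alpha : R) (g : nat -> Omega -> R[i]) (w : Omega) :
    distr R := fun n =>
  match n with
  | Posz k => g k w / (Num.sqrt (1 + k%:R `^ (2 * alpha)))%:C
  | Negz _ => 0
  end.

End Randomness.

(* Main.v *)
Require Import Defs.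
From HB Require Import structures.
From mathcomp Require Import all_boot all_order all_algebra.
From mathcomp Require Import finmap.
From mathcomp Require Import all_classical all_reals all_analysis.
From mathcomp Require Import measurable_realfun.
From mathcomp Require Import complex.
From mathcomp Require Import ring lra zify.

(** Write [u0 = sum_n a_n e^{inx}] with [a_n = v_n g_n].  The n-th coefficient
    of [Pi (|u0|^2 u0)] is the sum of [a_n1 * conj a_n2 * a_n3] over
    [n1 + n3 = n + n2].  The resonant triads, those with [n2 = n1] or
    [n2 = n3], contribute [(2 ||u0||_2^2 - |a_n|^2) a_n].  The remaining part
    [cubic_nr] has second moment [O(v_n^2)], because the moments of a rotation
    invariant Gaussian family vanish unless the indices pair up.  So the
    nonlinearity is exactly as rough as [u0], which gives (b).

    For (a), let [lam] be the weight of the critical exponent [alpha - 1/2]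
    and [L_N = sum_(1 <= n < N) lam_n |a_n|^2].  Almost surely [L_N] is
    unbounded, since [lam_n E|a_n|^2] is of order [1/n] while the variances are
    summable.  If the coefficients [c_n] of the nonlinearity were square
    summable against [lam], then pairing [lam_n c_n] with [a_n] would give
    [O(sqrt L_N)], whereas the resonant part of this pairing is at least
    [||u0||_2^2 L_N] and its nonresonant part, a quartic form in the Gaussians
    split into dyadic blocks, is bounded.

    The pointwise product is the limit of its truncations along infinitely many
    [K]: the truncated [L^4] norms have a controlled second moment, so by Fatou
    they are almost surely bounded along a subsequence, and [L^2] convergence
    together with an [L^4] bound passes to the limit in the cubic coefficients. *)

Set Implicit Arguments.
Unset Strict Implicit.
Unset Printing Implicit Defensive.

Import Order.TTheory GRing.Theory Num.Theory.
Import numFieldNormedType.Exports.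

Local Open Scope classical_set_scope.
Local Open Scope ring_scope.

Local Notation Re := complex.Re.
Local Notation Im := complex.Im.

(** Of the rotation invariance of the Gaussian law only the quarter turn [z |-> 'i * z] is used: it
    exchanges the coordinates up to a sign, so its invariance follows from the symmetry of the
    one-dimensional law. It detects the charge of a monomial only modulo 4, which is enough for the
    words of length six and eight that occur: the one spurious case, four equal letters, contradicts
    the relation between the frequencies.

    Fatou's lemma gives bounds along infinitely many [K] that depend on the sample point, and two
    such sets of [K] need not meet. All quantities wanted along the same [K] are therefore added
    before taking expectations. The cut-off of the Sobolev weight stays fixed while [K] grows; the
    blocks make the bound uniform in this cut-off.

    Since [u0] does not depend on time, the Duhamel term is [t] times a fixed distribution. Infinite
    norms are found at a single time: [T] for the Duhamel term, and 0 for the second iterate, which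
    starts at [u0]. *)

Section ComplexNumbers.
Variable R : realType.
Implicit Types x y z : R[i].

(** The squared modulus, kept real and polynomial in the two coordinates so that [ring], [lra] and
    [nra] apply; the modulus itself contains a square root. *)
Definition nsq z : R := Re z ^+ 2 + Im z ^+ 2.

Lemma nsq_ge0 z : 0 <= nsq z.
Proof. by rewrite addr_ge0 ?sqr_ge0. Qed.

Lemma normc_sqr z : Normc.normc z ^+ 2 = nsq z.
Proof. by case: z => a b; rewrite /= sqr_sqrtr// addr_ge0 ?sqr_ge0. Qed.

Lemma nsqM x y : nsq (x * y) = nsq x * nsq y.
Proof. by case: x y => a b [c e]; rewrite /nsq/=; ring. Qed.

Lemma nsqJ z : nsq (conjc z) = nsq z.
Proof. by case: z => a b; rewrite /nsq/= sqrrN. Qed.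

Lemma nsqN z : nsq (- z) = nsq z.
Proof. by case: z => a b; rewrite /nsq/= !sqrrN. Qed.

Lemma nsqB x y : nsq (x - y) = nsq (y - x).
Proof. by rewrite -nsqN opprB. Qed.

Lemma nsq_real (a : R) : nsq a%:C%C = a ^+ 2.
Proof. by rewrite /nsq/= expr0n addr0. Qed.

Lemma nsq0 : nsq 0 = 0 :> R.
Proof. by rewrite /nsq/= expr0n addr0. Qed.

Lemma nsqD_le x y : nsq (x + y) <= 2 * nsq x + 2 * nsq y.
Proof.
case: x y => a b [c e]; rewrite /nsq/=.
by have := sqr_ge0 (a - c); have := sqr_ge0 (b - e); lra.
Qed.

Lemma mulcJ z : z * conjc z = (nsq z)%:C%C.
Proof. by case: z => a b; apply/eqP; rewrite eq_complex /nsq/=; apply/andP; split; apply/eqP; ring. Qed.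

Lemma Re_add x y : Re (x + y) = Re x + Re y. Proof. by case: x y => ? ? []. Qed.
Lemma Im_add x y : Im (x + y) = Im x + Im y. Proof. by case: x y => ? ? []. Qed.
Lemma Re_sub x y : Re (x - y) = Re x - Re y. Proof. by case: x y => ? ? []. Qed.
Lemma Im_sub x y : Im (x - y) = Im x - Im y. Proof. by case: x y => ? ? []. Qed.
Lemma Re_mul x y : Re (x * y) = Re x * Re y - Im x * Im y.
Proof. by case: x y => ? ? []. Qed.
Lemma Im_mul x y : Im (x * y) = Re x * Im y + Im x * Re y.
Proof. by case: x y => ? ? []. Qed.
Lemma Re_conj z : Re (conjc z) = Re z. Proof. by case: z. Qed.
Lemma Im_conj z : Im (conjc z) = - Im z. Proof. by case: z. Qed.

Lemma Re_sum I (r : seq I) (Q : pred I) (F : I -> R[i]) :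
  Re (\sum_(i <- r | Q i) F i) = \sum_(i <- r | Q i) Re (F i).
Proof. by elim/big_rec2: _ => // i y1 y2 _ <-; rewrite Re_add. Qed.

Lemma complex_eqP x y : Re x = Re y -> Im x = Im y -> x = y.
Proof. by case: x y => a b [c e] /= -> ->. Qed.

Lemma Re_sqr_le z : Re z ^+ 2 <= nsq z.
Proof. by rewrite lerDl sqr_ge0. Qed.

Lemma Im_sqr_le z : Im z ^+ 2 <= nsq z.
Proof. by rewrite lerDr sqr_ge0. Qed.

Lemma normr_le_of_sqr (a b : R) : 0 <= b -> a ^+ 2 <= b ^+ 2 -> `|a| <= b.
Proof. by move=> b0 ab; rewrite -(ler_pXn2r (n := 2))// ?nnegrE// real_normK ?num_real. Qed.

Lemma normr_Re_le z (b : R) : 0 <= b -> nsq z <= b ^+ 2 -> `|Re z| <= b.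
Proof. by move=> b0 zb; apply: normr_le_of_sqr => //; exact: le_trans (Re_sqr_le z) zb. Qed.

Lemma normr_Im_le z (b : R) : 0 <= b -> nsq z <= b ^+ 2 -> `|Im z| <= b.
Proof. by move=> b0 zb; apply: normr_le_of_sqr => //; exact: le_trans (Im_sqr_le z) zb. Qed.

End ComplexNumbers.

(** * Measurability and integration of complex functions *)

Section ComplexIntegration.
Context {d : measure_display} {T : measurableType d} {R : realType}.
Variable mu : {measure set T -> \bar R}.
Variable D : set T.
Hypothesis mD : measurable D.
Implicit Types f g : T -> R[i].

(* cmfun and cint extend cmeasurable_fun and cintegral to an arbitrary measure. *)
Definition cmfun f :=
  measurable_fun D (fun x => Re (f x)) /\ measurable_fun D (fun x => Im (f x)).

Definition cintegrable f :=
  mu.-integrable D (EFin \o (fun x => Re (f x))) /\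
  mu.-integrable D (EFin \o (fun x => Im (f x))).

Definition cint f : R[i] :=
  ((\int[mu]_(x in D) Re (f x)) +i* (\int[mu]_(x in D) Im (f x)))%C.

Lemma cmfun_cst z : cmfun (cst z).
Proof. by split; exact: measurable_cst. Qed.

Lemma eq_cmfun f g : (forall x, f x = g x) -> cmfun f -> cmfun g.
Proof. by move=> /funext ->. Qed.

Lemma cmfunD f g : cmfun f -> cmfun g -> cmfun (fun x => f x + g x).
Proof.
move=> [rf jf] [rg jg]; split.
  by under eq_fun do rewrite Re_add; exact: measurable_funD.
by under eq_fun do rewrite Im_add; exact: measurable_funD.
Qed.

Lemma cmfunM f g : cmfun f -> cmfun g -> cmfun (fun x => f x * g x).
Proof.
move=> [rf jf] [rg jg]; split.
  by under eq_fun do rewrite Re_mul; apply: measurable_funB; exact: measurable_funM.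
by under eq_fun do rewrite Im_mul; apply: measurable_funD; exact: measurable_funM.
Qed.

Lemma cmfunJ f : cmfun f -> cmfun (fun x => conjc (f x)).
Proof.
move=> [rf jf]; split; first by under eq_fun do rewrite Re_conj.
by under eq_fun do rewrite Im_conj; exact: measurableT_comp.
Qed.

Lemma cmfunB f g : cmfun f -> cmfun g -> cmfun (fun x => f x - g x).
Proof.
move=> mf mg; apply: (@eq_cmfun (fun x => f x + (-1) * g x)).
  by move=> x; rewrite mulN1r.
by apply: cmfunD => //; apply: cmfunM => //; exact: cmfun_cst.
Qed.

Lemma cmfun_sum I (r : seq I) (Q : pred I) (F : I -> T -> R[i]) :
  (forall i, Q i -> cmfun (F i)) -> cmfun (fun x => \sum_(i <- r | Q i) F i x).
Proof.
move=> mF; elim: r => [|i r ih].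
  by apply: (@eq_cmfun (cst 0)) => [x|]; [rewrite big_nil|exact: cmfun_cst].
case: (boolP (Q i)) => Qi; last first.
  by apply: eq_cmfun ih => x; rewrite big_cons (negbTE Qi).
apply: (@eq_cmfun (fun x => F i x + \sum_(i <- r | Q i) F i x)).
  by move=> x; rewrite big_cons Qi.
by apply: cmfunD => //; exact: mF.
Qed.

Lemma measurable_nsq f : cmfun f -> measurable_fun D (fun x => nsq (f x)).
Proof. by move=> [rf jf]; apply: measurable_funD; exact: measurable_funX. Qed.

Lemma cintegrable_cmfun f : cintegrable f -> cmfun f.
Proof. by move=> [/measurable_int/measurable_EFinP ? /measurable_int/measurable_EFinP ?]. Qed.

Lemma cintegrable_le f (h : T -> R) : cmfun f -> mu.-integrable D (EFin \o h) ->
  (forall x, D x -> `|Re (f x)| <= h x) -> (forall x, D x -> `|Im (f x)| <= h x) ->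
  cintegrable f.
Proof.
move=> [mr mi] ih rh jh; split; (apply: le_integrable ih => //; first exact/measurable_EFinP);
  by move=> x Dx /=; rewrite lee_fin (le_trans _ (ler_norm _))// ?rh ?jh.
Qed.

Lemma cintegrable_nsq_le f (h : T -> R) : cmfun f -> mu.-integrable D (EFin \o h) ->
  (forall x, D x -> 0 <= h x) -> (forall x, D x -> nsq (f x) <= h x ^+ 2) -> cintegrable f.
Proof.
move=> mf ih h0 fh; apply: (cintegrable_le mf ih) => x Dx.
- by apply: normr_Re_le; [exact: h0|exact: fh].
- by apply: normr_Im_le; [exact: h0|exact: fh].
Qed.

Lemma eq_cint f g : (forall x, D x -> f x = g x) -> cint f = cint g.
Proof.
by move=> fg; congr (_ +i* _)%C; apply: eq_Rintegral => x; rewrite inE => Dx; rewrite fg.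
Qed.

Lemma eq_cintegrable f g : (forall x, D x -> f x = g x) -> cintegrable f -> cintegrable g.
Proof.
move=> fg [rf jf]; split.
  by apply: eq_integrable rf => // x; rewrite inE => Dx /=; rewrite fg.
by apply: eq_integrable jf => // x; rewrite inE => Dx /=; rewrite fg.
Qed.

Lemma cintegrableD f g : cintegrable f -> cintegrable g -> cintegrable (fun x => f x + g x).
Proof.
move=> [rf jf] [rg jg]; split.
  have := integrableD mD rf rg; apply: eq_integrable => // x _ /=; by rewrite Re_add EFinD.
have := integrableD mD jf jg; apply: eq_integrable => // x _ /=; by rewrite Im_add EFinD.
Qed.

Lemma cintD f g : cintegrable f -> cintegrable g ->
  cint (fun x => f x + g x) = cint f + cint g.
Proof.
move=> [rf jf] [rg jg]; rewrite /cint.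
under eq_Rintegral do rewrite Re_add.
by under [in X in (_ +i* X)%C]eq_Rintegral do rewrite Im_add; rewrite !RintegralD.
Qed.

Let integrableZ (k : R) (h : T -> R) : mu.-integrable D (EFin \o h) ->
  mu.-integrable D (EFin \o (fun x => k * h x)).
Proof. by move=> ih; have := integrableZl mD k ih; apply: eq_integrable => // x _ /=; rewrite EFinM. Qed.

Lemma cintegrableZ z f : cintegrable f -> cintegrable (fun x => z * f x).
Proof.
move=> [rf jf]; split.
  have := integrableB mD (integrableZ (Re z) rf) (integrableZ (Im z) jf).
  by apply: eq_integrable => // x _ /=; rewrite Re_mul EFinB.
have := integrableD mD (integrableZ (Re z) jf) (integrableZ (Im z) rf).
by apply: eq_integrable => // x _ /=; rewrite Im_mul EFinD.
Qed.

Lemma cintZ z f : cintegrable f -> cint (fun x => z * f x) = z * cint f.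
Proof.
move=> [rf jf]; rewrite /cint; under eq_Rintegral do rewrite Re_mul.
under [in X in (_ +i* X)%C]eq_Rintegral do rewrite Im_mul.
rewrite RintegralB ?RintegralD ?RintegralZl//; try exact: integrableZ.
by case: z.
Qed.

Lemma cintegrableB f g : cintegrable f -> cintegrable g -> cintegrable (fun x => f x - g x).
Proof.
move=> fi gi; apply: (@eq_cintegrable (fun x => f x + (-1) * g x)).
  by move=> x _; rewrite mulN1r.
by apply: cintegrableD => //; exact: cintegrableZ.
Qed.

Lemma cintB f g : cintegrable f -> cintegrable g ->
  cint (fun x => f x - g x) = cint f - cint g.
Proof.
move=> fi gi; rewrite (@eq_cint _ (fun x => f x + (-1) * g x)).
  by rewrite cintD ?cintZ ?mulN1r//; exact: cintegrableZ.
by move=> x _; rewrite mulN1r.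
Qed.

Lemma cint0 : cint (cst 0) = 0.
Proof. by rewrite /cint !(Rintegral_cst mu mD) /= !mul0r. Qed.

Lemma cintegrable0 : cintegrable (cst 0).
Proof. by split; exact: integrable0. Qed.

Lemma cintegrable_sum I (r : seq I) (Q : pred I) (F : I -> T -> R[i]) :
  (forall i, Q i -> cintegrable (F i)) ->
  cintegrable (fun x => \sum_(i <- r | Q i) F i x).
Proof.
move=> iF; elim: r => [|i r ih].
  by apply: eq_cintegrable cintegrable0 => x _; rewrite big_nil.
case: (boolP (Q i)) => Qi; last first.
  by apply: eq_cintegrable ih => x _; rewrite big_cons (negbTE Qi).
apply: (@eq_cintegrable (fun x => F i x + \sum_(i <- r | Q i) F i x)).
  by move=> x _; rewrite big_cons Qi.
by apply: cintegrableD => //; exact: iF.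
Qed.

Lemma cint_sum I (r : seq I) (Q : pred I) (F : I -> T -> R[i]) :
  (forall i, Q i -> cintegrable (F i)) ->
  cint (fun x => \sum_(i <- r | Q i) F i x) = \sum_(i <- r | Q i) cint (F i).
Proof.
move=> iF; elim: r => [|i r ih].
  by rewrite big_nil -[RHS]cint0; apply: eq_cint => x _; rewrite big_nil.
rewrite big_cons; case: (boolP (Q i)) => Qi; last first.
  by rewrite -ih; apply: eq_cint => x _; rewrite big_cons (negbTE Qi).
rewrite -ih -cintD; [|exact: iF|exact: cintegrable_sum].
by apply: eq_cint => x _; rewrite big_cons Qi.
Qed.

End ComplexIntegration.

(** * Integration against a density and under an image law *)

Section Density.
Context {d d' : measure_display} {T : measurableType d} {T' : measurableType d'}.
Context {R : realType}.
Variables (mu : {measure set T -> \bar R}) (nu : {measure set T' -> \bar R}).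
Variables (Y : T -> R) (G : T -> T') (c : \bar R).
Hypotheses (mY : measurable_fun setT Y) (Y0 : forall x, 0 <= Y x).
Hypotheses (mG : measurable_fun setT G) (c_fin : c \is a fin_num).
Hypothesis YG : forall A, measurable A ->
  (\int[mu]_x (Y x * \1_A (G x))%:E = c * nu A)%E.

Import HBNNSimple.

Let nnsfun_density (h : {nnsfun T' >-> R}) :
  (\int[mu]_x (Y x * h (G x))%:E = c * \int[nu]_x (h x)%:E)%E.
Proof.
have mh r : measurable_fun setT (fun x => \1_(h @^-1` [set r]) (G x) : R).
  by apply: (@measurableT_comp _ _ _ _ _ _ (\1_(h @^-1` [set r]) : T' -> R)) => //; exact: measurable_indic.
transitivity (\int[mu]_x (\sum_(k \in range h)
    (k * (Y x * \1_(h @^-1` [set k]) (G x)))%:E))%E.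
  apply: eq_integral => x _; rewrite fsumEFin//; congr EFin.
  rewrite [in LHS]fimfunE !fsbig_finite//= mulr_sumr.
  by apply: eq_bigr => k _; rewrite mulrCA.
rewrite ge0_integral_fsum//; last 2 first.
- move=> r; apply/measurable_EFinP/measurable_funM => //.
  by apply: measurable_funM => //; exact: mh.
- move=> r x _; have [r0|r0] := leP 0 r; first by rewrite lee_fin mulr_ge0// mulr_ge0.
  by rewrite preimage_nnfun0// indic0 !mulr0.
under eq_integral do rewrite fimfunE -fsumEFin//.
rewrite ge0_integral_fsum//; last 2 first.
- by move=> r; exact/measurable_EFinP/measurableT_comp.
- by move=> n x _; rewrite EFinM nnfun_muleindic_ge0.
rewrite ge0_mule_fsumr; last first.
  by move=> r; apply: integral_ge0 => x _; rewrite EFinM nnfun_muleindic_ge0.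
apply: eq_fsbigr => r _; rewrite integralZl_indic_nnsfun// integral_indic// setIT.
have [r0|r0] := leP 0 r; last first.
  rewrite preimage_nnfun0// measure0 !mule0.
  by apply: integral0_eq => x _; rewrite indic0 !mulr0.
under eq_integral do rewrite EFinM.
rewrite ge0_integralZl ?lee_fin//; last 2 first.
- by apply/measurable_EFinP/measurable_funM => //; exact: mh.
- by move=> x _; rewrite lee_fin mulr_ge0.
by rewrite YG// muleCA.
Qed.

(** The hypothesis [YG] says that [G] carries the measure of density [Y] to [c * nu]; simple
    functions and monotone limits extend it from indicators to [f]. It serves for a density ([G] the
    identity), for the law of a random variable ([Y] equal to 1), and to isolate one of several
    independent factors ([Y] the product of the others, [c] its mean). *)
Lemma ge0_integral_density (f : T' -> R) : measurable_fun setT f ->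
  (forall y, 0 <= f y) ->
  (\int[mu]_x (Y x * f (G x))%:E = c * \int[nu]_y (f y)%:E)%E.
Proof.
move=> mf f0; have mf' : measurable_fun setT (EFin \o f) by exact/measurable_EFinP.
pose f_ := nnsfun_approx measurableT mf'.
have cf_ y : (f_ n y)%:E @[n --> \oo] --> (f y)%:E.
  by apply: cvg_nnsfun_approx => // x _; rewrite lee_fin.
have ndf x a b : (a <= b)%N -> f_ a x <= f_ b x.
  by move=> ab; exact/lefP/nd_nnsfun_approx.
transitivity (limn (fun n => \int[mu]_x (Y x * f_ n (G x))%:E))%E.
  rewrite -monotone_convergence//=.
  - apply: eq_integral => x _; apply/esym/cvg_lim => //=.
    under eq_fun do rewrite EFinM.
    by rewrite EFinM; apply: cvgeZl.
  - move=> n; apply/measurable_EFinP/measurable_funM => //.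
    exact: measurableT_comp.
  - by move=> n x _; rewrite lee_fin mulr_ge0.
  - by move=> x _ a b ab; rewrite lee_fin ler_wpM2l// ndf.
rewrite (_ : \int[nu]_y (f y)%:E = limn (fun n => \int[nu]_x (f_ n x)%:E))%E; last first.
  rewrite -monotone_convergence//=.
  - by apply: eq_integral => x _; apply/esym/cvg_lim => //; exact: cf_.
  - by move=> n; exact/measurable_EFinP/measurable_funTS.
  - by move=> n x _; rewrite lee_fin.
  - by move=> x _ a b ab; rewrite lee_fin ndf.
under [in LHS]eq_fun do rewrite nnsfun_density.
rewrite limeMl//; apply: ereal_nondecreasing_is_cvgn => a b ab; apply: ge0_le_integral => //.
- by move=> x _; rewrite lee_fin.
- exact/measurable_EFinP/measurable_funTS.
- exact/measurable_EFinP/measurable_funTS.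
- by move=> x _; rewrite lee_fin ndf.
Qed.

End Density.

(** * Independence: expectations of products of nonnegative functions *)

Section Factorization.
Context {d : measure_display} {Omega : measurableType d} {R : realType}.
Variable P : probability Omega R.
Variable nu : {measure set (measurableTypeR R * measurableTypeR R)%type -> \bar R}.
Variable X : nat -> Omega -> R[i].
Hypothesis mX : forall n, measurable_fun [set: Omega] (ReIm (X n)).
Hypothesis X_law : forall n A, measurable A -> P (ReIm (X n) @^-1` A) = nu A.
Hypothesis X_indep : independent P X.

Let mpre n (A : set (R * R)) : measurable A -> measurable (ReIm (X n) @^-1` A).
Proof. by move=> mA; rewrite -[X in measurable X]setTI; apply: mX. Qed.

Let indep_iota K (A : nat -> set (R * R)) : (forall n, measurable (A n)) ->
  P (\bigcap_(n in `I_K) (ReIm (X n) @^-1` A n)) =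
  (\prod_(n < K) P (ReIm (X n) @^-1` A n))%E.
Proof.
move=> mA; pose J : {fset nat} := [fset n in iota 0 K]%fset.
have JK : [set` J] = `I_K.
  by apply/seteqP; split => n /=; rewrite in_fset /= mem_iota add0n.
rewrite -JK X_indep// -[in RHS](big_mkord xpredT (fun n => P (ReIm (X n) @^-1` A n))).
apply: perm_big; apply: uniq_perm; rewrite ?fset_uniq ?iota_uniq//.
by move=> n; rewrite in_fset /= /index_iota subn0.
Qed.

Lemma ge0_integral_prod_indep K (h : nat -> measurableTypeR R * measurableTypeR R -> R) (F : nat -> R) :
  (forall k, measurable_fun setT (h k)) -> (forall k z, 0 <= h k z) ->
  (forall k, (\int[nu]_z (h k z)%:E = (F k)%:E)%E) ->
  (\int[P]_w (\prod_(k < K) h k (ReIm (X k) w))%:E = (\prod_(k < K) F k)%:E)%E.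
Proof.
move=> mh h0 hF.
(* Claim [j] allows arbitrary factors below [j] and indicators from [j] on; claim 0 is independence
   of events. To pass to [j.+1], all factors but the [j]-th form a density, so the [j]-th one need
   only be tested on indicators, where claim [j] applies. *)
suff claim j : forall (h : nat -> measurableTypeR R * measurableTypeR R -> R) (F : nat -> R),
    (forall k, measurable_fun setT (h k)) -> (forall k z, 0 <= h k z) ->
    (forall k, (\int[nu]_z (h k z)%:E = (F k)%:E)%E) ->
    (forall k, (j <= k < K)%N -> exists2 A, measurable A & h k = \1_A) ->
    (\int[P]_w (\prod_(k < K) h k (ReIm (X k) w))%:E = (\prod_(k < K) F k)%:E)%E.
  by apply: (claim K) => // k; case: ltngtP.
elim: j => [|j ih] {h F mh h0 hF} h F mh h0 hF hA.
  have /choice[A hAE] k : exists A, measurable A /\ ((k < K)%N -> h k = \1_A).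
    have [kK|_] := boolP (k < K)%N; last by exists set0; split.
    by have [//|A mA hk] := hA k; exists A.
  have mA k : measurable (A k) by case: (hAE k).
  transitivity (\int[P]_w (\1_(\bigcap_(n in `I_K) (ReIm (X n) @^-1` A n)) w)%:E)%E.
    apply: eq_integral => w _; congr EFin; rewrite indicE.
    case: (boolP (w \in _)) => [/set_mem wA|/negP wA].
      by rewrite big1// => k _; rewrite (hAE k).2// indicE mem_set//; exact: (wA _ (ltn_ord k)).
    apply/eqP; rewrite prodf_seq_eq0; apply/hasP.
    have [k [kK kA]] : exists k, (k < K)%N /\ ~ A k (ReIm (X k) w).
      by move: wA; rewrite inE => /existsNP[k /not_implyP[kK kA]]; exists k.
    exists (Ordinal kK); first by rewrite mem_index_enum.
    by rewrite /= (hAE k).2// indicE memNset.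
  rewrite integral_indic ?setIT//; last first.
    by apply: fin_bigcap_measurable => // k _; exact: mpre (mA k).
  apply: etrans (indep_iota K mA) _.
  rewrite (eq_bigr (fun k : 'I_K => (F k)%:E)) => [|k _].
    by elim/big_rec2: _ => // k x y _ ->; rewrite EFinM.
  apply: etrans (X_law k (mA k)) _; apply: etrans _ (hF k); rewrite (hAE k).2//.
  by rewrite integral_indic// setIT.
have [jK|Kj] := ltnP j K; last first.
  by apply: ih => // k /andP[jk kK]; move: (leq_trans Kj jk); rewrite leqNgt kK.
pose o := Ordinal jK.
under eq_integral do rewrite (bigD1 o)//= mulrC.
rewrite (bigD1 o)//= mulrC EFinM -hF.
pose Y w := \prod_(k < K | k != o) h k (ReIm (X k) w).
apply: (@ge0_integral_density _ _ _ _ _ P nu Y (ReIm (X j)) _) => //.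
- rewrite /Y; under eq_fun do rewrite -big_filter; apply: measurable_prod => k _.
  by apply: measurableT_comp => //; exact: mh.
- by move=> w; apply: prodr_ge0.
- exact: mX.
- move=> A mA.
  have mIA : measurable_fun setT (\1_A : R * R -> R) by exact: measurable_indic.
  have nuA : nu A \is a fin_num.
    rewrite -(X_law 0%N)//; apply: fin_num_measure.
    exact: mpre.
  pose h' k := if k == j then \1_A else h k.
  pose F' k := if k == j then fine (nu A) else F k.
  have := ih h' F'; rewrite /h' /F' => ih'.
  transitivity (\int[P]_w (\prod_(k < K) h' k (ReIm (X k) w))%:E)%E.
    apply: eq_integral => w _; congr EFin; rewrite [RHS](bigD1 o)//= mulrC /h' eqxx; congr (_ * _).
    by apply: eq_bigr => k ko; rewrite ifN.
  rewrite ih'.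
  + rewrite (bigD1 o)//= eqxx mulrC EFinM fineK//; congr (_%:E * _)%E.
    by apply: eq_bigr => k ko; rewrite ifN.
  + by move=> k; case: ifP.
  + by move=> k z; case: ifP.
  + by move=> k; case: ifP => // _; rewrite integral_indic// setIT fineK.
  + move=> k /andP[jk kK]; case: eqVneq => [_|kj]; first by exists A.
    by apply: hA; rewrite kK andbT ltn_neqAle jk eq_sym kj.
Qed.

End Factorization.

Section RealToComplex.
Context {d : measure_display} {T : measurableType d} {R : realType}.
Variable mu : {measure set T -> \bar R}.

Lemma cintegrable_real (h : T -> R) : mu.-integrable setT (EFin \o h) ->
  cintegrable mu setT (fun x => (h x)%:C%C).
Proof. by move=> ih; split => //; exact: integrable0. Qed.

Lemma cint_real (h : T -> R) : cint mu setT (fun x => (h x)%:C%C) =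
  (\int[mu]_x h x)%:C%C.
Proof. by rewrite /cint/= (Rintegral_cst mu measurableT) mul0r. Qed.

Lemma ge0_integral_EFin_integrable (h : T -> R) (F : R) : measurable_fun setT h ->
  (forall x, 0 <= h x) -> (\int[mu]_x (h x)%:E = F%:E)%E ->
  mu.-integrable setT (EFin \o h).
Proof.
move=> mh h0 hF; apply/integrableP; split; first exact/measurable_EFinP.
under eq_integral do rewrite /= ger0_norm//.
by rewrite hF ltry.
Qed.

End RealToComplex.

(** * Independence: expectations of products of complex functions *)

Section QuarterParts.
Context {d : measure_display} {T : measurableType d} {R : realType}.
Variable mu : {measure set T -> \bar R}.
Variable phi : T -> R[i].

(** A complex function is the combination of these four nonnegative ones with coefficients
    ['i ^+ e], so the factorization of expectations extends to complex factors by multilinearity. *)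
Definition quarter_part (e : 'I_4) (x : T) : R :=
  Num.max (nth 0 [:: Re (phi x); Im (phi x); - Re (phi x); - Im (phi x)] e) 0.

Lemma quarter_part_ge0 e x : 0 <= quarter_part e x.
Proof. by rewrite /quarter_part le_max lexx orbT. Qed.

Let maxrB (a : R) : Num.max a 0 - Num.max (- a) 0 = a.
Proof.
have [a0|a0] := leP 0 a.
  by rewrite (max_idPr _) ?oppr_le0// subr0.
by rewrite (max_idPl _) ?oppr_ge0 1?ltW// sub0r opprK.
Qed.

Lemma quarter_partE x : phi x = \sum_(e < 4) 'i%C ^+ e * (quarter_part e x)%:C%C.
Proof.
rewrite !big_ord_recl big_ord0 /quarter_part /= /bump /=.
rewrite expr0 expr1 expr2 (_ : 'i%C ^+ (1 + (1 + 1)) = - 'i%C); last first.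
  by rewrite exprD expr2; apply: complex_eqP; rewrite /=; ring.
apply: complex_eqP; rewrite /=.
  by rewrite -[LHS]maxrB; ring.
by rewrite -[LHS]maxrB; ring.
Qed.

Lemma measurable_quarter_part e : cmfun setT phi -> measurable_fun setT (quarter_part e).
Proof.
move=> [mr mi]; apply: measurable_maxr => //.
by case: e => -[|[|[|[|//]]]] /= _ //; exact: measurableT_comp.
Qed.

Lemma integrable_quarter_part e : cintegrable mu setT phi ->
  mu.-integrable setT (EFin \o quarter_part e).
Proof.
move=> iphi; have mphi := cintegrable_cmfun iphi; case: iphi => ir ii.
have : mu.-integrable setT (EFin \o (fun x => `|Re (phi x)| + `|Im (phi x)|)).
  have := integrableD measurableT (integrable_norm ir) (integrable_norm ii).
  by apply: eq_integrable.
apply: le_integrable => //.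
  exact/measurable_EFinP/measurable_quarter_part.
move=> x _; rewrite lee_fin ger0_norm ?quarter_part_ge0//.
rewrite ger0_norm ?addr_ge0// /quarter_part ge_max addr_ge0// andbT.
have a := normr_ge0 (Re (phi x)); have b := normr_ge0 (Im (phi x)).
have a1 := ler_norm (Re (phi x)); have b1 := ler_norm (Im (phi x)).
have a2 := ler_norm (- Re (phi x)); have b2 := ler_norm (- Im (phi x)).
rewrite normrN in a2; rewrite normrN in b2.
by case: e => -[|[|[|[|//]]]] /= _; lra.
Qed.

End QuarterParts.

Section ComplexFactorization.
Context {d : measure_display} {Omega : measurableType d} {R : realType}.
Variable P : probability Omega R.
Variable nu : {measure set (measurableTypeR R * measurableTypeR R)%type -> \bar R}.
Variable X : nat -> Omega -> R[i].
Hypothesis mX : forall n, measurable_fun [set: Omega] (ReIm (X n)).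
Hypothesis X_law : forall n A, measurable A -> P (ReIm (X n) @^-1` A) = nu A.
Hypothesis X_indep : independent P X.

Lemma cint_prod_indep K (phi : nat -> measurableTypeR R * measurableTypeR R -> R[i]) :
  (forall k, cintegrable nu setT (phi k)) ->
  cintegrable P setT (fun w => \prod_(k < K) phi k (ReIm (X k) w)) /\
  cint P setT (fun w => \prod_(k < K) phi k (ReIm (X k) w)) =
    \prod_(k < K) cint nu setT (phi k).
Proof.
move=> iphi.
pose H k e := quarter_part (phi k) e.
pose F k e := (\int[nu]_z H k e z).
have iH k e : nu.-integrable setT (EFin \o H k e) by exact: integrable_quarter_part.
have H0 k e z : 0 <= H k e z by exact: quarter_part_ge0.
have mH k e : measurable_fun setT (H k e).
  exact/measurable_quarter_part/(cintegrable_cmfun (iphi k)).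
have HF k e : (\int[nu]_z (H k e z)%:E = (F k e)%:E)%E.
  by rewrite /F /Rintegral fineK//; exact: integrable_fin_num (iH k e).
(* The nonnegative factorization takes families indexed by all naturals; the value [ord0] beyond [K]
   is a dummy. *)
pose ext (f : {ffun 'I_K -> 'I_4}) k : 'I_4 := oapp f ord0 (insub k).
have extE f (k : 'I_K) : ext f k = f k by rewrite /ext valK.
have intf (f : {ffun 'I_K -> 'I_4}) :
    (\int[P]_w (\prod_(k < K) H k (f k) (ReIm (X k) w))%:E =
     (\prod_(k < K) F k (f k))%:E)%E.
  rewrite (eq_bigr (fun k : 'I_K => F k (ext f k))) => [|k _]; last by rewrite extE.
  rewrite -(@ge0_integral_prod_indep _ _ _ P nu X mX X_law X_indep K _ _ (fun k => mH k (ext f k)) (fun k => H0 k (ext f k)) (fun k => HF k (ext f k)))//.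
  by apply: eq_integral => w _; congr EFin; apply: eq_bigr => k _; rewrite extE.
have mf (f : {ffun 'I_K -> 'I_4}) :
    measurable_fun setT (fun w => \prod_(k < K) H k (f k) (ReIm (X k) w)).
  by apply: measurable_prod => k _; apply: measurableT_comp => //; exact: mH.
have if_ (f : {ffun 'I_K -> 'I_4}) :
    P.-integrable setT (EFin \o (fun w => \prod_(k < K) H k (f k) (ReIm (X k) w))).
  by apply: ge0_integral_EFin_integrable (intf f) => // w; exact: prodr_ge0.
pose term (f : {ffun 'I_K -> 'I_4}) w : R[i] := (\prod_(k < K) 'i%C ^+ (f k)) *
  (\prod_(k < K) H k (f k) (ReIm (X k) w))%:C%C.
have prodE w : \prod_(k < K) phi k (ReIm (X k) w) =
    \sum_(f : {ffun 'I_K -> 'I_4}) term f w.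
  rewrite (eq_bigr (fun k : 'I_K => \sum_(e < 4) 'i%C ^+ e * (H k e (ReIm (X k) w))%:C%C)).
    rewrite bigA_distr_bigA/=; apply: eq_bigr => f _.
    by rewrite big_split/=; congr (_ * _); rewrite rmorph_prod.
  by move=> k _; rewrite -quarter_partE.
have iterm f : cintegrable P setT (term f).
  by apply: cintegrableZ => //; exact: cintegrable_real.
split.
  apply: (eq_cintegrable measurableT (f := fun w => \sum_f term f w)).
    by move=> w _; rewrite prodE.
  exact: cintegrable_sum.
rewrite (@eq_cint _ _ _ _ _ _ (fun w => \sum_f term f w)); last by move=> w _; rewrite prodE.
rewrite cint_sum//.
transitivity (\prod_(k < K) \sum_(e < 4) 'i%C ^+ e * (F k e)%:C%C); last first.
  apply: eq_bigr => k _.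
  rewrite (@eq_cint _ _ _ _ _ _ (fun z => \sum_(e < 4) 'i%C ^+ e * (H k e z)%:C%C)); last first.
    by move=> z _; exact: quarter_partE.
  rewrite cint_sum//; last first.
    by move=> e _; apply: cintegrableZ => //; exact: cintegrable_real.
  by apply: eq_bigr => e _; rewrite cintZ ?cint_real//; exact: cintegrable_real.
rewrite bigA_distr_bigA/=; apply: eq_bigr => f _.
rewrite cintZ//; last exact: cintegrable_real.
rewrite cint_real big_split/=; congr (_ * _).
by rewrite /Rintegral intf /= rmorph_prod.
Qed.

End ComplexFactorization.

(** * The complex Gaussian law: absolute moments *)

Section GaussianPlane.
Variable R : realType.
Variable s : R.
Hypothesis s_gt0 : 0 < s.

Local Notation N := (normal_prob (0 : R) s).
Local Notation leb := (@lebesgue_measure R).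

Let s_neq0 : s != 0. Proof. by rewrite gt_eqF. Qed.

Lemma integral_normal_prob (f : R -> R) : measurable_fun setT f -> (forall x, 0 <= f x) ->
  (\int[N]_x (f x)%:E = \int[leb]_x (normal_pdf 0 s x * f x)%:E)%E.
Proof.
move=> mf f0; rewrite -[LHS]mul1e; apply/esym.
apply: (@ge0_integral_density _ _ _ _ _ leb N (normal_pdf 0 s) id 1%E) => //.
- exact: measurable_normal_pdf.
- by move=> x; exact: normal_pdf_ge0.
- move=> A mA; rewrite mul1e /normal_prob [RHS]integral_mkcond.
  apply: eq_integral => x _; rewrite patchE indicE.
  by case: ifP => _; rewrite ?mulr1 ?mulr0.
Qed.

Lemma normal_prob_sym (A : set R) : measurable A -> N [set x | A (- x)] = N A.
Proof.
move=> mA.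
have mNA : measurable [set x : R | A (- x)].
  by rewrite -[X in measurable X]setTI; apply: (@oppr_measurable R setT).
have mpdf := measurable_normal_pdf (0 : R) s.
rewrite /normal_prob.
transitivity (\int[pushforward leb (-%R : _ -> measurableTypeR R)]_(x in A)
    (normal_pdf 0 s x)%:E)%E; last first.
  by apply: eq_measure_integral => B mB _; exact: lebesgue_measureN.
rewrite ge0_integral_pushforward//=; last 2 first.
- exact/measurable_EFinP/measurable_funTS.
- by move=> x _; rewrite lee_fin normal_pdf_ge0.
by apply: eq_integral => x _ /=; rewrite !normal_pdfE// /normal_fun !subr0 sqrrN.
Qed.

Lemma exprD_le (a b : R) m : 0 <= a -> 0 <= b ->
  (a + b) ^+ m <= (2 * a) ^+ m + (2 * b) ^+ m.
Proof.
move=> a0 b0; have [ab|ba] := leP a b.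
  apply: (@le_trans _ _ ((2 * b) ^+ m)).
    by apply: lerXn2r; rewrite ?nnegrE ?addr_ge0 ?mulr_ge0//; lra.
  by rewrite lerDr exprn_ge0 ?mulr_ge0.
apply: (@le_trans _ _ ((2 * a) ^+ m)).
  by apply: lerXn2r; rewrite ?nnegrE ?addr_ge0 ?mulr_ge0//; lra.
by rewrite lerDl exprn_ge0 ?mulr_ge0.
Qed.

Lemma expR_ge_pow (u : R) m : 0 <= u -> u ^+ m <= m`!%:R * expR u.
Proof.
move=> u0; case: m => [|m]; first by rewrite expr0 fact0 mul1r -expR0 ler_expR.
have := expR_ge1Dxn m u0 => h.
have f0 : 0 < (m.+1)`!%:R :> R by rewrite ltr0n fact_gt0.
rewrite mulrC -ler_pdivrMr//; apply: le_trans h.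
by rewrite lerDr.
Qed.

Lemma normal_moment m : (\int[N]_x (x ^+ (2 * m))%:E < +oo)%E.
Proof.
have even0 (x : R) : 0 <= x ^+ (2 * m) by rewrite exprM exprn_ge0 ?sqr_ge0.
have mev : measurable_fun setT (fun x : R => x ^+ (2 * m)) by exact: exprn_measurable.
rewrite (integral_normal_prob mev even0).
have s2 : 2 * s != 0 by rewrite mulf_neq0.
(* Comparison with the density of deviation [2 * s]. With y = x^2 / (2 s^2) it decays like exp (- y
   / 4) instead of exp (- y), and the gain exp (- 3 y / 4) absorbs x^(2m) = (8/3 s^2)^m (3/4 y)^m at
   the cost of a factorial. *)
pose C := normal_peak s / normal_peak (2 * s) * ((8 / 3 * s ^+ 2) ^+ m * m`!%:R).
have pk2 := normal_peak_gt0 s2.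
have pk1 := normal_peak_gt0 s_neq0.
have C0 : 0 <= C.
  by rewrite mulr_ge0 ?divr_ge0 ?ltW// mulr_gt0 ?ltr0n ?fact_gt0// exprn_gt0// !mulr_gt0.
apply: (@le_lt_trans _ _ (\int[leb]_x (C%:E * (normal_pdf 0 (2 * s) x)%:E))%E); last first.
  rewrite ge0_integralZl//; last 2 first.
  - by apply/measurable_EFinP; exact: measurable_normal_pdf.
  - by move=> x _; rewrite lee_fin normal_pdf_ge0.
  by rewrite integral_normal_pdf// mule1 ltry.
apply: ge0_le_integral => //.
- by move=> x _; rewrite lee_fin mulr_ge0// normal_pdf_ge0.
- apply/measurable_EFinP; apply: measurable_funM; first exact: measurable_normal_pdf.
  exact: exprn_measurable.
- apply/measurable_EFinP; apply: measurable_funM => //; exact: measurable_normal_pdf.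
move=> x _; rewrite -EFinM lee_fin !normal_pdfE//.
set y := x ^+ 2 / (s ^+ 2 *+ 2).
have y0 : 0 <= y by rewrite divr_ge0 ?sqr_ge0// mulrn_wge0 ?sqr_ge0.
have e1 : normal_fun 0 s x = expR (- y) by rewrite /normal_fun subr0 mulNr.
have e2 : normal_fun 0 (2 * s) x = expR (- (y / 4)).
  by rewrite /normal_fun subr0 mulNr /y; congr (expR (- _)); field.
have xE : x ^+ (2 * m) = (8 / 3 * s ^+ 2) ^+ m * (3 / 4 * y) ^+ m.
  by rewrite -exprMn exprM /y; congr (_ ^+ m); field.
have eE : expR (- (y / 4)) = expR (- y) * expR (3 / 4 * y).
  by rewrite -expRD; congr expR; field.
rewrite e1 e2 xE eE /C.
set q := (_ * s ^+ 2) ^+ m; have q0 : 0 <= q by rewrite exprn_ge0// mulr_ge0 ?sqr_ge0// divr_ge0.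
have hu : (3 / 4 * y) ^+ m <= m`!%:R * expR (3 / 4 * y).
  by apply: expR_ge_pow; rewrite mulr_ge0.
rewrite [leRHS](_ : _ = normal_peak s * expR (- y) * (q * (m`!%:R * expR (3 / 4 * y)))); last first.
  by field; rewrite gt_eqF.
by rewrite ler_wpM2l ?ler_wpM2l ?mulr_ge0 ?expR_ge0// ltW.
Qed.

Local Notation nu := (N \x N)%E.

Let NT : N [set: R] = 1%E. Proof. exact: probability_setT. Qed.

Lemma nu_setT : nu [set: R * R] = 1%E.
Proof. by rewrite -setXTT product_measure1E//= NT mule1. Qed.

Let nuX A B : measurable A -> measurable B -> nu (A `*` B) = (N A * N B)%E.
Proof. exact: product_measure1E. Qed.

Definition zc (z : R * R) : R[i] := (z.1 +i* z.2)%C.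

Lemma cmfun_zc : cmfun setT zc.
Proof. by split => /=; [exact: measurable_fst|exact: measurable_snd]. Qed.

Let integral_fst (h : R -> R) : measurable_fun setT h -> (forall x, 0 <= h x) ->
  (\int[nu]_z (h z.1)%:E = \int[N]_x (h x)%:E)%E.
Proof.
move=> mh h0; rewrite -[RHS]mul1e.
have := @ge0_integral_density _ _ _ _ _ nu N (cst 1) fst 1%E => /= H.
under eq_integral do rewrite -[h _]mul1r.
apply: H => // A mA; under eq_integral do rewrite mul1r.
transitivity (\int[nu]_z (\1_(A `*` setT) z)%:E)%E.
  by apply: eq_integral => z _; rewrite !indicE in_setX in_setT andbT.
rewrite integral_indic ?setIT//; last exact: measurableX.
by apply: etrans (nuX mA measurableT) _; rewrite NT mule1 mul1e.
Qed.

Let integral_snd (h : R -> R) : measurable_fun setT h -> (forall x, 0 <= h x) ->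
  (\int[nu]_z (h z.2)%:E = \int[N]_x (h x)%:E)%E.
Proof.
move=> mh h0; rewrite -[RHS]mul1e.
have := @ge0_integral_density _ _ _ _ _ nu N (cst 1) snd 1%E => /= H.
under eq_integral do rewrite -[h _]mul1r.
apply: H => // A mA; under eq_integral do rewrite mul1r.
transitivity (\int[nu]_z (\1_(setT `*` A) z)%:E)%E.
  by apply: eq_integral => z _; rewrite !indicE in_setX in_setT.
rewrite integral_indic ?setIT//; last exact: measurableX.
by apply: etrans (nuX measurableT mA) _; rewrite NT mul1e.
Qed.

Lemma gaussian_moment m : nu.-integrable setT (EFin \o (fun z => nsq (zc z) ^+ m)).
Proof.
have mn : measurable_fun setT (fun z : R * R => nsq (zc z) ^+ m).
  by apply: measurable_funX; apply: measurable_nsq; exact: cmfun_zc.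
apply/integrableP; split; first exact/measurable_EFinP.
have even0 (x : R) : 0 <= x ^+ (2 * m) by rewrite exprM exprn_ge0 ?sqr_ge0.
have mev : measurable_fun setT (fun x : R => x ^+ (2 * m)) by exact: exprn_measurable.
pose C : R := 2 ^+ m.
apply: (@le_lt_trans _ _ (\int[nu]_z (C%:E * ((z.1 ^+ (2 * m))%:E + (z.2 ^+ (2 * m))%:E)))%E).
  apply: ge0_le_integral => //.
  - exact/measurable_EFinP/measurableT_comp.
  - apply/measurable_EFinP; apply: measurable_funM => //; apply: measurable_funD => //.
      by apply: measurable_funX; exact: measurable_fst.
    by apply: measurable_funX; exact: measurable_snd.
  move=> [a b] _; rewrite /= -EFinD -EFinM lee_fin ger0_norm ?exprn_ge0 ?nsq_ge0//.
  rewrite /nsq /= !exprM /C mulrDr -!exprMn.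
  by apply: exprD_le; exact: sqr_ge0.
rewrite ge0_integralZl ?lee_fin ?exprn_ge0//; last 2 first.
- apply/measurable_EFinP; apply: measurable_funD => //.
    by apply: measurable_funX; exact: measurable_fst.
  by apply: measurable_funX; exact: measurable_snd.
- by move=> z _; rewrite -EFinD lee_fin addr_ge0.
rewrite ge0_integralD//; last 4 first.
- by move=> z _; rewrite lee_fin.
- by apply/measurable_EFinP; apply: measurable_funX; exact: measurable_fst.
- by move=> z _; rewrite lee_fin.
- by apply/measurable_EFinP; apply: measurable_funX; exact: measurable_snd.
rewrite (integral_fst mev)// (integral_snd mev)//.
have i0 : (0 <= \int[N]_x (x ^+ (2 * m))%:E)%E.
  by apply: integral_ge0 => x _; rewrite lee_fin.
have fin : (\int[N]_x (x ^+ (2 * m))%:E)%E \is a fin_num.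
  by rewrite ge0_fin_numE// normal_moment.
by rewrite -(fineK fin) -EFinD -EFinM ltry.
Qed.

(** Multiplication by ['i]. The preimage of a rectangle is a rectangle, so invariance of the product
    law can be checked on rectangles, by uniqueness of the product measure. *)
Definition quarter_turn (z : measurableTypeR R * measurableTypeR R) :
  measurableTypeR R * measurableTypeR R := (- z.2, z.1).

Lemma measurable_quarter_turn : measurable_fun setT quarter_turn.
Proof.
apply: measurable_fun_pair; last exact: measurable_fst.
by apply: measurable_funN; exact: measurable_snd.
Qed.

End GaussianPlane.

(** * The complex Gaussian law: quarter turn, mixed moments, variance *)

Section GaussianPlaneRotation.
Variable R : realType.
Variable s : R.
Hypothesis s_gt0 : 0 < s.

Local Notation N := (normal_prob (0 : R) s).
Local Notation nu := (N \x N)%E.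

Let nuX A B : measurable A -> measurable B -> nu (A `*` B) = (N A * N B)%E.
Proof. exact: product_measure1E. Qed.

Lemma quarter_turn_preserving A : measurable A -> nu ((@quarter_turn R) @^-1` A) = nu A.
Proof.
move=> mA; apply/esym.
pose m' : {measure set (measurableTypeR R * measurableTypeR R)%type -> \bar R} := pushforward nu (@quarter_turn R).
have H := @product_measure_unique _ _ _ _ _ N N (m' (@measurable_quarter_turn R)).
refine (H _ A mA) => {H} B C mB mC.
have mNB : measurable [set x : R | B (- x)].
  by rewrite -[X in measurable X]setTI; apply: (@oppr_measurable R setT).
have E : @quarter_turn R @^-1` (B `*` C) = C `*` [set x | B (- x)].
  by apply/seteqP; split => -[x y] /= [].
apply: etrans (congr1 nu E) _; apply: etrans (nuX mC mNB) _.
by rewrite normal_prob_sym// muleC.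
Qed.

Definition monomial p q (z : measurableTypeR R * measurableTypeR R) : R[i] := zc z ^+ p * conjc (zc z) ^+ q.

Lemma nsqX (z : R[i]) n : nsq (z ^+ n) = nsq z ^+ n.
Proof.
elim: n => [|n ih]; first by rewrite !expr0 /nsq/= expr0n expr1n addr0.
by rewrite !exprS nsqM ih.
Qed.

Lemma nsq_monomial p q z : nsq (monomial p q z) = nsq (zc z) ^+ (p + q).
Proof. by rewrite /monomial nsqM !nsqX nsqJ exprD. Qed.

Lemma cmfun_monomial p q : cmfun setT (monomial p q).
Proof.
have mX (f : measurableTypeR R * measurableTypeR R -> R[i]) n : cmfun setT f -> cmfun setT (fun z => f z ^+ n).
  move=> mf; elim: n => [|n ih].
    by apply: (@eq_cmfun _ _ _ _ (cst 1)) => [z|]; [rewrite expr0|exact: cmfun_cst].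
  by apply: (@eq_cmfun _ _ _ _ (fun z => f z * f z ^+ n)) => [z|]; [rewrite exprS|exact: cmfunM].
by apply: cmfunM; apply: mX; [exact: cmfun_zc|apply: cmfunJ; exact: cmfun_zc].
Qed.

Let integrable_bound m : nu.-integrable setT (EFin \o (fun z => 1 + nsq (zc z) ^+ m)).
Proof.
have i1 : nu.-integrable setT (EFin \o cst 1).
  apply/integrableP; split; first exact/measurable_EFinP.
  under eq_integral do rewrite /= normr1.
  rewrite integral_cst// mul1e.
  by apply: le_lt_trans (ltry 1); rewrite le_eqVlt; apply/orP; left; apply/eqP; exact: nu_setT.
have := integrableD measurableT i1 (gaussian_moment s_gt0 m).
by apply: eq_integrable => // x _ /=; rewrite EFinD.
Qed.

Let le_1D_sqr (t : R) : 0 <= t -> t <= (1 + t) ^+ 2.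
Proof. by move=> t0; nra. Qed.

Lemma cintegrable_monomial p q : cintegrable nu setT (monomial p q).
Proof.
apply: (cintegrable_nsq_le measurableT (cmfun_monomial p q) (integrable_bound (p + q))) => z _.
  by rewrite addr_ge0 ?exprn_ge0 ?nsq_ge0.
by rewrite nsq_monomial; apply: le_1D_sqr; rewrite exprn_ge0 ?nsq_ge0.
Qed.

(** As the conjugate of ['i] is ['i ^+ 3], the natural number [p + 3 * q] stands for p - q modulo
    4. *)
Let monomial_rot p q z : monomial p q (quarter_turn z) = 'i%C ^+ (p + 3 * q) * monomial p q z.
Proof.
have E1 : zc (quarter_turn z) = 'i%C * zc z.
  by case: z => x y; apply: complex_eqP; rewrite /=; ring.
have E2 u : conjc ('i%C * u) = 'i%C ^+ 3 * conjc u :> R[i].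
  by case: u => x y; apply: complex_eqP; rewrite /=; ring.
by rewrite /monomial E1 E2 (exprD _ p) (exprM _ 3) exprMn exprMn; ring.
Qed.

Lemma iX_neq1 k : (k %% 4 != 0)%N -> 'i%C ^+ k != 1 :> R[i].
Proof.
have i2 : 'i%C ^+ 2 = - 1 :> R[i] by exact: sqr_i.
have i4 : 'i%C ^+ 4 = 1 :> R[i] by rewrite (exprM _ 2 2) i2 sqrrN expr1n.
rewrite -(expr_mod _ i4).
have : (k %% 4 < 4)%N by rewrite ltn_pmod.
case: (k %% 4)%N => [//|[_ _|[_ _|[_ _|//]]]].
- by apply/eqP => -[] /eqP; rewrite eq_sym oner_eq0.
- by rewrite i2; apply/eqP => -[] h; lra.
- by rewrite exprS i2 mulrN1; apply/eqP => -[] /eqP; rewrite oppr0 eq_sym oner_eq0.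
Qed.

(** The quarter turn preserves the law and multiplies the monomial by a power of ['i] other than 1;
    an integral equal to such a multiple of itself vanishes. *)
Lemma cint_monomial_eq0 p q : ((p + 3 * q) %% 4 != 0)%N -> cint nu setT (monomial p q) = 0.
Proof.
move=> pq.
have int_rot (h : measurableTypeR R * measurableTypeR R -> R) : measurable_fun setT h ->
    nu.-integrable setT (EFin \o (h \o (@quarter_turn R))) ->
    \int[nu]_z h z = \int[nu]_z h (quarter_turn z).
  move=> mh ih; congr fine.
  have mh' : measurable_fun setT (EFin \o h) by exact/measurable_EFinP.
  have H := @integral_pushforward _ _ _ _ R _ (@measurable_quarter_turn R) nu setT _ mh' ih measurableT.
  apply: etrans _ H; apply: eq_measure_integral => [|mq A mA _]; first exact: measurable_quarter_turn.
  by rewrite /= -[LHS](quarter_turn_preserving mA).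
have [ir ii] : cintegrable nu setT (monomial p q \o (@quarter_turn R)).
  apply: (@eq_cintegrable _ _ _ _ _ measurableT (fun z => 'i%C ^+ (p + 3 * q) * monomial p q z)).
    by move=> z _ /=; rewrite monomial_rot.
  by apply: cintegrableZ => //; exact: cintegrable_monomial.
have [mr mi] := cmfun_monomial p q.
have turned : cint nu setT (monomial p q \o (@quarter_turn R)) = cint nu setT (monomial p q).
  have er := int_rot (fun z => Re (monomial p q z)) mr ir.
  have ei := int_rot (fun z => Im (monomial p q z)) mi ii.
  by rewrite /cint er ei.
have scaled := cintZ measurableT ('i%C ^+ (p + 3 * q)) (cintegrable_monomial p q).
have : cint nu setT (monomial p q) = 'i%C ^+ (p + 3 * q) * cint nu setT (monomial p q).
  apply: etrans (esym turned) _; apply: etrans _ scaled.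
  by apply: eq_cint => z _ /=; rewrite monomial_rot.
move=> /eqP; rewrite -subr_eq0 -[X in X - _]mul1r -mulrBl mulf_eq0 => /orP[|/eqP//].
by rewrite subr_eq0 eq_sym (negbTE (iX_neq1 pq)).
Qed.

(** Were the integral zero, the law would be carried by the origin, hence by the line [Z], which is
    null because the first marginal has a density. *)
Lemma gaussian_variance_gt0 : 0 < \int[nu]_z nsq (zc z).
Proof.
have mn : measurable_fun setT (fun z : measurableTypeR R * measurableTypeR R => nsq (zc z)).
  by apply: measurable_nsq; exact: cmfun_zc.
have mn' : measurable_fun setT
    (fun z : measurableTypeR R * measurableTypeR R => (nsq (zc z))%:E).
  exact/measurable_EFinP.
have [_ int_fin] := integrableP _ _ _ (gaussian_moment s_gt0 1).
have abs_fin : (\int[nu]_z `|(nsq (zc z))%:E| < +oo)%E by [].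
rewrite lt_neqAle Rintegral_ge0 ?andbT; last by move=> z _; exact: nsq_ge0.
apply/negP => /eqP/esym int0.
have : (\int[nu]_z `|(nsq (zc z))%:E| = 0)%E.
  rewrite -[LHS]fineK; last first.
    by rewrite ge0_fin_numE//; apply: integral_ge0.
  congr EFin; rewrite -[RHS]int0; congr fine.
  by apply: eq_integral => z _; rewrite gee0_abs// lee_fin nsq_ge0.
move=> /(ae_eq_integral_abs nu measurableT mn')[B [mB B0 nB]].
have N0 : N [set 0] = 0%E.
  rewrite /normal_prob; apply: null_set_integral => //; last exact: lebesgue_measure_set1.
  by apply/measurable_EFinP/measurable_funTS; exact: measurable_normal_pdf.
pose Z : set (measurableTypeR R * measurableTypeR R) := [set 0] `*` setT.
have mZ : measurable Z by exact: measurableX.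
have : (nu [set: R * R] <= nu (B `|` Z))%E.
  apply: le_measure; rewrite ?inE//.
    exact: measurableU.
  move=> [x y] _; have [n0|n0] := pselect (nsq (zc (x, y)) = 0).
    right; split => //=; move: n0; rewrite /nsq /= => /eqP.
    by rewrite paddr_eq0 ?sqr_ge0// sqrf_eq0 => /andP[/eqP].
  by left; apply: nB => /= h; apply: n0; have [] := h Logic.I.
have nu0 : nu (B `|` Z) = 0%E.
  apply/eqP; rewrite eq_le measure_ge0 andbT.
  have m0 : measurable [set (0 : R)] by [].
  have e0 : nu Z = 0%E by apply: etrans (nuX m0 measurableT) _; rewrite N0 mul0e.
  have leB : (nu B <= 0)%E := eq_ind_r (fun x => (x <= 0)%E) (lexx 0%E) B0.
  have leZ : (nu Z <= 0)%E := eq_ind_r (fun x => (x <= 0)%E) (lexx 0%E) e0.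
  by apply: le_trans (measureU2 nu mB mZ) _; rewrite -[leRHS]adde0; exact: leeD.
by rewrite nu0 nu_setT lee_fin ler10.
Qed.

End GaussianPlaneRotation.

(** * Second moments of sums whose terms have few correlations *)

Section SecondMoment.
Context {d : measure_display} {T : measurableType d} {R : realType}.
Variable mu : {measure set T -> \bar R}.

Lemma nsq_sum (I : finType) (Q : pred I) (F : I -> R[i]) :
  nsq (\sum_(i | Q i) F i) = \sum_(i | Q i) \sum_(j | Q j) Re (F i * conjc (F j)).
Proof.
transitivity (Re ((\sum_(i | Q i) F i) * conjc (\sum_(i | Q i) F i))).
  by rewrite mulcJ.
rewrite rmorph_sum /= mulr_suml Re_sum; apply: eq_bigr => i _.
by rewrite mulr_sumr Re_sum.
Qed.

Lemma normr_Re_mulJ_le (x y : R[i]) : `|Re (x * conjc y)| <= (nsq x + nsq y) / 2.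
Proof.
case: x y => a b [a' b']; rewrite /nsq /= ler_norml.
have := sqr_ge0 (a - a'); have := sqr_ge0 (a + a').
have := sqr_ge0 (b - b'); have := sqr_ge0 (b + b').
by move=> ? ? ? ?; apply/andP; split; lra.
Qed.

Let mul_le_mean_sqr (a b s c : R) : s <= c -> - c <= s ->
  a * b * s <= c * (a ^+ 2 + b ^+ 2) / 2.
Proof.
move=> s1 s2; have k1 := sqr_ge0 (a - b); have k2 := sqr_ge0 (a + b).
by have [kk|kk] := leP 0 (a * b); nra.
Qed.

Variables (I : finType) (Q : pred I) (Z : I -> T -> R[i]).
Hypothesis mZ : forall i, cmfun setT (Z i).
Hypothesis iZ : forall i, mu.-integrable setT (EFin \o (fun x => nsq (Z i x))).

Let mRe i j : measurable_fun setT (fun x => Re (Z i x * conjc (Z j x))).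
Proof. by have [] : cmfun setT (fun x => Z i x * conjc (Z j x)) by apply: cmfunM => //; exact: cmfunJ. Qed.

Let iRe i j : mu.-integrable setT (EFin \o (fun x => Re (Z i x * conjc (Z j x)))).
Proof.
have i2 := integrableZl measurableT 2^-1 (integrableD measurableT (iZ i) (iZ j)).
apply: le_integrable i2 => //; first exact/measurable_EFinP.
move=> x _; rewrite /= lee_fin (le_trans (normr_Re_mulJ_le _ _))// mulrC.
exact: ler_norm.
Qed.

Variables (kap : I -> R) (C : R) (r : rel I) (m : nat).
Hypothesis C_ub : forall i, \int[mu]_x nsq (Z i x) <= C.
Hypothesis r_sym : symmetric r.
Hypothesis Z_orth : forall i j, Q i -> Q j -> ~~ r i j ->
  \int[mu]_x Re (Z i x * conjc (Z j x)) = 0.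
Hypothesis r_card : forall i, Q i -> (#|[pred j | Q j && r i j]| <= m)%N.

Let Re_ub i j : \int[mu]_x Re (Z i x * conjc (Z j x)) <= C /\
  - C <= \int[mu]_x Re (Z i x * conjc (Z j x)).
Proof.
have hD : mu.-integrable setT (EFin \o (fun x => nsq (Z i x) + nsq (Z j x))).
  by have := integrableD measurableT (iZ i) (iZ j); apply: eq_integrable.
have h2 : mu.-integrable setT (EFin \o (fun x => 2^-1 * (nsq (Z i x) + nsq (Z j x)))).
  by have := integrableZl measurableT 2^-1 hD; apply: eq_integrable.
have : `|\int[mu]_x Re (Z i x * conjc (Z j x))| <= C.
  apply: le_trans (le_normr_Rintegral measurableT (iRe i j)) _.
  apply: (@le_trans _ _ (\int[mu]_x (2^-1 * (nsq (Z i x) + nsq (Z j x))))).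
    apply: le_Rintegral => //; first exact: integrable_norm.
    by move=> x _; rewrite [leRHS]mulrC normr_Re_mulJ_le.
  rewrite RintegralZl// RintegralD//; have := C_ub i; have := C_ub j; lra.
by rewrite ler_norml => /andP[? ?].
Qed.

(* Schur's test: every Z i is correlated with at most m of the Z j. *)
Lemma second_moment_le :
  (\int[mu]_x (nsq (\sum_(i | Q i) (kap i)%:C%C * Z i x))%:E <=
   (m%:R * C * \sum_(i | Q i) kap i ^+ 2)%:E)%E.
Proof.
pose S i j := \int[mu]_x Re (Z i x * conjc (Z j x)).
have scaled_Re x i j : Re ((kap i)%:C%C * Z i x * conjc ((kap j)%:C%C * Z j x)) =
    kap i * kap j * Re (Z i x * conjc (Z j x)).
  by case: (Z i x) (Z j x) => a b [a' b'] /=; ring.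
rewrite [leLHS](_ : _ = (\sum_(i | Q i) \sum_(j | Q j) kap i * kap j * S i j)%:E); last first.
  under eq_integral do rewrite nsq_sum -sumEFin.
  have icol i j : mu.-integrable setT (EFin \o (fun x => kap i * kap j * Re (Z i x * conjc (Z j x)))).
    have := integrableZl measurableT (kap i * kap j) (iRe i j).
    by apply: eq_integrable => // x _ /=; rewrite EFinM.
  have irow i : mu.-integrable setT (EFin \o (fun x =>
      \sum_(j | Q j) kap i * kap j * Re (Z i x * conjc (Z j x)))).
    have := integrable_sum measurableT (index_enum I) (fun j (_ : Q j) => icol i j).
    by apply: eq_integrable => // x _ /=; rewrite sumEFin.
  under eq_integral => x _ do (under eq_bigr => i _ do under eq_bigr => j _ do rewrite scaled_Re).
  rewrite (integral_sum measurableT); last by move=> i; exact: irow.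
  rewrite -sumEFin; apply: eq_bigr => i _.
  under eq_integral do rewrite -sumEFin.
  rewrite (integral_sum measurableT); last by move=> j; exact: icol.
  rewrite -sumEFin; apply: eq_bigr => j _.
  have e := integralZl measurableT (iRe i j) (kap i * kap j).
  rewrite [RHS]EFinM /S /Rintegral fineK; last exact: integrable_fin_num (iRe i j).
  by apply: etrans _ e; apply: eq_integral => x _; rewrite /= EFinM.
rewrite lee_fin.
have C0 (i : I) : 0 <= C by have [] := Re_ub i i; lra.
have bound i j : Q i -> Q j ->
    kap i * kap j * S i j <= (r i j)%:R * (C * (kap i ^+ 2 + kap j ^+ 2) / 2).
  move=> Qi Qj; have [rij|/(Z_orth Qi Qj) rij] := boolP (r i j); last first.
    by rewrite /S rij mulr0 mul0r.
  rewrite mul1r; have := Re_ub i j; rewrite -/(S i j) => -[s1 s2].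
  by apply: mul_le_mean_sqr.
apply: (@le_trans _ _ (\sum_(i | Q i) \sum_(j | Q j)
    (r i j)%:R * (C * (kap i ^+ 2 + kap j ^+ 2) / 2))).
  by apply: ler_sum => i Qi; apply: ler_sum => j Qj; exact: bound.
(* By symmetry of [r] both squares lead to the same double sum [W], in which each [kap i ^+ 2]
   occurs at most [m] times. *)
pose W := \sum_(i | Q i) \sum_(j | Q j) (r i j)%:R * kap i ^+ 2.
have -> : \sum_(i | Q i) \sum_(j | Q j) (r i j)%:R * (C * (kap i ^+ 2 + kap j ^+ 2) / 2)
    = C * W.
  transitivity (C / 2 * (W + \sum_(i | Q i) \sum_(j | Q j) (r i j)%:R * kap j ^+ 2)).
    rewrite /W -big_split /= mulr_sumr; apply: eq_bigr => i _.
    rewrite -big_split /= mulr_sumr; by apply: eq_bigr => j _; field.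
  have -> : \sum_(i | Q i) \sum_(j | Q j) (r i j)%:R * kap j ^+ 2 = W.
    rewrite exchange_big /=; apply: eq_bigr => i _; apply: eq_bigr => j _.
    by rewrite r_sym.
  by field.
(* Nonnegativity of [C] is read off from an index, so the empty sum is treated apart. *)
case: (pickP Q) => [i0 Qi0|Q0]; last first.
  by rewrite /W !big_pred0// !mulr0.
rewrite mulrAC mulrC ler_wpM2r//; first exact: C0.
rewrite mulr_sumr; apply: ler_sum => i Qi.
rewrite -mulr_suml ler_wpM2r ?sqr_ge0//.
rewrite -natr_sum ler_nat; apply: leq_trans (r_card Qi).
rewrite -sum1_card big_mkcond /= [leqRHS]big_mkcond /=.
by apply: leq_sum => j _; rewrite inE; case: (Q j); case: (r i j).
Qed.

End SecondMoment.

(** * Words in the Gaussian variables and their expectations *)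

Section Words.
Variable R : realType.
Implicit Types (s t : seq (nat * bool)) (z : nat -> R[i]).

(* The letter (k, false) stands for z k and (k, true) for its conjugate. *)
Definition word z s : R[i] := \prod_(p <- s) (if p.2 then conjc (z p.1) else z p.1).

Definition flip s := [seq (p.1, ~~ p.2) | p <- s].

(* Multiplying z k by 'i multiplies word z s by 'i ^+ word_charge s k. *)
Definition word_charge s k := (count_mem (k, false) s + 3 * count_mem (k, true) s)%N.

Lemma word_cat z s t : word z (s ++ t) = word z s * word z t.
Proof. exact: big_cat. Qed.

Lemma word_flip z s : word z (flip s) = conjc (word z s).
Proof.
rewrite /word big_map rmorph_prod; apply: eq_bigr => -[k []] _ //=.
by rewrite conjcK.
Qed.

Lemma word_charge_cat s t k : word_charge (s ++ t) k = (word_charge s k + word_charge t k)%N.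
Proof. by rewrite /word_charge !count_cat; lia. Qed.

(** Collecting the letters of equal index gives one function of each variable, the form in which
    independence applies. *)
Lemma word_monomial K z s : all (fun p => p.1 < K)%N s ->
  word z s = \prod_(k < K) monomial (count_mem (nat_of_ord k, false) s)
    (count_mem (nat_of_ord k, true) s) (Re (z k), Im (z k)).
Proof.
have zcE k : zc (Re (z k), Im (z k)) = z k by rewrite /zc /=; case: (z k).
elim: s => [_|p s ih /= /andP[pK sK]].
  by rewrite /word big_nil big1// => k _; rewrite /monomial !expr0 mulr1.
rewrite /word big_cons -/(word z s) ih//.
rewrite (_ : (if p.2 then _ else _) = \prod_(k < K | p.1 == k) (if p.2 then conjc (z k) else z k)).
  rewrite big_mkcond -big_split /=; apply: eq_bigr => k _.
  case: p pK => l b /= lK; rewrite /monomial zcE !xpair_eqE.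
  case: eqVneq => [_|_] /=; last by rewrite mul1r.
  by case: b => /=; rewrite ?add0n ?add1n exprS; ring.
rewrite (big_pred1 (Ordinal pK)) => [//|k /=].
by rewrite eq_sym.
Qed.

End Words.

Section GaussianFamily.
Context {d : measure_display} {Omega : measurableType d} {R : realType}.
Variables (P : probability Omega R) (g : nat -> Omega -> R[i]).
Hypothesis g_gauss : forall n, std_complex_gaussian P (g n).
Hypothesis g_indep : independent P g.

Let sg : R := (Num.sqrt 2)^-1.
Let sg_gt0 : 0 < sg. Proof. by rewrite invr_gt0 sqrtr_gt0. Qed.
Local Notation nu := (normal_prob (0 : R) sg \x normal_prob (0 : R) sg)%E.

Let mg n : measurable_fun [set: Omega] (ReIm (g n)).
Proof. by case: (g_gauss n). Qed.

Let g_law n A : measurable A -> P (ReIm (g n) @^-1` A) = nu A.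
Proof. by move=> mA; case: (g_gauss n) => _; apply. Qed.

Let zcReIm n w : zc (ReIm (g n) w) = g n w.
Proof. by rewrite /zc /ReIm /=; case: (g n w). Qed.

Lemma cmfun_gaussian n : cmfun setT (g n).
Proof. by have /measurable_fun_pairP[? ?] := mg n. Qed.

Lemma cint_gaussian_prod K (phi : nat -> measurableTypeR R * measurableTypeR R -> R[i]) :
  (forall k, cintegrable nu setT (phi k)) ->
  cintegrable P setT (fun w => \prod_(k < K) phi k (ReIm (g k) w)) /\
  cint P setT (fun w => \prod_(k < K) phi k (ReIm (g k) w)) =
    \prod_(k < K) cint nu setT (phi k).
Proof. by move=> iphi; apply: (cint_prod_indep mg g_law g_indep). Qed.

Let wordE s : exists K, forall w, word (g ^~ w) s =
  \prod_(k < K) monomial (count_mem (nat_of_ord k, false) s)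
    (count_mem (nat_of_ord k, true) s) (ReIm (g k) w).
Proof.
exists (\max_(p <- s) p.1).+1 => w; apply: word_monomial.
by apply/allP => p ps; rewrite ltnS (big_rem p)//= leq_maxl.
Qed.

Lemma cintegrable_word s : cintegrable P setT (fun w => word (g ^~ w) s).
Proof.
have [K E] := wordE s.
have [//|i _] := @cint_gaussian_prod K
  (fun k => monomial (count_mem (k, false) s) (count_mem (k, true) s)).
  by move=> k; exact: cintegrable_monomial.
by apply: eq_cintegrable i => // w _; rewrite E.
Qed.

(** The expectation factorizes over the indices, and the factor of index [k] is a mixed moment of
    nonzero charge. *)
Lemma cint_word_eq0 s k : (word_charge s k %% 4 != 0)%N ->
  cint P setT (fun w => word (g ^~ w) s) = 0.
Proof.
move=> sk.
(* [K] exceeds [k] as well as all letters, which spares showing that [k] occurs in [s]. *)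
have kK : (k < (maxn k (\max_(p <- s) p.1)).+1)%N by rewrite ltnS leq_maxl.
set K := (maxn _ _).+1 in kK.
have [|_ ip] := @cint_gaussian_prod K
  (fun k => monomial (count_mem (k, false) s) (count_mem (k, true) s)).
  by move=> l; exact: cintegrable_monomial.
rewrite (@eq_cint _ _ _ _ _ _ (fun w => \prod_(k < K) monomial (count_mem (nat_of_ord k, false) s)
    (count_mem (nat_of_ord k, true) s) (ReIm (g k) w))); last first.
  move=> w _; apply: word_monomial; apply/allP => p ps.
  by rewrite ltnS leq_max (big_rem p)//= leq_maxl orbT.
rewrite ip (bigD1 (Ordinal kK))//= cint_monomial_eq0 ?mul0r//.
Qed.

Lemma gaussian_moment_fin n m : P.-integrable setT (EFin \o (fun w => nsq (g n w) ^+ m)) /\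
  \int[P]_w nsq (g n w) ^+ m = \int[nu]_z nsq (zc z) ^+ m.
Proof.
have mh : measurable_fun setT (fun z : measurableTypeR R * measurableTypeR R => nsq (zc z) ^+ m).
  by apply: measurable_funX; apply: measurable_nsq; exact: cmfun_zc.
have h0 (z : measurableTypeR R * measurableTypeR R) : 0 <= nsq (zc z) ^+ m.
  by rewrite exprn_ge0 ?nsq_ge0.
have [_ int_fin] := integrableP _ _ _ (gaussian_moment sg_gt0 m).
have e : (\int[P]_w (nsq (g n w) ^+ m)%:E = \int[nu]_z (nsq (zc z) ^+ m)%:E)%E.
  rewrite -[RHS]mul1e.
  have := @ge0_integral_density _ _ _ _ _ P nu (cst 1) (ReIm (g n)) 1%E.
  move=> /(_ _ _ _ _ _ _ mh h0) <-//.
  - by apply: eq_integral => w _; rewrite /= mul1r zcReIm.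
  - exact: mg.
  - move=> A mA; rewrite mul1e; apply: etrans _ (g_law n mA).
    have mpre : measurable (ReIm (g n) @^-1` A).
      by rewrite -[X in measurable X]setTI; apply: mg.
    transitivity (\int[P]_w (\1_(ReIm (g n) @^-1` A) w)%:E)%E.
      by apply: eq_integral => w _; rewrite mul1r.
    by rewrite integral_indic// setIT.
split; last by rewrite /Rintegral e.
apply/integrableP; split.
  apply/measurable_EFinP/measurable_funX; apply: measurable_nsq; exact: cmfun_gaussian.
under eq_integral do rewrite /= ger0_norm ?exprn_ge0 ?nsq_ge0//.
rewrite e; apply: le_lt_trans int_fin; rewrite le_eqVlt; apply/orP; left; apply/eqP.
by apply: eq_integral => z _ /=; rewrite ger0_norm.
Qed.

End GaussianFamily.

(** * Pairing of indices forced by vanishing charges *)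

Section ChargeCombinatorics.

Let cnt (a b k : nat) : nat := (a == k) + (b == k).

Let cnt_le2 a b k : (cnt a b k <= 2)%N.
Proof. by rewrite /cnt; case: eqP; case: eqP. Qed.

Let cnt2 a b k : cnt a b k = 2%N -> a = k /\ b = k.
Proof. by rewrite /cnt; case: eqP => [->|_]; case: eqP => [->|_]. Qed.

Let cnt0 a b k : k != a -> k != b -> cnt a b k = 0%N.
Proof. by rewrite /cnt ![k == _]eq_sym => /negbTE -> /negbTE ->. Qed.

Let cnt_gt0 a b k : (0 < cnt a b k)%N -> k = a \/ k = b.
Proof.
rewrite /cnt; case: eqP => [->|_]; first by left.
by case: eqP => [->|_ //]; right.
Qed.

Let cnt_pair a b a' b' : (forall k, cnt a b k = cnt a' b' k) ->
  (a' = a /\ b' = b) \/ (a' = b /\ b' = a).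
Proof.
rewrite /cnt => H; have := H a; have := H b; rewrite !eqxx.
have [->|ab] := eqVneq a b.
  by case: (eqVneq a' b) => [->|_]; case: (eqVneq b' b) => [->|_] // _ _; left.
case: (eqVneq a' a) => [->|_].
  by rewrite (negbTE ab); case: (eqVneq b' b) => [->|_] // _ _; left.
case: (eqVneq b' a) => [->|_]; last by case: eqP.
by rewrite (negbTE ab) addn0; case: (eqVneq a' b) => [->|_] // _ _; right.
Qed.

Let cnt_disj a b a' b' k : a' != a -> a' != b -> b' != a -> b' != b ->
  cnt a b k = 0%N \/ cnt a' b' k = 0%N.
Proof.
move=> h1 h2 h3 h4; have [|/cnt_gt0[]->] := posnP (cnt a b k); first by left.
  by right; apply: cnt0; rewrite eq_sym.
by right; apply: cnt0; rewrite eq_sym.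
Qed.

(** Nonresonance and the frequency relation make the plain indices n1, n3 distinct from the
    conjugated ones n2, n4, and likewise for the m's. Charges modulo 4 then force equal
    multiplicities, except that four equal letters of the same sign also have charge 0. In that case
    n1 = n3 = k, say; the charge at n2 gives n4 = n2, and the frequency relation yields n2 = k, a
    contradiction. *)
Lemma quadruple_charge (n1 n2 n3 n4 m1 m2 m3 m4 : nat) :
    n2 != n1 -> n2 != n3 -> m2 != m1 -> m2 != m3 ->
    (n1 + n3 = n4 + n2)%N -> (m1 + m3 = m4 + m2)%N ->
    (forall k, (((n1 == k) + (n3 == k) + 3 * ((n2 == k) + (n4 == k)) +
      ((m2 == k) + (m4 == k) + 3 * ((m1 == k) + (m3 == k)))) %% 4 = 0)%N) ->
  ((m1 = n1 /\ m3 = n3) \/ (m1 = n3 /\ m3 = n1)) /\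
  ((m2 = n2 /\ m4 = n4) \/ (m2 = n4 /\ m4 = n2)).
Proof.
move=> n21 n23 m21 m23 En Em H.
have n41 : n4 != n1 by apply: contraNneq n23 => ?; subst n4; apply/eqP; lia.
have n43 : n4 != n3 by apply: contraNneq n21 => ?; subst n4; apply/eqP; lia.
have m41 : m4 != m1 by apply: contraNneq m23 => ?; subst m4; apply/eqP; lia.
have m43 : m4 != m3 by apply: contraNneq m21 => ?; subst m4; apply/eqP; lia.
(* The last two alternatives are the four equal letters that charges modulo 4 cannot tell from
   none. *)
have key k : (cnt n1 n3 k = cnt m1 m3 k /\ cnt n2 n4 k = cnt m2 m4 k) \/
    (cnt n1 n3 k = 2 /\ cnt m2 m4 k = 2)%N \/ (cnt n2 n4 k = 2 /\ cnt m1 m3 k = 2)%N.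
  move: (H k) (cnt_disj k n21 n23 n41 n43) (cnt_disj k m21 m23 m41 m43).
  rewrite -!/(cnt _ _ _).
  move: (cnt_le2 n1 n3 k) (cnt_le2 n2 n4 k) (cnt_le2 m1 m3 k) (cnt_le2 m2 m4 k).
  move: (cnt n1 n3 k) (cnt n2 n4 k) (cnt m1 m3 k) (cnt m2 m4 k) => a b c e.
  clear; move=> *; lia.
have no_pos k : ~ (cnt n1 n3 k = 2 /\ cnt m2 m4 k = 2)%N.
  move=> [/cnt2[E1 E3] /cnt2[F2 F4]].
  subst n1 n3 m2 m4.
  have n2k : cnt k k n2 = 0%N by exact: cnt0.
  have := key n2; rewrite n2k.
  have : (0 < cnt n2 n4 n2)%N by rewrite /cnt eqxx.
  move=> h [[_ h0]|[[]//|[/cnt2[_ h0] _]]]; first by rewrite h0 in h.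
  by subst n4; move: n21 => /eqP; lia.
have no_neg k : ~ (cnt n2 n4 k = 2 /\ cnt m1 m3 k = 2)%N.
  move=> [/cnt2[E1 E3] /cnt2[F2 F4]].
  subst n2 n4 m1 m3.
  have n1k : cnt k k n1 = 0%N by apply: cnt0; rewrite eq_sym.
  have := key n1; rewrite n1k.
  have : (0 < cnt n1 n3 n1)%N by rewrite /cnt eqxx.
  move=> h [[h0 _]|[[/cnt2[_ h0] _]|[]//]]; first by rewrite h0 in h.
  by subst n3; move: n21 => /eqP; lia.
have key' k : cnt n1 n3 k = cnt m1 m3 k /\ cnt n2 n4 k = cnt m2 m4 k.
  by case: (key k) => [//|[/no_pos|/no_neg]].
by split; apply: cnt_pair => k; case: (key' k).
Qed.

(** An index now carries a charge between -3 and 3, so that vanishing modulo 4 means vanishing, and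
    multiplicities can be compared directly. *)
Lemma triple_charge (n1 n2 n3 m1 m2 m3 : nat) :
    n2 != n1 -> n2 != n3 -> m2 != m1 -> m2 != m3 ->
    (forall k, (((n1 == k) + (n3 == k) + 3 * (n2 == k) +
      ((m2 == k) + 3 * ((m1 == k) + (m3 == k)))) %% 4 = 0)%N) ->
  m2 = n2 /\ ((m1 = n1 /\ m3 = n3) \/ (m1 = n3 /\ m3 = n1)).
Proof.
move=> n21 n23 m21 m23 H.
have key k : cnt n1 n3 k = cnt m1 m3 k /\ (n2 == k) = (m2 == k).
  move: (H k) (cnt_disj k n21 n23 n21 n23) (cnt_disj k m21 m23 m21 m23).
  rewrite -!/(cnt _ _ _).
  move: (cnt_le2 n1 n3 k) (cnt_le2 m1 m3 k); rewrite /cnt -/(cnt n1 n3 k) -/(cnt m1 m3 k).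
  move: (cnt n1 n3 k) (cnt m1 m3 k) (n2 == k) (m2 == k) => a c b e.
  by clear; case: b; case: e; move=> /= *; lia.
split; first by have [_] := key n2; rewrite eqxx => /esym/eqP.
by apply: cnt_pair => k; case: (key k).
Qed.

End ChargeCombinatorics.

(** * Cubic and quartic forms and their second moments *)

Section CubicForms.
Variable R : realType.
Implicit Types (a : nat -> R[i]) (lam v : nat -> R).

Definition triad (a : nat -> R[i]) K (t : 'I_K * 'I_K * 'I_K) : R[i] :=
  a t.1.1 * conjc (a t.1.2) * a t.2.

Definition interacts K n (t : 'I_K * 'I_K * 'I_K) := (t.1.1 + t.2 == n + t.1.2)%N.

Definition nonresonant K (t : 'I_K * 'I_K * 'I_K) := (t.1.2 != t.1.1) && (t.1.2 != t.2).

Definition cubic a K n : R[i] := \sum_(t : 'I_K * 'I_K * 'I_K | interacts n t) triad a t.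

Definition cubic_nr a K n : R[i] :=
  \sum_(t : 'I_K * 'I_K * 'I_K | interacts n t && nonresonant t) triad a t.

(** The nonresonant part of the pairing of the truncated series with its cubic nonlinearity,
    weighted by [lam]. For [lam] equal to 1 its real part is, up to the factor 2 pi, the nonresonant
    part of the integral of the fourth power of the modulus. *)
Definition quartic_nr lam a K : R[i] :=
  \sum_(n < K) (lam n)%:C%C * (conjc (a n) * cubic_nr a K n).

Definition triad_word K (t : 'I_K * 'I_K * 'I_K) : seq (nat * bool) :=
  [:: (nat_of_ord t.1.1, false); (nat_of_ord t.1.2, true); (nat_of_ord t.2, false)].

Definition triad_swap K (t : 'I_K * 'I_K * 'I_K) := ((t.2, t.1.2), t.1.1).

Lemma triadE a K (t : 'I_K * 'I_K * 'I_K) : triad a t = word a (triad_word t).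
Proof. by rewrite /triad /word !big_cons big_nil mulr1 mulrA. Qed.

Definition scaled v (z : nat -> R[i]) k : R[i] := (v k)%:C%C * z k.

Lemma conjc_realM (x : R) (y : R[i]) : conjc (x%:C%C * y) = x%:C%C * conjc y.
Proof. by case: y => a b; apply: complex_eqP => /=; ring. Qed.

Lemma triad_scaled v z K (t : 'I_K * 'I_K * 'I_K) :
  triad (scaled v z) t = (v t.1.1 * v t.1.2 * v t.2)%:C%C * word z (triad_word t).
Proof.
by rewrite -triadE /triad /scaled conjc_realM !rmorphM /=; ring.
Qed.

End CubicForms.

Section GaussianForms.
Context {d : measure_display} {Omega : measurableType d} {R : realType}.
Variables (P : probability Omega R) (g : nat -> Omega -> R[i]).
Hypothesis g_gauss : forall n, std_complex_gaussian P (g n).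
Hypothesis g_indep : independent P g.

Let sg : R := (Num.sqrt 2)^-1.
Let sg_gt0 : 0 < sg. Proof. by rewrite invr_gt0 sqrtr_gt0. Qed.
Local Notation nu := (normal_prob (0 : R) sg \x normal_prob (0 : R) sg)%E.
(** The eighth moment of the modulus: by the inequality between arithmetic and geometric means, it
    controls the second moment of every word of length three or four. *)
Let M : R := \int[nu]_z nsq (zc z) ^+ 4.
Let M_ge0 : 0 <= M.
Proof. by apply: Rintegral_ge0 => z _; rewrite exprn_ge0 ?nsq_ge0. Qed.

Let nsq_word_integrable s : P.-integrable setT (EFin \o (fun w => nsq (word (g ^~ w) s))).
Proof.
have [h _] := cintegrable_word g_gauss g_indep (s ++ flip s).
apply: eq_integrable h => // w _ /=.
by rewrite word_cat word_flip mulcJ.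
Qed.

Let cmfun_word s : cmfun setT (fun w => word (g ^~ w) s).
Proof. exact: cintegrable_cmfun (cintegrable_word g_gauss g_indep s). Qed.

Let int_nsqX n : \int[P]_w nsq (g n w) ^+ 4 = M.
Proof. by case: (gaussian_moment_fin g_gauss n 4). Qed.

Let integrable_nsqX n : P.-integrable setT (EFin \o (fun w => nsq (g n w) ^+ 4)).
Proof. by case: (gaussian_moment_fin g_gauss n 4). Qed.

Let int_one : \int[P]_w (1 : R) = 1.
Proof. by rewrite Rintegral_cst// mul1r (_ : fine _ = fine 1%E)//; congr fine; exact: probability_setT. Qed.

Let integrable_one : P.-integrable setT (EFin \o (fun _ : Omega => 1 : R)).
Proof. exact: finite_measure_integrable_cst. Qed.

Let mean_le (x y : R) : x * y <= x ^+ 2 + y ^+ 2.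
Proof. by have := sqr_ge0 (x - y); have := sqr_ge0 x; have := sqr_ge0 y; nra. Qed.

Let prod4_le (x y z t : R) : x * y * (z * t) <= x ^+ 4 + y ^+ 4 + (z ^+ 4 + t ^+ 4).
Proof.
have h (u v : R) : (u * v) ^+ 2 <= (u ^+ 4 + v ^+ 4).
  by rewrite exprMn; apply: le_trans (mean_le _ _) _; rewrite -!exprM.
by apply: le_trans (mean_le _ _) _; apply: lerD; exact: h.
Qed.

Let int_sum4 (f1 f2 f3 f4 : Omega -> R) :
  P.-integrable setT (EFin \o f1) -> P.-integrable setT (EFin \o f2) ->
  P.-integrable setT (EFin \o f3) -> P.-integrable setT (EFin \o f4) ->
  P.-integrable setT (EFin \o (fun w => f1 w + f2 w + (f3 w + f4 w))) /\
  \int[P]_w (f1 w + f2 w + (f3 w + f4 w)) =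
  \int[P]_w f1 w + \int[P]_w f2 w + (\int[P]_w f3 w + \int[P]_w f4 w).
Proof.
move=> i1 i2 i3 i4.
have i12 : P.-integrable setT (EFin \o (fun w => f1 w + f2 w)).
  by have := integrableD measurableT i1 i2; apply: eq_integrable.
have i34 : P.-integrable setT (EFin \o (fun w => f3 w + f4 w)).
  by have := integrableD measurableT i3 i4; apply: eq_integrable.
split; first by have := integrableD measurableT i12 i34; apply: eq_integrable.
by rewrite RintegralD// !RintegralD.
Qed.

Let triad_bound K (t : 'I_K * 'I_K * 'I_K) :
  \int[P]_w nsq (word (g ^~ w) (triad_word t)) <= 4 * M + 1.
Proof.
have [i e] := int_sum4 (integrable_nsqX t.1.1) (integrable_nsqX t.1.2)
  (integrable_nsqX t.2) integrable_one.
apply: (@le_trans _ _ (M + M + (M + 1))); last by have := M_ge0; lra.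
rewrite -{1}(int_nsqX t.1.1) -{1}(int_nsqX t.1.2) -(int_nsqX t.2) -int_one -e.
apply: le_Rintegral => // w _.
rewrite /word !big_cons big_nil mulr1 /= !nsqM nsqJ mulrA -[X in _ * X]mulr1.
by apply: le_trans (prod4_le _ _ _ _) _; rewrite expr1n.
Qed.

(** Two nonresonant triads are correlated only if they agree up to exchanging the two plain letters,
    whence the factor 2 in the constant given by Schur's test. *)
Lemma cubic_nr_moment : exists2 C : R, 0 <= C & forall (v : nat -> R) K n,
  (\int[P]_w (nsq (cubic_nr (scaled v (g ^~ w)) K n))%:E <=
   (C * \sum_(t : 'I_K * 'I_K * 'I_K | interacts n t && nonresonant t)
          (v t.1.1 * v t.1.2 * v t.2) ^+ 2)%:E)%E.
Proof.
exists (2 * (4 * M + 1)); first by rewrite !mulr_ge0// addr_ge0// mulr_ge0.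
move=> v K n.
under eq_integral do (rewrite /cubic_nr; under eq_bigr do rewrite triad_scaled).
pose r (t u : 'I_K * 'I_K * 'I_K) := (u == t) || (u == triad_swap t).
apply: (@second_moment_le _ _ _ P _ _ (fun t w => word (g ^~ w) (triad_word t)) _ _ _ _ r) => //.
- by move=> t u; rewrite /r eq_sym; congr (_ || _); apply/eqP/eqP => ->;
    rewrite /triad_swap -!surjective_pairing.
- move=> t u /andP[_ /andP[t21 t23]] /andP[_ /andP[u21 u23]] rtu.
  have [k sk] : exists k, (word_charge (triad_word t ++ flip (triad_word u)) k %% 4 != 0)%N.
    apply: contrapT => /forallNP H; move/negP: rtu; apply.
    have [] := @triple_charge t.1.1 t.1.2 t.2 u.1.1 u.1.2 u.2 t21 t23 u21 u23.
      move=> k; have /negP := H k; rewrite negbK => /eqP.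
      by rewrite word_charge_cat /word_charge /= !xpair_eqE /= !(andbT, andbF, addn0, add0n).
    move=> /val_inj e2 [[/val_inj e1 /val_inj e3]|[/val_inj e1 /val_inj e3]]; apply/orP; [left|right];
      by apply/eqP; case: u e1 e2 e3 {H u21 u23} => [[? ?] ?] /= -> -> ->;
        rewrite /triad_swap -?surjective_pairing.
  apply: etrans _ (congr1 (@complex.Re R) (cint_word_eq0 g_gauss g_indep sk)).
  apply: eq_Rintegral => w _.
  by rewrite word_cat word_flip.
- move=> t _; apply: (@leq_trans #|[:: t; triad_swap t]|); last exact: card_size.
  by apply: fintype.subset_leq_card; apply/fintype.subsetP => u; rewrite !inE => /andP[].
Qed.

Let quad_word K (q : 'I_K * ('I_K * 'I_K * 'I_K)) : seq (nat * bool) :=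
  (nat_of_ord q.1, true) :: triad_word q.2.

Let swap_pos K (q : 'I_K * ('I_K * 'I_K * 'I_K)) := (q.1, triad_swap q.2).

Let swap_neg K (q : 'I_K * ('I_K * 'I_K * 'I_K)) := (q.2.1.2, (q.2.1.1, q.1, q.2.2)).

(** The plain letters may be exchanged among themselves, and so may the conjugated ones: four
    quadruples share a word up to order, whence the factor 4 below. *)
Let quad_rel K : rel ('I_K * ('I_K * 'I_K * 'I_K)) := fun q u =>
  u \in [:: q; swap_pos q; swap_neg q; swap_pos (swap_neg q)].

Let quad_rel_sym K : symmetric (@quad_rel K).
Proof.
suff h q u : @quad_rel K q u -> quad_rel u q by move=> q u; apply/idP/idP; exact: h.
case: q => n [[a b] c]; rewrite /quad_rel !inE /swap_pos /swap_neg /triad_swap /=.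
by case/or4P => /eqP -> /=; rewrite eqxx ?orbT.
Qed.

Let quad_bound K (q : 'I_K * ('I_K * 'I_K * 'I_K)) :
  \int[P]_w nsq (word (g ^~ w) (quad_word q)) <= 4 * M.
Proof.
have [i e] := int_sum4 (integrable_nsqX q.1) (integrable_nsqX q.2.1.1)
  (integrable_nsqX q.2.1.2) (integrable_nsqX q.2.2).
apply: (@le_trans _ _ (M + M + (M + M))); last by lra.
rewrite -{1}(int_nsqX q.1) -{1}(int_nsqX q.2.1.1) -{1}(int_nsqX q.2.1.2) -(int_nsqX q.2.2) -e.
apply: le_Rintegral => // w _.
rewrite /word !big_cons big_nil mulr1 /= !nsqM !nsqJ mulrA.
exact: prod4_le.
Qed.

Lemma quartic_nr_moment : exists2 C : R, 0 <= C & forall (lam v : nat -> R) K,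
  (\int[P]_w (nsq (quartic_nr lam (scaled v (g ^~ w)) K))%:E <=
   (C * \sum_(n < K) \sum_(t : 'I_K * 'I_K * 'I_K | interacts n t && nonresonant t)
          (lam n * v n * (v t.1.1 * v t.1.2 * v t.2)) ^+ 2)%:E)%E.
Proof.
exists (4 * (4 * M)); first by rewrite !mulr_ge0.
move=> lam v K; rewrite pair_big_dep /=.
pose Q (q : 'I_K * ('I_K * 'I_K * 'I_K)) := interacts q.1 q.2 && nonresonant q.2.
have expand w : quartic_nr lam (scaled v (g ^~ w)) K = \sum_(q | Q q)
    (lam q.1 * v q.1 * (v q.2.1.1 * v q.2.1.2 * v q.2.2))%:C%C * word (g ^~ w) (quad_word q).
  rewrite /quartic_nr /cubic_nr; under eq_bigr do rewrite !mulr_sumr.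
  rewrite pair_big_dep /=; apply: eq_bigr => -[n t] _ /=.
  rewrite triad_scaled /word !big_cons /= /scaled conjc_realM !rmorphM /=; ring.
under eq_integral do rewrite expand.
apply: (@second_moment_le _ _ _ P _ Q (fun q w => word (g ^~ w) (quad_word q)) _ _ _ _ (@quad_rel K)) => //.
- exact: quad_rel_sym.
- move=> [n t] [m u] /andP[/eqP /= qn /andP[t21 t23]] /andP[/eqP /= un /andP[u21 u23]] rtu.
  have [k sk] : exists k, (word_charge (quad_word (n, t) ++ flip (quad_word (m, u))) k %% 4 != 0)%N.
    apply: contrapT => /forallNP H; move/negP: rtu; apply.
    have [] := @quadruple_charge t.1.1 t.1.2 t.2 n u.1.1 u.1.2 u.2 m t21 t23 u21 u23 qn un.
      move=> k; have /negP := H k; rewrite negbK => /eqP.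
      rewrite word_charge_cat /word_charge /= !xpair_eqE /= !(andbT, andbF, addn0, add0n).
      by rewrite (addnC (n == k :> nat)) (addnC (m == k :> nat)).
    case: t u qn un t21 t23 u21 u23 H => [[a b] c] [[a' b'] c'] /= _ _ _ _ _ _ _.
    rewrite /quad_rel /swap_pos /swap_neg /triad_swap /= !inE !xpair_eqE.
    by move=> [[/val_inj -> /val_inj ->]|[/val_inj -> /val_inj ->]]
      [[/val_inj -> /val_inj ->]|[/val_inj -> /val_inj ->]]; rewrite !eqxx ?orbT.
  apply: etrans _ (congr1 (@complex.Re R) (cint_word_eq0 g_gauss g_indep sk)).
  apply: eq_Rintegral => w _.
  by rewrite word_cat word_flip.
- move=> q _; apply: (@leq_trans #|[:: q; swap_pos q; swap_neg q; swap_pos (swap_neg q)]|);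
    last exact: card_size.
  by apply: fintype.subset_leq_card; apply/fintype.subsetP => u; rewrite inE => /andP[].
Qed.

Let V : R := \int[nu]_z nsq (zc z).

(** The variables |g_k|^2 - m are centred and independent, hence orthogonal, and Schur's test
    applies with each index related to itself alone. [m] is the mean of |g_k|^2, and [C] comes from
    (x - m)^2 <= 2 x^2 + 2 m^2. *)
Lemma gaussian_mean : exists m C : R, [/\ 0 < m, 0 <= C & forall (p : nat -> R) K,
  (\int[P]_w ((\sum_(k < K) p k * (nsq (g k w) - m)) ^+ 2)%:E <=
   (C * \sum_(k < K) p k ^+ 2)%:E)%E].
Proof.
have m1 n : P.-integrable setT (EFin \o (fun w => nsq (g n w))) /\ \int[P]_w nsq (g n w) = V.
  exact: (gaussian_moment_fin g_gauss n 1).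
have m2 n : P.-integrable setT (EFin \o (fun w => nsq (g n w) ^+ 2)).
  by case: (gaussian_moment_fin g_gauss n 2).
pose M2 : R := \int[nu]_z nsq (zc z) ^+ 2.
have m2E n : \int[P]_w nsq (g n w) ^+ 2 = M2 by case: (gaussian_moment_fin g_gauss n 2).
have M2_ge0 : 0 <= M2 by apply: Rintegral_ge0 => z _; rewrite exprn_ge0 ?nsq_ge0.
pose Z k w : R[i] := (nsq (g k w) - V)%:C%C.
have mZ k : cmfun setT (Z k).
  split => //=; apply: measurable_funB => //; apply: measurable_nsq; exact: cmfun_gaussian.
have dom (x : R) : (x - V) ^+ 2 <= 2 * x ^+ 2 + 2 * V ^+ 2.
  by have := sqr_ge0 (x + V); nra.
have icst (c : R) : P.-integrable setT (EFin \o cst c).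
  exact: finite_measure_integrable_cst.
have idom k : P.-integrable setT (EFin \o (fun w => 2 * nsq (g k w) ^+ 2 + 2 * V ^+ 2)).
  have i1 := integrableZl measurableT 2 (m2 k).
  have := integrableD measurableT i1 (icst (2 * V ^+ 2)).
  by apply: eq_integrable => // w _ /=; rewrite EFinD EFinM.
have iZ k : P.-integrable setT (EFin \o (fun w => nsq (Z k w))).
  apply: le_integrable (idom k) => //; first exact/measurable_EFinP/measurable_nsq.
  move=> w _; rewrite /= lee_fin nsq_real ger0_norm ?sqr_ge0//.
  by apply: le_trans (dom _) _; exact: ler_norm.
pose C := 2 * M2 + 2 * V ^+ 2.
have C0 : 0 <= C by have := sqr_ge0 V; rewrite /C; lra.
exists V, C; split; [exact: (gaussian_variance_gt0 sg_gt0)|exact: C0|move=> p K].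
have Zsum w : nsq (\sum_(k < K) (p k)%:C%C * Z k w) = (\sum_(k < K) p k * (nsq (g k w) - V)) ^+ 2.
  by rewrite -nsq_real rmorph_sum; congr nsq; apply: eq_bigr => k _; rewrite rmorphM.
under eq_integral do rewrite -Zsum.
rewrite -[C]mul1r.
apply: (@second_moment_le _ _ _ P _ xpredT (fun k : 'I_K => Z k) _ _ _ _ (fun k l => k == l) 1) => //.
- move=> k; have i1 := integrableZl measurableT 2 (m2 k).
  apply: (@le_trans _ _ (\int[P]_w (2 * nsq (g k w) ^+ 2 + 2 * V ^+ 2))).
    by apply: le_Rintegral => // w _; rewrite nsq_real.
  have i2 : P.-integrable setT (EFin \o (fun w => 2 * nsq (g k w) ^+ 2)).
    by apply: eq_integrable i1 => // w _ /=; rewrite EFinM.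
  rewrite RintegralD//; last exact: icst.
  rewrite RintegralZl// m2E Rintegral_cst// (_ : fine _ = fine 1%E) ?mulr1//.
  by congr fine; exact: probability_setT.
- move=> k l _ _ kl.
  (* A product over all indices in which only the factors [k] and [l] differ from 1, so that
     factorization shows the covariance to be zero. *)
  pose phi (j : nat) (z : measurableTypeR R * measurableTypeR R) : R[i] :=
    if (j == k) || (j == l) then (nsq (zc z) - V)%:C%C else 1.
  have inu : nu.-integrable setT (EFin \o (fun z => nsq (zc z))).
    exact: (gaussian_moment sg_gt0 1).
  have inu1 c : nu.-integrable setT (EFin \o (fun=> c : R)).
    apply/integrableP; split; first exact/measurable_EFinP.
    rewrite /= integral_cst// /= (_ : _ setT = 1%E) ?mule1 ?ltry//.
    exact: nu_setT.
  have inuV : nu.-integrable setT (EFin \o (fun z => nsq (zc z) - V)).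
    by have := integrableB measurableT inu (inu1 V); apply: eq_integrable.
  have iphi j : cintegrable nu setT (phi j).
    have [jkl|/negbTE jkl] := boolP ((j == k) || (j == l)).
      by apply: eq_cintegrable (cintegrable_real inuV) => // z _; rewrite /phi jkl.
    apply: (@eq_cintegrable _ _ _ _ _ measurableT (cst 1)) => [z _|].
      by rewrite /phi jkl.
    by split; exact: inu1.
  have [_ ip] := cint_gaussian_prod g_gauss g_indep K iphi.
  have phik : cint nu setT (phi k) = 0.
    rewrite (_ : phi k = (fun z => (nsq (zc z) - V)%:C%C)).
      rewrite cint_real RintegralB//.
      by rewrite Rintegral_cst// (_ : fine _ = fine 1%E) ?mulr1 ?subrr//; congr fine; exact: nu_setT.
    by apply/funext => z; rewrite /phi eqxx.
  rewrite (bigD1 k)//= phik mul0r in ip.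
  apply: etrans _ (congr1 (@complex.Re R) ip); apply: eq_Rintegral => w _.
  rewrite (bigD1 k)//= (bigD1 l) 1?eq_sym//= big1 => [|j /andP[jk jl]].
    have zg m : zc (ReIm (g m) w) = g m w by rewrite /zc /ReIm /=; case: (g m w).
    by rewrite mulr1 /phi !eqxx orbT !zg /= oppr0.
  by rewrite /phi -!(inj_eq val_inj) in jk jl *; rewrite (negbTE jk) (negbTE jl).
- by move=> k _; rewrite -[leqRHS](card1 k); apply: fintype.subset_leq_card; apply/fintype.subsetP => l;
    rewrite !inE => /eqP ->.
Qed.

End GaussianForms.

(** * Almost sure bounds from Fatou's lemma *)

Section FatouFrequently.
Context {d : measure_display} {T : measurableType d} {R : realType}.
Variable mu : {measure set T -> \bar R}.

(* Fatou's lemma only controls the lower limit, hence infinitely many K rather than all of them. *)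
Lemma ae_frequently_bounded_in (D : set T) (Q : nat -> T -> R) (C : R) : measurable D ->
  (forall K, measurable_fun D (Q K)) -> (forall K x, 0 <= Q K x) ->
  (forall K, (\int[mu]_(x in D) (Q K x)%:E <= C%:E)%E) ->
  {ae mu, forall x, D x ->
    exists B : R, forall M, exists2 K, (M <= K)%N & Q K x <= B}.
Proof.
move=> mD mQ Q0 QC.
pose f K x := (Q K x)%:E.
have mf K : measurable_fun D (f K) by exact/measurable_EFinP.
have f0 K x : D x -> (0 <= f K x)%E by move=> _; rewrite lee_fin.
have lim0 x : (0 <= limn_einf (f ^~ x))%E.
  rewrite limn_einf_lim; apply: lime_ge; first exact: is_cvg_einfs.
  by apply: nearW => n; apply: le_ereal_inf_tmp => _ [k _ <-]; rewrite lee_fin.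
have mlim : measurable_fun D (fun x => limn_einf (f ^~ x)).
  rewrite /limn_einf; apply: measurableT_comp => //.
  by apply: measurable_fun_limn_esup => k; exact: measurableT_comp.
have int_lim : mu.-integrable D (fun x => limn_einf (f ^~ x)).
  apply/integrableP; split => //.
  under eq_integral do rewrite gee0_abs//.
  apply: le_lt_trans (fatou mu mD mf f0) _.
  apply: le_lt_trans (ltry C); rewrite limn_einf_lim.
  apply: lime_le; first exact: is_cvg_einfs.
  apply: nearW => n; apply: (le_trans _ (QC n)).
  by apply: ereal_inf_lbound; exists n => /=.
apply: filterS (integrable_ae mD int_lim) => x /[apply] fin.
(* The margin 1 puts the infimum over the tail from [M] strictly below the bound, so some actual [K]
   in the tail satisfies it. *)
exists (fine (limn_einf (f ^~ x)) + 1) => M.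
have lt1 : (einfs (f ^~ x) M < (fine (limn_einf (f ^~ x)) + 1)%:E)%E.
  rewrite EFinD fineK//; apply: (@le_lt_trans _ _ (limn_einf (f ^~ x))).
    rewrite limn_einf_lim; have /cvg_lim -> // := @cvg_einfs_sup R (f ^~ x).
    by apply: ereal_sup_ubound; exists M.
  by rewrite lteDl// lte01.
have [_ [K /= MK <-] KQ] := ereal_inf_lt lt1.
by exists K => //; move: KQ; rewrite lte_fin => /ltW.
Qed.

Lemma ae_frequently_bounded (Q : nat -> T -> R) (C : R) :
  (forall K, measurable_fun setT (Q K)) -> (forall K x, 0 <= Q K x) ->
  (forall K, (\int[mu]_x (Q K x)%:E <= C%:E)%E) ->
  {ae mu, forall x, exists B : R, forall M, exists2 K, (M <= K)%N & Q K x <= B}.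
Proof.
move=> mQ Q0 QC; apply: filterS (ae_frequently_bounded_in measurableT mQ Q0 QC).
by move=> x /(_ Logic.I).
Qed.

(** Partial sums of nonnegative terms increase, so a bound along infinitely many of them holds for
    all. *)
Lemma ae_sum_bounded (D : set T) (h : nat -> T -> R) (c : nat -> R) (C : R) : measurable D ->
  (forall j, measurable_fun D (h j)) -> (forall j x, 0 <= h j x) ->
  (forall j, (\int[mu]_(x in D) (h j x)%:E <= (c j)%:E)%E) ->
  (forall J, \sum_(j < J) c j <= C) ->
  {ae mu, forall x, D x -> exists B : R, forall J, \sum_(j < J) h j x <= B}.
Proof.
move=> mD mh h0 hc cC.
have := @ae_frequently_bounded_in D (fun J x => \sum_(j < J) h j x) C mD.
move=> /(_ _ _ _)/filterS; apply; last 3 first.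
- by move=> J; apply: measurable_sum => j; exact: mh.
- by move=> J x; rewrite sumr_ge0.
- move=> J; under eq_integral do rewrite -sumEFin.
  rewrite ge0_integral_sum//; last 2 first.
  + by move=> j; exact/measurable_EFinP.
  + by move=> j x _; rewrite lee_fin.
  apply: (@le_trans _ _ (\sum_(j < J) c j)%:E); last by rewrite lee_fin.
  by rewrite -sumEFin; apply: lee_sum => j _.
move=> x + Dx => /(_ Dx)[B HB]; exists B => J.
have [K JK] := HB J; apply: le_trans.
rewrite -!(big_mkord xpredT (fun j => h j x)) [leRHS](@big_cat_nat _ _ _ J)//=.
by rewrite lerDl sumr_ge0.
Qed.

(** Fatou's lemma for a limit known almost everywhere. The bound is asked only from [N] on, because
    a difference with a fixed truncation is small only for later truncations. *)
Lemma ae_lim_integral_le (D : set T) (u_ : nat -> T -> R) (u : T -> R) (C : R) (N : nat) :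
  measurable D -> (forall j, measurable_fun D (u_ j)) -> measurable_fun D u ->
  (forall j x, 0 <= u_ j x) -> (forall x, 0 <= u x) ->
  {ae mu, forall x, D x -> u_ j x @[j --> \oo] --> u x} ->
  (forall j, (N <= j)%N -> (\int[mu]_(x in D) (u_ j x)%:E <= C%:E)%E) ->
  (\int[mu]_(x in D) (u x)%:E <= C%:E)%E.
Proof.
move=> mD mu_ mu' u_0 u0 ulim uC.
pose f j x := (u_ j x)%:E.
have mf j : measurable_fun D (f j) by exact/measurable_EFinP.
have f0 j x : D x -> (0 <= f j x)%E by move=> _; rewrite lee_fin.
have lim0 x : (0 <= limn_einf (f ^~ x))%E.
  rewrite limn_einf_lim; apply: lime_ge; first exact: is_cvg_einfs.
  by apply: nearW => n; apply: le_ereal_inf_tmp => _ [k _ <-]; rewrite lee_fin.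
have mlim : measurable_fun D (fun x => limn_einf (f ^~ x)).
  rewrite /limn_einf; apply: measurableT_comp => //.
  by apply: measurable_fun_limn_esup => k; exact: measurableT_comp.
apply: (@le_trans _ _ (\int[mu]_(x in D) limn_einf (f ^~ x))%E).
  apply: ae_ge0_le_integral => //.
  - by move=> x _; rewrite lee_fin.
  - exact/measurable_EFinP.
  apply: filterS ulim => x /[apply] ux.
  have fx : f ^~ x @ \oo --> (u x)%:E by apply: cvg_EFin ux; exact: nearW.
  by rewrite is_cvg_limn_einfE ?(cvg_lim _ fx)//; apply/cvg_ex; exists (u x)%:E.
apply: le_trans (fatou mu mD mf f0) _; rewrite limn_einf_lim.
apply: lime_le; first exact: is_cvg_einfs.
apply: nearW => n; apply: (@le_trans _ _ (\int[mu]_(x in D) f (maxn N n) x)%E).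
  by apply: ereal_inf_lbound; exists (maxn N n) => //=; exact: leq_maxr.
by apply: uC; exact: leq_maxl.
Qed.

End FatouFrequently.

(** * Power sums and Sobolev weights *)

Section PowerSeries.
Variable R : realType.

Lemma geometric_sum_le (q : R) J : 0 <= q -> q < 1 -> \sum_(j < J) q ^+ j <= (1 - q)^-1.
Proof.
move=> q0 q1; have h : (1 - q) * \sum_(j < J) q ^+ j = 1 - q ^+ J by rewrite -opprB mulNr -subrX1 opprB.
rewrite -[leRHS]mulr1 -ler_pdivrMl ?invr_gt0 ?subr_gt0// invrK h.
by rewrite gerBl exprn_ge0.
Qed.

Lemma sum_dyadic_le (f : nat -> R) (c : nat -> R) J :
  (forall j n, (2 ^ j <= n < 2 ^ j.+1)%N -> f n <= c j) ->
  \sum_(1 <= n < 2 ^ J) f n <= \sum_(j < J) (2 ^ j)%:R * c j.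
Proof.
move=> fc; elim: J => [|J ih]; first by rewrite expn0 big_geq// big_ord0.
rewrite big_ord_recr /= (@big_cat_nat _ _ _ (2 ^ J)%N)/= ?leq_exp2l ?expn_gt0//.
apply: lerD => //; apply: (@le_trans _ _ (\sum_(2 ^ J <= n < 2 ^ J.+1) c J)).
  by rewrite big_nat [leRHS]big_nat; apply: ler_sum => n nJ; exact: fc nJ.
by rewrite sumr_const_nat expnS mul2n -addnn addnK mulr_natl.
Qed.

Lemma sum_powR_le (p : R) : 1 < p ->
  exists C : R, forall N, \sum_(1 <= n < N) (n%:R `^ p)^-1 <= C.
Proof.
(* Cauchy condensation: the block from 2^j to 2^(j+1) contributes at most [q ^+ j]. *)
move=> p1; pose q : R := 2 `^ (1 - p).
have q0 : 0 < q by exact: powR_gt0.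
have q1 : q < 1.
  rewrite /q (_ : 1 - p = - (p - 1)); last by rewrite opprB.
  rewrite powRN invf_lt1 ?powR_gt0// /powR gt_eqF// expR_gt1 mulr_gt0 ?subr_gt0//.
  by rewrite ln_gt0// ltr1n.
exists (1 - q)^-1 => N.
apply: (@le_trans _ _ (\sum_(1 <= n < 2 ^ N) (n%:R `^ p)^-1)).
  case: N => [|N]; first by rewrite expn0.
  rewrite [leRHS](@big_cat_nat _ _ _ N.+1)//=; last by rewrite ltnW// ltn_expl.
  by rewrite lerDl sumr_ge0// => n _; rewrite invr_ge0 powR_ge0.
apply: le_trans (geometric_sum_le N (ltW q0) q1).
apply: (@le_trans _ _ (\sum_(j < N) (2 ^ j)%:R * ((2 ^ j)%:R `^ p)^-1)).
  apply: (@sum_dyadic_le _ (fun j => ((2 ^ j)%:R `^ p)^-1)) => j n /andP[jn _].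
  have j0 : 0 < (2 ^ j)%:R :> R by rewrite ltr0n expn_gt0.
  rewrite lef_pV2 ?posrE ?powR_gt0//; last by rewrite (lt_le_trans j0)// ler_nat.
  by apply: ge0_ler_powR; rewrite ?nnegrE ?ler_nat// ltW// (lt_trans _ p1).
apply: ler_sum => j _.
have -> : q ^+ j = (2 ^ j)%:R `^ (1 - p).
  by rewrite /q -powR_mulrn ?powR_ge0// -powRrM mulrC powRrM powR_mulrn// natrX.
rewrite powRB ?powRr1//.
by apply/implyP => _; rewrite pnatr_eq0 expn_eq0.
Qed.

End PowerSeries.

Section Weights.
Variables (R : realType) (alpha : R).
Hypothesis alpha_gt : 2^-1 < alpha.

Definition vweight (k : nat) : R := (Num.sqrt (1 + k%:R `^ (2 * alpha)))^-1.

Definition wweight (k : nat) : R := (1 + k%:R `^ (2 * alpha))^-1.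

Lemma vweight_sqr k : vweight k ^+ 2 = wweight k.
Proof. by rewrite /vweight exprVn sqr_sqrtr// addr_ge0// powR_ge0. Qed.

Lemma wweight_gt0 k : 0 < wweight k.
Proof. by rewrite invr_gt0 ltr_wpDr// powR_ge0. Qed.

Lemma wweight_le1 k : wweight k <= 1.
Proof. by rewrite invf_le1 ?ltr_wpDr ?powR_ge0// lerDl powR_ge0. Qed.

Let alpha_half : 1 < 2 * alpha.
Proof. by have := alpha_gt; rewrite -ltr_pdivrMl// mulr1. Qed.

Let alpha2_ge0 : 0 <= 2 * alpha.
Proof. by rewrite ltW// (lt_trans _ alpha_half). Qed.

Lemma wweight_le_powR k : (0 < k)%N -> wweight k <= (k%:R `^ (2 * alpha))^-1.
Proof.
move=> k0; rewrite lef_pV2 ?posrE ?powR_gt0 ?ltr0n ?ltr_wpDr ?powR_ge0//.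
by rewrite lerDr.
Qed.

(** In an interacting triad one of the plain frequencies is at least half the output frequency [n];
    this trades its weight for that of [n]. *)
Lemma wweight_half n k : (n <= 2 * k)%N -> wweight k <= 2 `^ (2 * alpha) * wweight n.
Proof.
move=> nk; rewrite /wweight -[leLHS]mulr1 ler_pdivrMl ?ltr_wpDr ?powR_ge0//.
rewrite mulrA ler_pdivlMr ?ltr_wpDr ?powR_ge0// mul1r.
have h1 : 1 <= 2 `^ (2 * alpha) :> R.
  by rewrite -[leLHS](powRr0 2); apply: ler_powR; rewrite ?ler1n.
have h2 : n%:R `^ (2 * alpha) <= 2 `^ (2 * alpha) * k%:R `^ (2 * alpha) :> R.
  rewrite -powRM//; apply: ge0_ler_powR; rewrite ?nnegrE//.
  by rewrite -natrM ler_nat.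
by lra.
Qed.

Lemma sum_wweight_le : exists W : R, forall K, \sum_(k < K) wweight k <= W.
Proof.
have [C HC] := @sum_powR_le R (2 * alpha) alpha_half.
exists (1 + C) => -[|K].
  by rewrite big_ord0 addr_ge0// (le_trans _ (HC 0%N))// big_geq.
rewrite -(big_mkord xpredT) big_ltn//; apply: lerD; first exact: wweight_le1.
apply: le_trans (HC K.+1); rewrite big_nat [leRHS]big_nat; apply: ler_sum => k /andP[k0 _].
exact: wweight_le_powR.
Qed.

Definition sobolev_weight (s : R) (n : nat) : R := (1 + n%:R ^+ 2) `^ s.

Lemma sobolev_weight_gt0 s n : 0 < sobolev_weight s n.
Proof. by rewrite powR_gt0// ltr_wpDr// sqr_ge0. Qed.

(** The constant covers both signs of [s]: for s >= 0 one uses 1 + n^2 <= 2 n^2, while for s < 0 the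
    power is decreasing. *)
Lemma sobolev_weight_le s n : (0 < n)%N ->
  sobolev_weight s n <= (1 + 2 `^ s) * n%:R `^ (2 * s).
Proof.
move=> n0; have n1 : 1 <= n%:R :> R by rewrite ler1n.
have np : 0 <= n%:R ^+ 2 :> R by rewrite sqr_ge0.
have -> : n%:R `^ (2 * s) = (n%:R ^+ 2) `^ s :> R by rewrite powRrM powR_mulrn.
have pos : 0 <= (n%:R ^+ 2) `^ s :> R by exact: powR_ge0.
have [s0|s0] := leP 0 s.
  apply: (@le_trans _ _ ((2 * n%:R ^+ 2) `^ s)).
    apply: ge0_ler_powR; rewrite ?nnegrE ?addr_ge0 ?mulr_ge0//.
    have h : 1 <= n%:R ^+ 2 :> R by rewrite exprn_ege1.
    by lra.
  by rewrite powRM// ler_wpM2r// lerDr.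
have p1 : 0 < 1 + n%:R ^+ 2 :> R by rewrite ltr_wpDr.
have p2 : 0 < n%:R ^+ 2 :> R by rewrite exprn_gt0// ltr0n.
apply: (@le_trans _ _ ((n%:R ^+ 2) `^ s)).
  have h : (n%:R ^+ 2) `^ (- s) <= (1 + n%:R ^+ 2) `^ (- s) :> R.
    apply: ge0_ler_powR; rewrite ?nnegrE ?oppr_ge0 1?ltW//.
    by rewrite ltrDr.
  by move: h; rewrite !powRN lef_pV2 ?posrE ?powR_gt0.
by rewrite ler_peMl// lerDl powR_ge0.
Qed.

Lemma sum_sobolev_weight_le s : s < alpha - 2^-1 ->
  exists C : R, forall N, \sum_(n < N) sobolev_weight s n * wweight n <= C.
Proof.
(* The exponent 2 alpha - 2 s exceeds 1 exactly when s < alpha - 1/2. *)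
move=> s_lt; have [C HC] := @sum_powR_le R (2 * alpha - 2 * s) ltac:(have := s_lt; lra).
have D0 : 0 <= 1 + 2 `^ s :> R by rewrite addr_ge0// powR_ge0.
have C0 : 0 <= C by rewrite (le_trans _ (HC 0%N))// big_geq.
exists (sobolev_weight s 0 * wweight 0 + (1 + 2 `^ s) * C) => -[|N].
  by rewrite big_ord0 addr_ge0 ?mulr_ge0// ltW ?sobolev_weight_gt0 ?wweight_gt0.
rewrite -(big_mkord xpredT (fun n => sobolev_weight s n * wweight n)) big_ltn//; apply: lerD => //.
apply: (@le_trans _ _ (\sum_(1 <= n < N.+1) (1 + 2 `^ s) * (n%:R `^ (2 * alpha - 2 * s))^-1)).
  rewrite big_nat [leRHS]big_nat; apply: ler_sum => n /andP[n0 _].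
  have nn0 : (n%:R : R) != 0 by rewrite pnatr_eq0 -lt0n.
  rewrite -powRN opprB powRB ?nn0 ?implybT// mulrA.
  apply: ler_pM (ltW (sobolev_weight_gt0 _ _)) (ltW (wweight_gt0 _)) _ _.
    exact: sobolev_weight_le.
  exact: wweight_le_powR.
by rewrite -mulr_sumr ler_wpM2l.
Qed.

Let s0 : R := alpha - 2^-1.

(** The harmonic borderline: the Sobolev weight is at least n^(2 alpha - 1), and 1 + n^(2 alpha) <=
    2 n^(2 alpha) costs the factor 2. *)
Lemma critical_weight_ge n : (0 < n)%N -> (2 * n%:R)^-1 <= sobolev_weight s0 n * wweight n.
Proof.
move=> n0; have np : 0 < n%:R :> R by rewrite ltr0n.
have n1 : 1 <= n%:R :> R by rewrite ler1n.
have hs : n%:R `^ (2 * alpha) / n%:R <= sobolev_weight s0 n.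
  have -> : n%:R `^ (2 * alpha) / n%:R = (n%:R ^+ 2) `^ s0 :> R.
    rewrite -powR_mulrn// -powRrM -[X in _ / X](powRr1 (ltW np)) -powRB ?gt_eqF ?implybT//.
    by congr (_ `^ _); rewrite /s0; field.
  have s00 : 0 <= s0 by rewrite subr_ge0 ltW.
  apply: ge0_ler_powR => //; rewrite ?nnegrE ?addr_ge0 ?sqr_ge0//.
  by rewrite lerDr.
have pa : 1 <= n%:R `^ (2 * alpha) :> R by rewrite -[leLHS](powRr0 n%:R); apply: ler_powR.
have hw : (2 * n%:R `^ (2 * alpha))^-1 <= wweight n.
  rewrite lef_pV2 ?posrE ?mulr_gt0 ?powR_gt0 ?ltr_wpDr ?powR_ge0//; lra.
apply: (@le_trans _ _ (n%:R `^ (2 * alpha) / n%:R * (2 * n%:R `^ (2 * alpha))^-1)).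
  rewrite le_eqVlt; apply/orP; left; apply/eqP; field.
  by rewrite !gt_eqF ?powR_gt0.
by apply: ler_pM => //; rewrite ?divr_ge0 ?invr_ge0 ?mulr_ge0 ?powR_ge0.
Qed.

Lemma critical_weight_le : exists2 C : R, 0 <= C &
  forall n, (0 < n)%N -> sobolev_weight s0 n * wweight n <= C / n%:R.
Proof.
exists (1 + 2 `^ s0); first by rewrite addr_ge0// powR_ge0.
move=> n n0; have nn0 : (n%:R : R) != 0 by rewrite pnatr_eq0 -lt0n.
have -> : n%:R^-1 = n%:R `^ (2 * s0) / n%:R `^ (2 * alpha) :> R.
  rewrite -powRB ?nn0 ?implybT// (_ : 2 * s0 - 2 * alpha = - 1).
    by rewrite powRN powRr1.
  by rewrite /s0; field.
rewrite mulrA; apply: ler_pM (ltW (sobolev_weight_gt0 _ _)) (ltW (wweight_gt0 _)) _ _.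
  exact: sobolev_weight_le.
exact: wweight_le_powR.
Qed.

End Weights.

(** * Sums over interacting triads *)

Section TriadSums.
Variables (R : realType) (alpha : R).
Hypothesis alpha_gt : 2^-1 < alpha.

Local Notation v := (vweight alpha).
Local Notation w := (wweight alpha).

(** Given [n], the first two frequencies determine the third. *)
Let sum_interacts_le K n (F : 'I_K -> 'I_K -> R) : (forall i j, 0 <= F i j) ->
  \sum_(t : 'I_K * 'I_K * 'I_K | interacts n t) F t.1.1 t.1.2 <= \sum_i \sum_j F i j.
Proof.
move=> F0; rewrite pair_bigA /=.
rewrite (eq_bigl (fun t : 'I_K * 'I_K * 'I_K => xpredT t.1 && interacts n (t.1, t.2))); last first.
  by move=> [t k].
rewrite -(pair_big_dep xpredT (fun p k => interacts n (p, k)) (fun p k => F p.1 p.2)) /=.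
apply: ler_sum => -[i j] _ /=.
rewrite sumr_const -mulr_natr -[leRHS]mulr1 ler_wpM2l// (ler_nat _ _ 1).
apply/card_le1_eqP => k l /eqP /= kE /eqP /= lE.
by apply: val_inj => /=; lia.
Qed.

(** From n <= n1 + n3, the larger of n1 and n3 is at least n / 2, and its weight is at most
    [D * w n]. The other two frequencies determine it, and their weights are summable. *)
Lemma sum_triads_le : exists2 C : R, 0 <= C & forall K n,
  \sum_(t : 'I_K * 'I_K * 'I_K | interacts n t && nonresonant t)
    (v t.1.1 * v t.1.2 * v t.2) ^+ 2 <= C * w n.
Proof.
have [W HW] := sum_wweight_le alpha_gt.
have W0 : 0 <= W by apply: le_trans (HW 0%N); rewrite big_ord0.
have w0 k : 0 <= w k by exact: ltW (wweight_gt0 _ _).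
pose D : R := 2 `^ (2 * alpha); have D0 : 0 <= D by exact: powR_ge0.
exists (D * (W * W + W * W)); first by rewrite mulr_ge0 ?addr_ge0 ?mulr_ge0.
move=> K n.
apply: (@le_trans _ _ (\sum_(t : 'I_K * 'I_K * 'I_K | interacts n t)
    D * w n * (w t.1.1 * w t.1.2 + w t.2 * w t.1.2))).
  rewrite big_mkcondr /=; apply: ler_sum => t /eqP tn.
  have nonneg : 0 <= D * w n * (w t.1.1 * w t.1.2 + w t.2 * w t.1.2).
    by rewrite mulr_ge0 ?addr_ge0 ?mulr_ge0.
  case: ifP => // _; rewrite !exprMn !vweight_sqr.
  have h1 := w0 t.1.1; have h2 := w0 t.1.2; have h3 := w0 t.2; have hn := w0 n.
  have [k1|k1] := leqP n (2 * t.1.1).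
    have := wweight_half alpha_gt k1; rewrite -/D => k.
    apply: (@le_trans _ _ (D * w n * w t.1.2 * w t.2)).
      by rewrite ler_wpM2r// ler_wpM2r.
    rewrite mulrDr -mulrA [w t.1.2 * _]mulrC lerDr.
    by rewrite mulr_ge0// mulr_ge0.
  have k3 : (n <= 2 * t.2)%N by lia.
  have := wweight_half alpha_gt k3; rewrite -/D => k.
  apply: (@le_trans _ _ (w t.1.1 * w t.1.2 * (D * w n))).
    by rewrite ler_wpM2l// mulr_ge0.
  rewrite mulrC mulrDr lerDl.
  by rewrite mulr_ge0// mulr_ge0.
rewrite -mulr_sumr mulrAC ler_wpM2r// ler_wpM2l// big_split /=; apply: lerD.
  apply: le_trans (sum_interacts_le n (F := fun i j => w i * w j) _) _.
    by move=> i j; rewrite mulr_ge0.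
  under eq_bigr do rewrite -mulr_sumr; rewrite -mulr_suml.
  by apply: ler_pM; rewrite ?sumr_ge0.
(* Exchanging the two plain frequencies reduces the second sum to the first. *)
rewrite (reindex_inj (h := @triad_swap K)) /=; last first.
  by apply: (can_inj (g := @triad_swap K)) => -[[a b] c].
rewrite (eq_bigl (fun t : 'I_K * 'I_K * 'I_K => interacts n t)); last first.
  by move=> t; rewrite /interacts /= addnC.
apply: le_trans (sum_interacts_le n (F := fun i j => w i * w j) _) _.
  by move=> i j; rewrite mulr_ge0.
under eq_bigr do rewrite -mulr_sumr; rewrite -mulr_suml.
by apply: ler_pM; rewrite ?sumr_ge0.
Qed.

End TriadSums.

(** * Almost sure bounds for the random datum *)

Section AlmostSure.
Context {d : measure_display} {Omega : measurableType d} {R : realType}.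
Variables (P : probability Omega R) (g : nat -> Omega -> R[i]).
Hypothesis g_gauss : forall n, std_complex_gaussian P (g n).
Hypothesis g_indep : independent P g.
Variable alpha : R.
Hypothesis alpha_gt : 2^-1 < alpha.

Local Notation v := (vweight alpha).
Local Notation w := (wweight alpha).

Definition datum (x : Omega) : nat -> R[i] := scaled v (g ^~ x).

Let nsq_datum x n : nsq (datum x n) = w n * nsq (g n x).
Proof. by rewrite /datum /scaled nsqM nsq_real vweight_sqr. Qed.

Let w_ge0 n : 0 <= w n.
Proof. exact: ltW (wweight_gt0 _ _). Qed.

Let cmfun_datum n : cmfun setT (fun x => datum x n).
Proof. by apply: cmfunM; [exact: cmfun_cst|exact: cmfun_gaussian]. Qed.

Let cmfun_cubic_nr K n : cmfun setT (fun x => cubic_nr (datum x) K n).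
Proof.
apply: cmfun_sum => t _; apply: cmfunM; last exact: cmfun_datum.
by apply: cmfunM; [exact: cmfun_datum|apply: cmfunJ; exact: cmfun_datum].
Qed.

Let cmfun_quartic_nr lam K : cmfun setT (fun x => quartic_nr lam (datum x) K).
Proof.
apply: cmfun_sum => n _; apply: cmfunM; first exact: cmfun_cst.
by apply: cmfunM; [apply: cmfunJ; exact: cmfun_datum|exact: cmfun_cubic_nr].
Qed.

Let measurable_nsq_cubic K n : measurable_fun setT (fun x => nsq (cubic_nr (datum x) K n)).
Proof. by apply: measurable_nsq; exact: cmfun_cubic_nr. Qed.

Let measurable_nsq_quartic lam K : measurable_fun setT (fun x => nsq (quartic_nr lam (datum x) K)).
Proof. by apply: measurable_nsq; exact: cmfun_quartic_nr. Qed.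

Let cubic_moment : exists2 C : R, 0 <= C & forall K n,
  (\int[P]_x (nsq (cubic_nr (datum x) K n))%:E <= (C * w n)%:E)%E.
Proof.
have [C C0 HC] := cubic_nr_moment g_gauss g_indep.
have [D D0 HD] := sum_triads_le alpha_gt.
exists (C * D); first by rewrite mulr_ge0.
move=> K n; apply: le_trans (HC v K n) _.
by rewrite lee_fin -mulrA ler_wpM2l.
Qed.

Let quartic_moment : exists2 C : R, 0 <= C & forall lam K,
  (\int[P]_x (nsq (quartic_nr lam (datum x) K))%:E <=
   (C * \sum_(n < K) lam n ^+ 2 * w n ^+ 2)%:E)%E.
Proof.
have [C C0 HC] := quartic_nr_moment g_gauss g_indep.
have [D D0 HD] := sum_triads_le alpha_gt.
exists (C * D); first by rewrite mulr_ge0.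
move=> lam K; apply: le_trans (HC lam v K) _.
rewrite lee_fin -mulrA ler_wpM2l// mulr_sumr; apply: ler_sum => n _.
under eq_bigr do rewrite exprMn; rewrite -mulr_sumr exprMn vweight_sqr.
apply: (@le_trans _ _ (lam n ^+ 2 * w n * (D * w n))).
  by apply: ler_wpM2l => //; apply: mulr_ge0 => //; exact: sqr_ge0.
by rewrite le_eqVlt; apply/orP; left; apply/eqP; ring.
Qed.

Let int_scaled_sum I (r : seq I) (c : I -> R) (f : I -> Omega -> R) :
  (forall i, 0 <= c i) -> (forall i x, 0 <= f i x) ->
  (forall i, measurable_fun setT (f i)) ->
  (\int[P]_x (\sum_(i <- r) c i * f i x)%:E = \sum_(i <- r) (c i)%:E * \int[P]_x (f i x)%:E)%E.
Proof.
move=> c0 f0 mf; under eq_integral do rewrite -sumEFin.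
rewrite ge0_integral_sum//; last 2 first.
- by move=> i; apply/measurable_EFinP/measurable_funM => //.
- by move=> i x _; rewrite lee_fin mulr_ge0.
apply: eq_bigr => i _; under eq_integral do rewrite EFinM.
by rewrite ge0_integralZl ?lee_fin//; [exact/measurable_EFinP|move=> x _; rewrite lee_fin].
Qed.

Lemma ae_weighted_bounded (rho : nat -> R) : (forall n, 0 <= rho n) ->
  (exists C : R, forall N, \sum_(n < N) rho n * w n <= C) ->
  {ae P, forall x, exists B : R, forall N, \sum_(n < N) rho n * nsq (datum x n) <= B}.
Proof.
move=> rho0 [C HC].
have [M HM] : exists M : R, forall n, (\int[P]_x (nsq (g n x))%:E = M%:E)%E.
  exists (\int[P]_x nsq (g 0%N x)) => n.
  have [i0 e0] := gaussian_moment_fin g_gauss 0%N 1.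
  have [i e] := gaussian_moment_fin g_gauss n 1.
  have -> : \int[P]_x nsq (g 0%N x) = \int[P]_x nsq (g n x).
    exact: etrans e0 (esym e).
  by rewrite /Rintegral fineK//; exact: (integrable_fin_num measurableT i).
have mdat n : measurable_fun setT (fun x => nsq (datum x n)).
  by apply: measurable_nsq; exact: cmfun_datum.
have nd x N K : (N <= K)%N ->
    \sum_(n < N) rho n * nsq (datum x n) <= \sum_(n < K) rho n * nsq (datum x n).
  move=> NK; rewrite -!(big_mkord xpredT (fun n => rho n * nsq (datum x n))).
  rewrite [leRHS](@big_cat_nat _ _ _ N)//= lerDl sumr_ge0// => n _.
  by rewrite mulr_ge0 ?nsq_ge0.
have := @ae_frequently_bounded _ _ _ P
  (fun N x => \sum_(n < N) rho n * nsq (datum x n)) (C * M).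
move=> /(_ _ _ _)/filterS; apply.
- move=> x [B HB]; exists B => N; have [K NK KB] := HB N.
  exact: le_trans (nd x _ _ NK) KB.
- move=> K; apply: measurable_sum => n; apply: measurable_funM => //.
- by move=> K x; rewrite sumr_ge0// => n _; rewrite mulr_ge0 ?nsq_ge0.
move=> K; rewrite int_scaled_sum//; last by move=> n x; exact: nsq_ge0.
have M0 : 0 <= M by rewrite -lee_fin -(HM 0%N) integral_ge0// => x _; rewrite lee_fin nsq_ge0.
apply: (@le_trans _ _ (\sum_(n < K) rho n * w n * M)%:E)%E; last first.
  by rewrite lee_fin -mulr_suml ler_wpM2r.
rewrite -sumEFin; apply: lee_sum => n _.
under eq_integral do rewrite nsq_datum EFinM.
rewrite ge0_integralZl ?lee_fin//; last 2 first.
- by apply/measurable_EFinP/measurable_nsq; exact: cmfun_gaussian.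
- by move=> x _; rewrite lee_fin nsq_ge0.
by rewrite HM -!EFinM mulrA.
Qed.

(** The quartic form controls the L^4 norm of the truncation, the sum a Sobolev norm of the
    nonresonant nonlinearity. Neither need be monotone in [K], so they are added to be bounded along
    the same [K]. *)
Lemma ae_cubic_bounded (rho : nat -> R) : (forall n, 0 <= rho n) ->
  (exists C : R, forall N, \sum_(n < N) rho n * w n <= C) ->
  {ae P, forall x, exists B : R, forall M, exists2 K, (M <= K)%N &
    nsq (quartic_nr (cst 1) (datum x) K) +
    \sum_(n < K) rho n * nsq (cubic_nr (datum x) K n) <= B}.
Proof.
move=> rho0 [C HC].
have [C1 C10 H1] := cubic_moment.
have [C2 C20 H2] := quartic_moment.
have [W HW] := sum_wweight_le alpha_gt.
apply: (@ae_frequently_bounded _ _ _ P (fun K x => nsq (quartic_nr (cst 1) (datum x) K) +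
    \sum_(n < K) rho n * nsq (cubic_nr (datum x) K n)) (C2 * W + C1 * C)).
- move=> K; apply: measurable_funD => //.
  by apply: measurable_sum => n; apply: measurable_funM => //.
- move=> K x; rewrite addr_ge0 ?nsq_ge0 ?sumr_ge0// => n _.
  by rewrite mulr_ge0 ?nsq_ge0.
move=> K; under eq_integral do rewrite EFinD.
rewrite ge0_integralD//; last 4 first.
- by move=> x _; rewrite lee_fin nsq_ge0.
- exact/measurable_EFinP.
- by move=> x _; rewrite lee_fin sumr_ge0// => n _; rewrite mulr_ge0 ?nsq_ge0.
- by apply/measurable_EFinP; apply: measurable_sum => n; apply: measurable_funM => //.
rewrite EFinD; apply: leeD.
  apply: le_trans (H2 _ _) _; rewrite lee_fin ler_wpM2l//; apply: le_trans (HW K).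
  by apply: ler_sum => n _; rewrite expr1n mul1r expr2 ler_piMl// wweight_le1.
rewrite int_scaled_sum//; last by move=> n x; exact: nsq_ge0.
apply: (@le_trans _ _ (\sum_(n < K) C1 * (rho n * w n))%:E)%E; last first.
  by rewrite lee_fin -mulr_sumr ler_wpM2l.
rewrite -sumEFin; apply: lee_sum => n _.
apply: (@le_trans _ _ ((rho n)%:E * (C1 * w n)%:E))%E.
  by rewrite lee_wpmul2l ?lee_fin.
by rewrite -EFinM lee_fin mulrCA.
Qed.

Let s0 := alpha - 2^-1.
Let lam := sobolev_weight s0.

(* On the j-th block lam n * w n is at most C / 4 ^ j, which pays for the factor 2 ^ j below. *)
Definition block_weight (j n : nat) : R := if (4 ^ j <= n < 4 ^ j.+1)%N then lam n else 0.

(** A quartic form is wanted whose weight is cut off at 4^J, for every J, along one set of [K]; the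
    weighted sum over blocks controls all of them at once. Block [j] has 3 * 4^j indices, each
    contributing at most (C / 4^j)^2, so its second moment is of order 4^(-j) and the factor 2^j
    leaves a geometric series. *)
Lemma ae_quartic_bounded :
  {ae P, forall x, exists B : R, forall M, exists2 K, (M <= K)%N &
    nsq (quartic_nr (cst 1) (datum x) K) +
    \sum_(j < K) 2 ^+ j * nsq (quartic_nr (block_weight j) (datum x) K) <= B}.
Proof.
have [C2 C20 H2] := quartic_moment.
have [W HW] := sum_wweight_le alpha_gt.
have [C C0 HC] := critical_weight_le alpha.
have block j K : \sum_(n < K) block_weight j n ^+ 2 * w n ^+ 2 <= 3 * C ^+ 2 / 4 ^+ j.
  have p4 : 0 < 4 ^+ j :> R by rewrite exprn_gt0.
  pose F (n : nat) : R := if (4 ^ j <= n < 4 ^ j.+1)%N then (C / 4 ^+ j) ^+ 2 else 0.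
  have F0 n : 0 <= F n by rewrite /F; case: ifP => // _; exact: sqr_ge0.
  apply: (@le_trans _ _ (\sum_(n < K) F n)).
    apply: ler_sum => n _; rewrite /F /block_weight; case: ifP => [/andP[jn _]|_]; last first.
      by rewrite expr0n mul0r.
    have n0 : (0 < n)%N by rewrite (leq_trans _ jn)// expn_gt0.
    rewrite -exprMn; apply: lerXn2r; rewrite ?nnegrE.
    - by rewrite mulr_ge0// ltW// sobolev_weight_gt0.
    - by rewrite divr_ge0// ltW.
    apply: le_trans (HC _ n0) _; rewrite ler_wpM2l//.
    by rewrite lef_pV2 ?posrE ?ltr0n// -natrX ler_nat.
  (* The range is enlarged to contain the whole block whatever [K] is. *)
  apply: (@le_trans _ _ (\sum_(n < K + 4 ^ j.+1) F n)).
    rewrite -!(big_mkord xpredT F) [leRHS](@big_cat_nat _ _ _ K)//= ?leq_addr//.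
    by rewrite lerDl sumr_ge0.
  rewrite -(big_mkord xpredT F) (@big_cat_nat _ _ _ (4 ^ j)%N)//=; last first.
    by rewrite (leq_trans _ (leq_addl _ _))// leq_exp2l.
  rewrite [X in X + _]big_nat [X in X + _]big1 ?add0r => [|n /andP[_ nj]]; last first.
    by rewrite /F leqNgt nj.
  rewrite (@big_cat_nat _ _ _ (4 ^ j.+1)%N)/= ?leq_addl ?leq_exp2l//.
  rewrite [X in _ + X]big_nat [X in _ + X]big1 ?addr0 => [|n /andP[jn _]]; last first.
    by rewrite /F ltnNge jn andbF.
  rewrite big_nat (eq_bigr (fun=> (C / 4 ^+ j) ^+ 2)) => [|n nj]; last by rewrite /F nj.
  rewrite -big_nat sumr_const_nat -[_ *+ (_ - _)]mulr_natr natrB ?leq_exp2l// !natrX (exprS _ j).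
  by rewrite le_eqVlt; apply/orP; left; apply/eqP; field; rewrite gt_eqF.
apply: (@ae_frequently_bounded _ _ _ P (fun K x => nsq (quartic_nr (cst 1) (datum x) K) +
    \sum_(j < K) 2 ^+ j * nsq (quartic_nr (block_weight j) (datum x) K))
    (C2 * W + C2 * (3 * C ^+ 2) * 2)).
- move=> K; apply: measurable_funD => //.
  by apply: measurable_sum => n; apply: measurable_funM => //.
- move=> K x; rewrite addr_ge0 ?nsq_ge0 ?sumr_ge0// => n _.
  by rewrite mulr_ge0 ?nsq_ge0 ?exprn_ge0.
move=> K; under eq_integral do rewrite EFinD.
rewrite ge0_integralD//; last 4 first.
- by move=> x _; rewrite lee_fin nsq_ge0.
- exact/measurable_EFinP.
- by move=> x _; rewrite lee_fin sumr_ge0// => n _; rewrite mulr_ge0 ?nsq_ge0 ?exprn_ge0.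
- by apply/measurable_EFinP; apply: measurable_sum => n; apply: measurable_funM => //.
rewrite EFinD; apply: leeD.
  apply: le_trans (H2 _ _) _; rewrite lee_fin ler_wpM2l//; apply: le_trans (HW K).
  by apply: ler_sum => n _; rewrite expr1n mul1r expr2 ler_piMl// wweight_le1.
rewrite int_scaled_sum//; last by move=> n x; exact: nsq_ge0.
apply: (@le_trans _ _ (\sum_(j < K) C2 * (3 * C ^+ 2) * 2^-1 ^+ j)%:E)%E; last first.
  rewrite lee_fin -mulr_sumr ler_wpM2l ?mulr_ge0 ?sqr_ge0//.
  have h : (1 - 2^-1)^-1 = 2 :> R by field.
  by rewrite -[leRHS]h; apply: geometric_sum_le; rewrite ?invr_ge0// invf_lt1// ltr1n.
rewrite -sumEFin; apply: lee_sum => j _.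
apply: (@le_trans _ _ ((2 ^+ j)%:E * (C2 * (3 * C ^+ 2 / 4 ^+ j))%:E))%E.
  rewrite lee_wpmul2l ?lee_fin ?exprn_ge0//; apply: le_trans (H2 _ _) _.
  by rewrite lee_fin ler_wpM2l.
rewrite -EFinM lee_fin exprVn (_ : 4 = 2 * 2)//; last by ring.
rewrite exprMn le_eqVlt; apply/orP; left; apply/eqP; field.
by rewrite expf_neq0.
Qed.

(** Every dyadic block contributes at least 1/4. *)
Lemma harmonic_unbounded (A : R) : exists M, forall K, (M <= K)%N ->
  A <= \sum_(1 <= n < K) (2 * n%:R)^-1.
Proof.
have dyadic J : J%:R / 4 <= \sum_(1 <= n < 2 ^ J) (2 * n%:R)^-1 :> R.
  elim: J => [|J ih]; first by rewrite mul0r sumr_ge0// => n _; rewrite invr_ge0 mulr_ge0.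
  rewrite (@big_cat_nat _ _ _ (2 ^ J)%N)/= ?expn_gt0 ?leq_exp2l//.
  rewrite -natr1 mulrDl; apply: lerD => //.
  apply: (@le_trans _ _ (\sum_(2 ^ J <= n < 2 ^ J.+1) (2 * (2 ^ J.+1)%:R)^-1)).
    rewrite sumr_const_nat expnS mul2n -addnn addnK addnn -mul2n natrM natrX -[_ *+ (2 ^ J)]mulr_natr natrX.
    by rewrite le_eqVlt; apply/orP; left; apply/eqP; field; rewrite expf_neq0.
  apply: ler_sum_nat => n /andP[Jn nJ].
  have n0 : (0 < n)%N by rewrite (leq_trans _ Jn)// expn_gt0.
  rewrite lef_pV2 ?posrE ?mulr_gt0 ?ltr0n ?expn_gt0//.
  by rewrite ler_wpM2l// ler_nat ltnW.
pose J := Num.bound `|A * 4|.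
exists (2 ^ J)%N => K JK.
apply: (@le_trans _ _ (J%:R / 4)).
  rewrite ler_pdivlMr//; apply: le_trans (ler_norm _) _.
  by apply/ltW/archi_boundP.
apply: le_trans (dyadic J) _.
rewrite [leRHS](@big_cat_nat _ _ _ (2 ^ J)%N)/= ?expn_gt0//.
by rewrite lerDl sumr_ge0// => n _; rewrite invr_ge0 mulr_ge0.
Qed.

(** The weights lam_n w_n lie between multiples of 1/n. Their squares are summable, so the deviation
    from the mean has bounded second moment, while the mean itself diverges like the harmonic
    series. *)
Lemma ae_critical_norm_unbounded :
  {ae P, forall x, forall A : R, exists N, A <= \sum_(1 <= n < N) lam n * nsq (datum x n)}.
Proof.
have [m [D [m0 D0 HD]]] := gaussian_mean g_gauss g_indep.
have [C C0 HC] := critical_weight_le alpha.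
have [C' HC'] := @sum_powR_le R 2 ltac:(by rewrite ltr1n).
(* The comparison with 1/n starts at n = 1; the value 0 at the origin lets the sums range over
   ordinals. *)
pose p n : R := if n is 0%N then 0 else lam n * w n.
have p2 K : \sum_(n < K) p n ^+ 2 <= C ^+ 2 * C'.
  apply: (@le_trans _ _ (C ^+ 2 * \sum_(1 <= n < K.+1) (n%:R `^ 2)^-1)); last first.
    by rewrite ler_wpM2l ?sqr_ge0.
  rewrite mulr_sumr -(big_mkord xpredT (fun n => p n ^+ 2)).
  apply: (@le_trans _ _ (\sum_(0 <= n < K.+1) p n ^+ 2)).
    by rewrite big_nat_recr//= lerDl sqr_ge0.
  rewrite big_ltn// expr0n add0r big_nat [leRHS]big_nat; apply: ler_sum => -[//|n] _.
  rewrite (powR_mulrn 2)// -exprVn -exprMn; apply: lerXn2r; rewrite ?nnegrE.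
  - by rewrite mulr_ge0// ltW// sobolev_weight_gt0.
  - by rewrite divr_ge0.
  exact: HC.
have mp K : measurable_fun setT (fun x => (\sum_(n < K) p n * (nsq (g n x) - m)) ^+ 2).
  apply: measurable_funX; apply: measurable_sum => n; apply: measurable_funM => //.
  by apply: measurable_funB => //; apply: measurable_nsq; exact: cmfun_gaussian.
have := @ae_frequently_bounded _ _ _ P
  (fun K x => (\sum_(n < K) p n * (nsq (g n x) - m)) ^+ 2) (D * (C ^+ 2 * C')) mp.
move=> /(_ _ _)/filterS; apply; last 2 first.
- by move=> K x; exact: sqr_ge0.
- by move=> K; apply: le_trans (HD p K) _; rewrite lee_fin ler_wpM2l.
move=> x [B HB] A.
(* The deviation y satisfies y^2 <= B, hence y >= - (1 + B); the mean must exceed [A] by that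
   much. *)
have [M HM] := harmonic_unbounded ((A + 1 + B) / m).
have [K MK KB] := HB M; exists K.
have -> : \sum_(1 <= n < K) lam n * nsq (datum x n) = \sum_(n < K) p n * nsq (g n x).
  case: K {MK KB} => [|K]; first by rewrite big_geq// big_ord0.
  rewrite -(big_mkord xpredT (fun n => p n * nsq (g n x))) big_ltn// mul0r add0r.
  apply: eq_big_nat => -[//|n] _.
  by rewrite nsq_datum mulrA.
have ps : (A + 1 + B) / m <= \sum_(n < K) p n.
  apply: le_trans (HM K MK) _.
  case: K {MK KB} => [|K]; first by rewrite big_geq// big_ord0.
  rewrite -(big_mkord xpredT p) [leRHS]big_ltn// add0r.
  apply: ler_sum_nat => -[//|n] _.
  exact: critical_weight_ge.
move: KB; rewrite (_ : \sum_(n < K) p n * (nsq (g n x) - m) =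
    \sum_(n < K) p n * nsq (g n x) - m * \sum_(n < K) p n); last first.
  rewrite mulr_sumr -sumrB; apply: eq_bigr => n _; ring.
rewrite ler_pdivrMr// in ps; move: ps.
set L := \sum_(n < K) p n * nsq (g n x); set S := \sum_(n < K) p n => ps KB.
have := sqr_ge0 (L - m * S + 1); have := sqr_ge0 (L - m * S); nra.
Qed.

End AlmostSure.

(** * Fourier analysis of trigonometric polynomials on the torus *)

Section TorusExponentials.
Variable R : realType.
Local Notation leb := (@lebesgue_measure R).
Local Notation torus := (@torus R : set (measurableTypeR R)).

Lemma measurable_torus : measurable torus.
Proof. exact: measurable_itv. Qed.

Lemma twopi_gt0 : 0 < 2 * pi :> R.
Proof. by rewrite mulr_gt0// pi_gt0. Qed.

Lemma leb_torus : leb torus = (2 * pi)%:E.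
Proof. by rewrite lebesgue_measure_itv/= lte_fin twopi_gt0 -EFinB subr0. Qed.

Lemma expi0 x : expi 0 x = 1 :> R[i].
Proof. by rewrite /expi mul0r cos0 sin0. Qed.

Lemma expiD m n (x : R) : expi (m + n) x = expi m x * expi n x.
Proof.
by rewrite /expi intrD mulrDl cosD sinD; apply: complex_eqP => /=; ring.
Qed.

Lemma expiN n (x : R) : expi (- n) x = conjc (expi n x).
Proof. by rewrite /expi mulrNz mulNr cosN sinN. Qed.

Lemma nsq_expi n (x : R) : nsq (expi n x) = 1.
Proof. by rewrite /nsq /expi /= cos2Dsin2. Qed.

Lemma cmfun_expi n : cmfun torus (fun x : R => expi n x).
Proof.
have ml : measurable_fun torus (fun x : R => n%:~R * x) by exact: measurable_funM.
by split; apply: measurableT_comp ml; apply: continuous_measurable_fun;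
  [exact: continuous_cos|exact: continuous_sin].
Qed.

Lemma integrable_torus_cst (c : R) : leb.-integrable torus (EFin \o cst c).
Proof.
apply/integrableP; split; first exact/measurable_EFinP.
rewrite (eq_integral (cst `|c|%:E)) => [|x _ //].
have h : (`|c|%:E * leb torus < +oo)%E by rewrite leb_torus -EFinM ltry.
by rewrite (integral_cst _ measurable_torus); exact: h.
Qed.

Lemma cintegrable_expi n : cintegrable leb torus (fun x : R => expi n x).
Proof.
apply: (cintegrable_nsq_le measurable_torus (cmfun_expi n) (integrable_torus_cst 1)) => x _ //.
by rewrite nsq_expi expr1n.
Qed.

Let cos_int_2pi n : cos (n%:~R * (2 * pi)) = 1 :> R.
Proof.
have pos (k : nat) : cos (k%:R * (2 * pi)) = 1 :> R.
  rewrite (_ : k%:R * (2 * pi) = 0 + (pi *+ 2) *+ k).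
    by rewrite (periodicn (@cosD2pi R)) cos0.
  by rewrite add0r !mulr_natl.
by case: n => k; [exact: pos|rewrite NegzE mulrNz mulNr cosN; exact: pos].
Qed.

Let sin_int_2pi n : sin (n%:~R * (2 * pi)) = 0 :> R.
Proof.
have pos (k : nat) : sin (k%:R * (2 * pi)) = 0 :> R.
  rewrite (_ : k%:R * (2 * pi) = 0 + (pi *+ 2) *+ k).
    by rewrite (periodicn (@sinD2pi R)) sin0.
  by rewrite add0r !mulr_natl.
by case: n => k; [exact: pos|rewrite NegzE mulrNz mulNr sinN pos oppr0].
Qed.

Let ftc (F f : R -> R) : continuous f -> (forall x : R, is_derive x 1 F (f x)) ->
  F (2 * pi) = F 0 -> \int[leb]_(x in torus) f x = 0.
Proof.
move=> cf dF F2pi.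
have cF : continuous F.
  by move=> x; apply: differentiable_continuous; apply/derivable1_diffP; case: (dF x).
rewrite /Rintegral (@continuous_FTC2 _ f F 0 (2 * pi) twopi_gt0).
- by rewrite F2pi subee.
- exact: continuous_subspaceT.
- split; first by move=> x _; case: (dF x).
  + exact: cvg_at_right_filter (cF _).
  + exact: cvg_at_left_filter (cF _).
- by move=> x _; rewrite derive1E; case: (dF x).
Qed.

Lemma cint_expi n : cint leb torus (fun x : R => expi n x) = if n == 0 then (2 * pi)%:C%C else 0.
Proof.
case: eqVneq => [->|n0].
  rewrite (@eq_cint _ _ _ _ _ _ (fun=> (1 : R)%:C%C)); last by move=> x _; rewrite expi0.
  rewrite /cint /= !Rintegral_cst//=; try exact: measurable_torus.
  by rewrite leb_torus /= mul1r mul0r.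
have nR : n%:~R != 0 :> R by rewrite intr_eq0.
have lin (x : R) : is_derive x 1 (fun x : R => n%:~R * x) (n%:~R *: 1).
  exact: is_deriveZ.
rewrite /cint /expi /=; apply: complex_eqP => /=.
- apply: (@ftc (fun x => n%:~R^-1 * sin (n%:~R * x))).
  + move=> x; apply: (@continuous_comp _ _ _ (fun x : R => n%:~R * x) cos).
      exact: mulrl_continuous.
    exact: continuous_cos.
  + move=> x; have dsin := is_derive1_comp (is_derive_sin (n%:~R * x)) (lin x).
    apply: is_derive_eq (is_deriveZ n%:~R^-1 dsin) _.
    by rewrite /GRing.scale /= mulr1 mulrCA mulVf// mulr1.
  + by rewrite sin_int_2pi !mulr0 sin0 mulr0.
- apply: (@ftc (fun x => - (n%:~R^-1 * cos (n%:~R * x)))).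
  + move=> x; apply: (@continuous_comp _ _ _ (fun x : R => n%:~R * x) sin).
      exact: mulrl_continuous.
    exact: continuous_sin.
  + move=> x; have dcos := is_derive1_comp (is_derive_cos (n%:~R * x)) (lin x).
    apply: is_derive_eq (is_deriveN (is_deriveZ n%:~R^-1 dcos)) _.
    by rewrite /GRing.scale /= mulr1 mulNr mulrN opprK mulrCA mulVf// mulr1.
  + by rewrite cos_int_2pi !mulr0 cos0.
Qed.

End TorusExponentials.

Section TrigonometricSums.
Variable R : realType.
Local Notation leb := (@lebesgue_measure R).
Local Notation torus := (@torus R : set (measurableTypeR R)).
Implicit Types a : nat -> R[i].

Lemma conjcM (x y : R[i]) : conjc (x * y) = conjc x * conjc y.
Proof. exact: rmorphM. Qed.

Definition trig_sum a K (x : R) : R[i] := \sum_(k < K) a k * expi k%:Z x.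

Lemma cmfun_trig_sum a K : cmfun torus (trig_sum a K).
Proof.
by apply: cmfun_sum => k _; apply: cmfunM; [exact: cmfun_cst|exact: cmfun_expi].
Qed.

Lemma trig_sum_triads a K (x : R) (n : nat) :
  trig_sum a K x * conjc (trig_sum a K x) * trig_sum a K x * expi (- n%:Z) x =
  \sum_(t : 'I_K * 'I_K * 'I_K) triad a t *
    expi (t.1.1%:Z - t.1.2%:Z + t.2%:Z - n%:Z) x.
Proof.
rewrite /trig_sum rmorph_sum /= big_distrlr /= pair_bigA /= big_distrlr /= pair_bigA /=.
rewrite mulr_suml; apply: eq_bigr => -[[i j] k] _ /=.
by rewrite !expiD conjcM -expiN /triad /=; ring.
Qed.

(** Orthogonality of the exponentials keeps exactly the interacting triads. *)
Lemma trig_sum_cint a K n :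
  cintegrable leb torus (fun x => trig_sum a K x * conjc (trig_sum a K x) * trig_sum a K x *
    expi (- n%:Z) x) /\
  cint leb torus (fun x => trig_sum a K x * conjc (trig_sum a K x) * trig_sum a K x *
    expi (- n%:Z) x) = (2 * pi)%:C%C * cubic a K n.
Proof.
have mT := @measurable_torus R.
have iT (t : 'I_K * 'I_K * 'I_K) : cintegrable leb torus (fun x => triad a t *
    expi (t.1.1%:Z - t.1.2%:Z + t.2%:Z - n%:Z) x).
  by apply: cintegrableZ => //; exact: cintegrable_expi.
split.
  apply: (eq_cintegrable mT) (cintegrable_sum mT (index_enum _) (fun t (_ : true) => iT t)) => x _.
  by rewrite trig_sum_triads.
transitivity (cint leb torus (fun x => \sum_(t : 'I_K * 'I_K * 'I_K) triad a t *
    expi (t.1.1%:Z - t.1.2%:Z + t.2%:Z - n%:Z) x)).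
  by apply: eq_cint => x _; exact: trig_sum_triads.
rewrite cint_sum// mulr_sumr big_mkcond /= [RHS]big_mkcond /=; apply: eq_bigr => t _.
rewrite cintZ//; last exact: cintegrable_expi.
rewrite cint_expi /interacts.
have -> : (t.1.1%:Z - t.1.2%:Z + t.2%:Z - n%:Z == 0) = (t.1.1 + t.2 == n + t.1.2)%N.
  by apply/eqP/eqP; lia.
by case: ifP; rewrite ?mulr0// mulrC.
Qed.

(** In |S|^4 only one conjugated factor is expanded, which leaves the Fourier coefficients of |S|^2
    S just computed. *)
Lemma trig_sum_quartic a K :
  leb.-integrable torus (EFin \o (fun x => nsq (trig_sum a K x) ^+ 2)) /\
  (\int[leb]_(x in torus) (nsq (trig_sum a K x) ^+ 2)) =
  2 * pi * Re (\sum_(n < K) conjc (a n) * cubic a K n).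
Proof.
have mT := @measurable_torus R.
pose F n x := trig_sum a K x * conjc (trig_sum a K x) * trig_sum a K x * expi (- n%:Z) x.
have expand x : (nsq (trig_sum a K x) ^+ 2)%:C%C = \sum_(n < K) conjc (a n) * F n x.
  rewrite expr2 rmorphM /= -mulcJ; set S := trig_sum a K x.
  have SJ : conjc S = \sum_(n < K) conjc (a n) * expi (- n%:Z) x.
    by rewrite /S /trig_sum rmorph_sum /=; apply: eq_bigr => n _; rewrite conjcM -expiN.
  rewrite mulrA [X in _ * X]SJ mulr_sumr; apply: eq_bigr => n _.
  by rewrite /F -/S; ring.
have iF n : cintegrable leb torus (F n) by case: (trig_sum_cint a K n).
have iaF (n : 'I_K) : cintegrable leb torus (fun x => conjc (a n) * F n x).
  by apply: cintegrableZ => //; exact: iF.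
have [ir _] := cintegrable_sum mT (index_enum _) (fun n (_ : true) => iaF n).
split.
  apply: eq_integrable ir => // x _ /=; by rewrite -expand.
transitivity (Re (cint leb torus (fun x => \sum_(n < K) conjc (a n) * F n x))).
  by apply: eq_Rintegral => x _; rewrite -expand.
rewrite cint_sum//.
rewrite (eq_bigr (fun n : 'I_K => (2 * pi)%:C%C * (conjc (a n) * cubic a K n))).
  by rewrite -mulr_sumr Re_mul /= mul0r subr0.
move=> n _; rewrite (cintZ mT _ (iF n)).
by have [_ ->] := trig_sum_cint a K n; rewrite mulrCA.
Qed.

Lemma trig_sum_square a K :
  leb.-integrable torus (EFin \o (fun x => nsq (trig_sum a K x))) /\
  \int[leb]_(x in torus) nsq (trig_sum a K x) = 2 * pi * \sum_(k < K) nsq (a k).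
Proof.
have mT := @measurable_torus R.
pose F (p : 'I_K * 'I_K) x := a p.1 * conjc (a p.2) * expi (p.1%:Z - p.2%:Z) x.
have expand x : (nsq (trig_sum a K x))%:C%C = \sum_(p : 'I_K * 'I_K) F p x.
  rewrite -mulcJ /trig_sum rmorph_sum /= big_distrlr /= pair_bigA /=; apply: eq_bigr => -[i j] _ /=.
  by rewrite conjcM -expiN /F expiD /=; ring.
have iF p : cintegrable leb torus (F p).
  by apply: cintegrableZ => //; exact: cintegrable_expi.
have [ir _] := cintegrable_sum mT (index_enum _) (fun p (_ : true) => iF p).
split.
  apply: eq_integrable ir => // x _ /=; by rewrite -expand.
transitivity (Re (cint leb torus (fun x => \sum_(p : 'I_K * 'I_K) F p x))).
  by apply: eq_Rintegral => x _; rewrite -expand.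
rewrite cint_sum// (eq_bigr (fun p : 'I_K * 'I_K => if p.1 == p.2 then
    (2 * pi)%:C%C * (nsq (a p.1))%:C%C else 0)); last first.
  move=> [i j] _ /=; rewrite cintZ//; last exact: cintegrable_expi.
  rewrite cint_expi /= subr_eq0 eqz_nat (inj_eq val_inj).
  by case: eqVneq => [->|_]; rewrite ?mulr0// mulcJ mulrC.
rewrite -big_mkcond /= -(pair_big_dep xpredT (fun i j : 'I_K => i == j)
  (fun i j => (2 * pi)%:C%C * (nsq (a i))%:C%C)) /=.
rewrite (eq_bigr (fun i : 'I_K => (2 * pi)%:C%C * (nsq (a i))%:C%C)).
  by rewrite -mulr_sumr -rmorph_sum -rmorphM.
by move=> i _; rewrite (big_pred1 i) => // j; rewrite eq_sym.
Qed.

(** Zeroing the first coefficients, rather than shifting the index, keeps the difference a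
    trigonometric sum to which Parseval's identity applies. *)
Lemma trig_sumB a K L (x : R) : (L <= K)%N ->
  trig_sum a K x - trig_sum a L x = trig_sum (fun k => if (k < L)%N then 0 else a k) K x.
Proof.
move=> LK; rewrite /trig_sum.
rewrite -!(big_mkord xpredT (fun k => a k * expi k%:Z x)).
rewrite -(big_mkord xpredT (fun k => (if (k < L)%N then 0 else a k) * expi k%:Z x)).
rewrite (@big_cat_nat _ _ _ L)//= [RHS](@big_cat_nat _ _ _ L)//=.
rewrite [in RHS]big_nat [in RHS]big1 ?add0r => [|k /andP[_ ->]]; last by rewrite mul0r.
rewrite addrAC subrr add0r; apply: eq_big_nat => k /andP[Lk _].
by rewrite ltnNge Lk.
Qed.

Lemma trig_sumB_square a K L : (L <= K)%N ->
  leb.-integrable torus (EFin \o (fun x => nsq (trig_sum a K x - trig_sum a L x))) /\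
  \int[leb]_(x in torus) nsq (trig_sum a K x - trig_sum a L x) =
    2 * pi * \sum_(L <= k < K) nsq (a k).
Proof.
move=> LK; have [i e] := trig_sum_square (fun k => if (k < L)%N then 0 else a k) K.
split; first by apply: eq_integrable i => // [|x _ /=]; [exact: measurable_torus|rewrite trig_sumB].
under eq_Rintegral do rewrite trig_sumB//.
rewrite e -(big_mkord xpredT (fun k => nsq (if (k < L)%N then 0 else a k))).
rewrite (@big_cat_nat _ _ _ L)//= [in LHS]big_nat [in LHS]big1 ?add0r => [|k /andP[_ ->]].
  by congr (_ * _); apply: eq_big_nat => k /andP[Lk _]; rewrite ltnNge Lk.
exact: nsq0.
Qed.

(** The partial sum of order [N] includes the frequency [N], whereas [trig_sum] stops before its
    bound. *)
Lemma fourier_partial_sumE (c : distr R) N (x : R) : (forall n : int, n < 0 -> c n = 0) ->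
  fourier_partial_sum c N x = trig_sum (fun k => c k%:Z) N.+1 x.
Proof.
move=> c0; rewrite /fourier_partial_sum [X in _ + X]big1 ?addr0// => k _.
by rewrite c0 ?mul0r// oppr_lt0.
Qed.

End TrigonometricSums.

(** * Almost everywhere convergence from dyadically weighted square sums *)

Section RealSequences.
Variable R : realType.
Implicit Types u : nat -> R.

Lemma sum_tail_le u (B eps : R) : (forall k, 0 <= u k) -> (forall K, \sum_(k < K) u k <= B) ->
  0 < eps -> exists N, forall L K, (N <= L)%N -> \sum_(L <= k < K) u k <= eps.
Proof.
move=> u0 uB eps0.
pose S := [set y | exists K, y = \sum_(k < K) u k].
have hS : has_sup S.
  by split; [exists (\sum_(k < 0) u k), 0%N|exists B => _ [K ->]].
have [_ [N ->] NS] := sup_adherent eps0 hS.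
exists N => L K NL; have [LK|KL] := leqP L K; last first.
  by rewrite big_geq ?(ltnW KL)// ltW.
have : \sum_(k < K) u k <= sup S by apply: ub_le_sup; [exact: hS.2|exists K].
move: NS; rewrite -!(big_mkord xpredT u) (@big_cat_nat _ _ _ L _ K)//=.
rewrite (@big_cat_nat _ _ _ N _ L)//=.
have : 0 <= \sum_(N <= k < L) u k by rewrite sumr_ge0.
by lra.
Qed.

(** Turns square summability with weights 2^j into absolute summability without the Cauchy-Schwarz
    inequality. *)
Lemma normr_le_dyadic j (y : R) : `|y| <= (2 ^+ j)^-1 + 2 ^+ j * y ^+ 2.
Proof.
have p0 : 0 < 2 ^+ j :> R by rewrite exprn_gt0.
have e : 2 ^+ j * ((2 ^+ j)^-1 + 2 ^+ j * y ^+ 2) = 1 + `|2 ^+ j * y| ^+ 2.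
  by rewrite real_normK ?num_real// exprMn; field; rewrite gt_eqF.
rewrite -(ler_pM2l p0) e -[X in X * _]gtr0_norm// -normrM.
have := sqr_ge0 (`|2 ^+ j * y| - 1); have := normr_ge0 (2 ^+ j * y); nra.
Qed.

Lemma sum_inv2_le J : \sum_(j < J) (2 ^+ j)^-1 <= 2 :> R.
Proof.
have -> : \sum_(j < J) (2 ^+ j)^-1 = 2 - 2 / 2 ^+ J :> R.
  elim: J => [|J ih]; first by rewrite big_ord0 expr0 divr1 subrr.
  by rewrite big_ord_recr /= ih exprS; field; rewrite expf_neq0.
by rewrite lerBlDr lerDl divr_ge0// exprn_ge0.
Qed.

Lemma cvg_dyadic_increments u (B : R) :
  (forall J, \sum_(j < J) 2 ^+ j * (u j.+1 - u j) ^+ 2 <= B) -> cvgn u.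
Proof.
move=> uB.
have : cvgn [normed series (telescope u)].
  apply: nondecreasing_is_cvgn.
    by apply: nondecreasing_series => n _ _ /=.
  exists (2 + B) => _ [J _ <-] /=; rewrite /series /= big_mkord.
  apply: (@le_trans _ _ (\sum_(j < J) ((2 ^+ j)^-1 + 2 ^+ j * (u j.+1 - u j) ^+ 2))).
    by apply: ler_sum => j _; exact: normr_le_dyadic.
  by rewrite big_split /= lerD ?sum_inv2_le// uB.
move=> /normed_cvg c; rewrite (funext (eq_sum_telescope u)).
by apply: is_cvgD => //; exact: is_cvg_cst.
Qed.

End RealSequences.

Section DyadicSum.
Context {d : measure_display} {T : measurableType d} {R : realType}.
Variable mu : {measure set T -> \bar R}.

(** Integrals of order 4^(-j) afford the weight 2^j: the weighted integrals still form a geometric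
    series. The conclusion feeds the pointwise convergence criteria. *)
Lemma ae_dyadic_sum_bounded (D : set T) (h : nat -> T -> R) (c : R) : measurable D ->
  (forall j, measurable_fun D (h j)) -> (forall j x, 0 <= h j x) -> 0 <= c ->
  (forall j, (\int[mu]_(x in D) (h j x)%:E <= (c / 4 ^+ j)%:E)%E) ->
  {ae mu, forall x, D x -> exists B : R, forall J, \sum_(j < J) 2 ^+ j * h j x <= B}.
Proof.
move=> mD mh h0 c0 hc.
apply: (@ae_sum_bounded _ _ _ mu D (fun j x => 2 ^+ j * h j x) (fun j => c * (2 ^+ j)^-1) (c * 2)).
- exact: mD.
- by move=> j; apply: measurable_funM => //.
- by move=> j x; rewrite mulr_ge0 ?exprn_ge0.
- move=> j; under eq_integral do rewrite EFinM.
  rewrite ge0_integralZl ?lee_fin ?exprn_ge0//; last 2 first.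
  + by apply/measurable_EFinP.
  + by move=> x _; rewrite lee_fin.
  apply: (@le_trans _ _ ((2 ^+ j)%:E * (c / 4 ^+ j)%:E)%E).
    by apply: lee_wpmul2l => //; rewrite lee_fin exprn_ge0.
  have -> : 4 = 2 * 2 :> R by rewrite -natrM.
  rewrite -EFinM lee_fin le_eqVlt exprMn; apply/orP; left; apply/eqP.
  by field; rewrite expf_neq0.
- by move=> J; rewrite -mulr_sumr ler_wpM2l// sum_inv2_le.
Qed.

End DyadicSum.

(** * The Riesz-Fischer theorem for the chosen Fourier sum *)

Section RieszFischer.
Variable R : realType.
Local Notation leb := (@lebesgue_measure R).
Local Notation torus := (@torus R : set (measurableTypeR R)).
Implicit Types (a : nat -> R[i]) (f : R -> R[i]).

(** For coefficients vanishing at negative frequencies this is [is_fourier_sum], with the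
    extended-real limit unfolded into a bound for each [eps]. *)
Definition l2_limit a f := cmfun torus f /\ forall eps : R, 0 < eps ->
  exists N, forall K, (N <= K)%N ->
    (\int[leb]_(x in torus) (nsq (f x - trig_sum a K x))%:E <= eps%:E)%E.

Lemma cvg_nsqB (F : nat -> R[i]) (z c : R[i]) :
  Re (F j) @[j --> \oo] --> Re z -> Im (F j) @[j --> \oo] --> Im z ->
  nsq (F j - c) @[j --> \oo] --> nsq (z - c).
Proof.
move=> rF iF; rewrite /nsq !Re_sub !Im_sub !expr2.
under eq_fun do rewrite !Re_sub !Im_sub !expr2.
by apply: cvgD; apply: cvgM; apply: cvgB => //; exact: cvg_cst.
Qed.

Lemma cvg_fine_limn_esup (u : nat -> R) : cvgn u ->
  u @ \oo --> fine (limn_esup (fun j => (u j)%:E)).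
Proof.
move=> cu; have e : (fun j => (u j)%:E) @ \oo --> (limn u)%:E.
  by apply: cvg_EFin cu; exact: nearW.
by rewrite is_cvg_limn_esupE ?(cvg_lim _ e)//; apply/cvg_ex; exists (limn u)%:E.
Qed.

Lemma integral_EFinE (h : R -> R) : leb.-integrable torus (EFin \o h) ->
  (\int[leb]_(x in torus) (h x)%:E = (\int[leb]_(x in torus) h x)%:E)%E.
Proof.
move=> ih; rewrite /Rintegral fineK//.
by have := integrable_fin_num (@measurable_torus R) ih.
Qed.

Lemma integral_trig_sumB a K L : (L <= K)%N ->
  (\int[leb]_(x in torus) (nsq (trig_sum a K x - trig_sum a L x))%:E =
   (2 * pi * \sum_(L <= k < K) nsq (a k))%:E)%E.
Proof. by move=> LK; have [i <-] := trig_sumB_square a LK; exact: integral_EFinE. Qed.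

(** Truncations chosen with tails at most 4^(-j) converge almost everywhere; Fatou's lemma then
    bounds the distance from the limit to any late truncation by the tail. *)
Lemma riesz_fischer a (B : R) : (forall K, \sum_(k < K) nsq (a k) <= B) ->
  exists f, l2_limit a f.
Proof.
move=> aB; have mT := @measurable_torus R; have tp := twopi_gt0 R.
have a0 k : 0 <= nsq (a k) by exact: nsq_ge0.
have tail j : exists N, forall L K, (N <= L)%N -> \sum_(L <= k < K) nsq (a k) <= (4 ^+ j)^-1.
  by apply: (sum_tail_le a0 aB); rewrite invr_gt0 exprn_gt0.
pose m j := sval (cid (tail j)).
(* The maximum makes [M] monotone, so that tails telescope, and the summand [j] makes it reach every
   [K]. *)
pose M j := (\max_(i < j.+1) m i + j)%N.
have mM j : (m j <= M j)%N.
  by apply: leq_trans (leq_addr _ _); exact: (@leq_bigmax _ (fun i : 'I_j.+1 => m i) ord_max).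
have MS j : (M j <= M j.+1)%N.
  by rewrite /M leq_add// [leqRHS]big_ord_recr /= leq_maxl.
have jM j : (j <= M j)%N by exact: leq_addl.
pose F j := trig_sum a (M j).
have mF j : cmfun torus (F j) by exact: cmfun_trig_sum.
have inc : {ae leb, forall x, torus x ->
    exists B, forall J, \sum_(j < J) 2 ^+ j * nsq (F j.+1 x - F j x) <= B}.
  apply: (@ae_dyadic_sum_bounded _ _ _ leb torus (fun j x => nsq (F j.+1 x - F j x)) (2 * pi)).
  - exact: mT.
  - by move=> j; apply: measurable_nsq; exact: cmfunB.
  - by move=> j x; exact: nsq_ge0.
  - exact: ltW.
  - move=> j; rewrite (integral_trig_sumB a (MS j)) lee_fin ler_pM2l//.
    by apply: (svalP (cid (tail j))); exact: mM.
(* An upper limit is measurable everywhere, and it equals the limit wherever that exists. *)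
pose f x := (fine (limn_esup (fun j => (Re (F j x))%:E)) +i*
             fine (limn_esup (fun j => (Im (F j x))%:E)))%C.
have mf : cmfun torus f.
  split; (apply: measurableT_comp; first exact: fine_measurable);
  by apply: measurable_fun_limn_esup => j; apply/measurable_EFinP; case: (mF j).
have Ff : {ae leb, forall x, torus x -> Re (F j x) @[j --> \oo] --> Re (f x) /\
    Im (F j x) @[j --> \oo] --> Im (f x)}.
  apply: filterS inc => x + Dx => /(_ Dx)[C HC]; split => /=; apply: cvg_fine_limn_esup;
    apply: (@cvg_dyadic_increments _ _ C) => J; apply: le_trans (HC J);
    apply: ler_sum => j _; rewrite ler_pM2l ?exprn_gt0//.
    by rewrite -Re_sub Re_sqr_le.
  by rewrite -Im_sub Im_sqr_le.
exists f; split => // eps eps0.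
have [N HN] := sum_tail_le a0 aB (divr_gt0 eps0 tp).
exists N => K NK.
apply: (@ae_lim_integral_le _ _ _ leb torus (fun j x => nsq (F j x - trig_sum a K x)) _ _ K) => //.
- by move=> j; apply: measurable_nsq; apply: cmfunB => //; exact: cmfun_trig_sum.
- by apply: measurable_nsq; apply: cmfunB => //; exact: cmfun_trig_sum.
- by move=> *; exact: nsq_ge0.
- by move=> *; exact: nsq_ge0.
- by apply: filterS Ff => x + Dx => /(_ Dx)[r i]; exact: cvg_nsqB.
move=> j Kj; rewrite integral_trig_sumB ?lee_fin ?(leq_trans Kj)//.
by rewrite mulrC -ler_pdivlMr// HN.
Qed.

Section OfDistribution.
Variables (c : distr R) (c_neg : forall n : int, n < 0 -> c n = 0).
Let a k := c k%:Z.

Let integral_partial_sum f N :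
  (\int[leb]_(x in torus) ((Normc.normc (f x - fourier_partial_sum c N x)) ^+ 2)%:E =
   \int[leb]_(x in torus) (nsq (f x - trig_sum a N.+1 x))%:E)%E.
Proof.
by apply: eq_integral => x _; rewrite normc_sqr fourier_partial_sumE.
Qed.

Lemma is_fourier_sumP f : is_fourier_sum c f <-> l2_limit a f.
Proof.
have pos N : (0 <= \int[leb]_(x in torus) (nsq (f x - trig_sum a N.+1 x))%:E)%E.
  by apply: integral_ge0 => x _; rewrite lee_fin nsq_ge0.
split=> -[mf h]; split => //.
- move=> eps eps0.
  have : \forall N \near \oo,
      (\int[leb]_(x in torus) (nsq (f x - trig_sum a N.+1 x))%:E <= eps%:E)%E.
    have := h; under eq_fun do rewrite integral_partial_sum.
    move=> /fine_cvgP[fin /cvgr0Pnorm_le/(_ eps eps0)] le.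
    near=> N; rewrite -(@fineK _ (\int[leb]_(x in torus) _)%E); last by near: N.
    by rewrite lee_fin (le_trans (ler_norm _))//; near: N.
  move=> [N _ HN]; exists N.+1 => -[//|K]; rewrite ltnS => NK; exact: HN.
- under eq_fun do rewrite integral_partial_sum.
  have near_le (eps : R) : 0 < eps -> \forall N \near \oo,
      (\int[leb]_(x in torus) (nsq (f x - trig_sum a N.+1 x))%:E <= eps%:E)%E.
    by move=> /h[N HN]; exists N => // K /= NK; apply: HN; exact: leqW.
  apply/fine_cvgP; split.
    apply: filterS (near_le 1 ltr01) => N le1.
    by rewrite ge0_fin_numE// (le_lt_trans le1)// ltry.
  apply/cvgr0Pnorm_le => eps eps0; apply: filterS (near_le eps eps0) => N leN /=.
  rewrite ger0_norm ?fine_ge0// -lee_fin fineK//.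
  by rewrite ge0_fin_numE// (le_lt_trans leN)// ltry.
Unshelve. all: by end_near. Qed.

Lemma fun_of_distr_l2_limit (B : R) : (forall K, \sum_(k < K) nsq (a k) <= B) ->
  l2_limit a (fun_of_distr c).
Proof.
move=> /riesz_fischer[f /is_fourier_sumP cf].
by apply/is_fourier_sumP; exact: (@xgetPex _ (fun=> 0) [set f | is_fourier_sum c f] (ex_intro _ f cf)).
Qed.

End OfDistribution.
End RieszFischer.

(** * Passage to the limit in the cubic coefficients *)

Section CubicCoefficients.
Variable R : realType.
Local Notation leb := (@lebesgue_measure R).
Local Notation torus := (@torus R : set (measurableTypeR R)).
Implicit Types (a : nat -> R[i]) (f : R -> R[i]).

(** The criterion on increments is applied to the series of the [x_ j - l]: the series converges, so
    its terms tend to 0. *)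
Lemma cvg_dyadic_sqr (x_ : nat -> R) (l B : R) :
  (forall J, \sum_(j < J) 2 ^+ j * (x_ j - l) ^+ 2 <= B) -> x_ @ \oo --> l.
Proof.
move=> xB; apply/subr_cvg0; apply: cvg_series_cvg_0.
apply: (@cvg_dyadic_increments _ _ B) => J; apply: le_trans (xB J).
by apply: ler_sum => j _; rewrite /series /= big_nat_recr//= addrAC subrr add0r.
Qed.

Lemma nsq_cubicB (x y : R[i]) : nsq (x * conjc x * x - y * conjc y * y) <=
  16 * nsq (x - y) * (nsq x ^+ 2 + nsq y ^+ 2).
Proof.
have -> : x * conjc x * x - y * conjc y * y =
    x * conjc x * (x - y) + x * (conjc (x - y)) * y + (x - y) * conjc y * y.
  by rewrite rmorphB /=; ring.
apply: le_trans (nsqD_le _ _) _.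
apply: (@le_trans _ _ (2 * (2 * nsq (x * conjc x * (x - y)) + 2 * nsq (x * conjc (x - y) * y)) +
   2 * nsq ((x - y) * conjc y * y))).
  by rewrite lerD2r ler_pM2l// nsqD_le.
rewrite !nsqM !nsqJ; move: (nsq_ge0 (x - y)) (nsq_ge0 x) (nsq_ge0 y).
move: (nsq (x - y)) (nsq x) (nsq y) => p F G p0 F0 G0.
rewrite -subr_ge0.
have -> : 16 * p * (F ^+ 2 + G ^+ 2) - (2 * (2 * (F * F * p) + 2 * (F * p * G)) + 2 * (p * G * G)) =
  p * (2 * (F - G) ^+ 2 + 10 * F ^+ 2 + 12 * G ^+ 2) by ring.
by rewrite mulr_ge0// !addr_ge0// mulr_ge0// sqr_ge0.
Qed.

(** By orthogonality this is the mean over the torus of the fourth power of the modulus of the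
    truncated series. *)
Definition quartic_energy a K : R := Re (\sum_(n < K) conjc (a n) * cubic a K n).

Lemma integral_quartic a K :
  (\int[leb]_(x in torus) (nsq (trig_sum a K x) ^+ 2)%:E = (2 * pi * quartic_energy a K)%:E)%E.
Proof. by have [i <-] := trig_sum_quartic a K; exact: integral_EFinE. Qed.

(** Among the [K] of bounded energy, some are within 4^(-j) of [f] in squared L^2 distance. Along
    them the truncations converge almost everywhere, and Fatou's lemma transfers the L^4 bound to
    [f]. *)
Lemma l2_limit_quartic a f (B : R) : l2_limit a f ->
  (forall M, exists2 K, (M <= K)%N & quartic_energy a K <= B) ->
  (\int[leb]_(x in torus) (nsq (f x) ^+ 2)%:E <= (2 * pi * B)%:E)%E.
Proof.
move=> [mf af] good.
have pick j : exists K, quartic_energy a K <= B /\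
    (\int[leb]_(x in torus) (nsq (f x - trig_sum a K x))%:E <= (1 / 4 ^+ j)%:E)%E.
  have [N HN] := af (1 / 4 ^+ j) ltac:(by rewrite divr_gt0 ?exprn_gt0).
  by have [K NK KB] := good N; exists K; split => //; exact: HN.
pose k j := sval (cid (pick j)); pose F j := trig_sum a (k j).
have kP j := svalP (cid (pick j)).
have mF j : cmfun torus (F j) by exact: cmfun_trig_sum.
have inc : {ae leb, forall x, torus x ->
    exists C, forall J, \sum_(j < J) 2 ^+ j * nsq (f x - F j x) <= C}.
  apply: (@ae_dyadic_sum_bounded _ _ _ leb torus (fun j x => nsq (f x - F j x)) 1).
  - exact: measurable_torus.
  - by move=> j; apply: measurable_nsq; exact: cmfunB.
  - by move=> j x; exact: nsq_ge0.
  - exact: ler01.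
  - by move=> j; case: (kP j).
apply: (@ae_lim_integral_le _ _ _ leb torus (fun j x => nsq (F j x) ^+ 2) _ _ 0%N).
- exact: measurable_torus.
- by move=> j; apply: measurable_funX; exact: measurable_nsq.
- by apply: measurable_funX; exact: measurable_nsq.
- by move=> *; exact: sqr_ge0.
- by move=> *; exact: sqr_ge0.
- apply: filterS inc => x + Dx => /(_ Dx)[C HC].
  have lim : nsq (F j x) @[j --> \oo] --> nsq (f x).
    rewrite -[X in _ --> nsq X]subr0.
    rewrite (_ : (fun j => _) = (fun j => nsq (F j x - 0))); last by apply/funext => j; rewrite subr0.
    apply: cvg_nsqB; apply: (@cvg_dyadic_sqr _ _ C) => J; apply: le_trans (HC J);
      apply: ler_sum => j _; rewrite ler_pM2l ?exprn_gt0// nsqB.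
      by rewrite -Re_sub Re_sqr_le.
    by rewrite -Im_sub Im_sqr_le.
  by rewrite expr2; under eq_fun do rewrite expr2; exact: cvgM.
- move=> j _; rewrite integral_quartic lee_fin ler_pM2l ?twopi_gt0//.
  by case: (kP j).
Qed.

End CubicCoefficients.

Section CubicIntegrals.
Context {d : measure_display} {T : measurableType d} {R : realType}.
Variable mu : {measure set T -> \bar R}.
Variable D : set T.
Hypothesis mD : measurable D.
Implicit Types (f e : T -> R[i]) (h : T -> R).

Lemma nsq_cint_le f h : cintegrable mu D f -> mu.-integrable D (EFin \o h) ->
  (forall x, D x -> 0 <= h x) -> (forall x, D x -> nsq (f x) <= h x ^+ 2) ->
  nsq (cint mu D f) <= 2 * (\int[mu]_(x in D) h x) ^+ 2.
Proof.
move=> [ir ii] ih h0 fh.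
have bound (q : T -> R) : mu.-integrable D (EFin \o q) -> (forall x, D x -> `|q x| <= h x) ->
    (\int[mu]_(x in D) q x) ^+ 2 <= (\int[mu]_(x in D) h x) ^+ 2.
  move=> iq qh; have int_le : `|\int[mu]_(x in D) q x| <= \int[mu]_(x in D) h x.
    apply: le_trans (le_normr_Rintegral mD iq) _.
    by apply: le_Rintegral => //; exact: integrable_norm.
  by rewrite -[leLHS]real_normK ?num_real// ler_pXn2r// nnegrE (le_trans _ int_le).
rewrite /nsq /= mulr2n mulrDl !mul1r lerD// bound// => x Dx.
  by apply: normr_Re_le; [exact: h0|exact: fh].
by apply: normr_Im_le; [exact: h0|exact: fh].
Qed.

Lemma ge0_integrable h (C : R) : measurable_fun D h -> (forall x, 0 <= h x) ->
  (\int[mu]_(x in D) (h x)%:E <= C%:E)%E ->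
  mu.-integrable D (EFin \o h) /\ \int[mu]_(x in D) h x <= C.
Proof.
move=> mh h0 hC; have ih : mu.-integrable D (EFin \o h).
  apply/integrableP; split; first exact/measurable_EFinP.
  rewrite (eq_integral (EFin \o h)) => [|x _ /=]; last by rewrite ger0_norm.
  exact: le_lt_trans hC (ltry C).
split => //; rewrite -lee_fin /Rintegral fineK//.
by have := integrable_fin_num mD ih.
Qed.

Lemma cintegrable_cubic f e (A : R) : mu.-integrable D (EFin \o cst 1) ->
  cmfun D f -> cmfun D e -> (forall x, nsq (e x) = 1) ->
  (\int[mu]_(x in D) (nsq (f x) ^+ 2)%:E <= A%:E)%E ->
  cintegrable mu D (fun x => f x * conjc (f x) * f x * e x).
Proof.
move=> i1 mf me e1 fA.
have [if2 _] := ge0_integrable (measurable_funX 2 (measurable_nsq mf)) (fun x => sqr_ge0 _) fA.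
apply: (@cintegrable_nsq_le _ _ _ mu D mD _ (fun x => 1 + nsq (f x) ^+ 2)).
- by apply: cmfunM => //; apply: cmfunM => //; apply: cmfunM => //; exact: cmfunJ.
- have := integrableD mD i1 if2; exact: eq_integrable.
- by move=> x _; rewrite addr_ge0// sqr_ge0.
move=> x _; rewrite !nsqM nsqJ e1 mulr1; move: (nsq (f x)) => F.
(* The inequality F^3 <= (1 + F^2)^2, that is |f|^3 <= 1 + |f|^4, by a sum of squares. *)
rewrite -subr_ge0 (_ : _ - _ = 1 + F ^+ 2 + F ^+ 2 * (2^-1 ^+ 2 *+ 3 + (F - 2^-1) ^+ 2)).
  apply: addr_ge0; first by rewrite addr_ge0// sqr_ge0.
  by apply: mulr_ge0; rewrite ?addr_ge0 ?mulrn_wge0// sqr_ge0.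
by field.
Qed.

(** The cubic difference is at most 4 |f - g| sqrt (|f|^4 + |g|^4). The parameter [t] splits this
    product into the squared L^2 distance and the L^4 norms: a large [t] makes the second part
    small, then a small [eta] the first. *)
Lemma cint_cubic_close f g e (A eta t : R) : mu.-integrable D (EFin \o cst 1) ->
  cmfun D f -> cmfun D g -> cmfun D e -> (forall x, nsq (e x) = 1) ->
  (\int[mu]_(x in D) (nsq (f x) ^+ 2)%:E <= A%:E)%E ->
  (\int[mu]_(x in D) (nsq (g x) ^+ 2)%:E <= A%:E)%E ->
  (\int[mu]_(x in D) (nsq (f x - g x))%:E <= eta%:E)%E -> 0 < t ->
  nsq (cint mu D (fun x => f x * conjc (f x) * f x * e x) -
       cint mu D (fun x => g x * conjc (g x) * g x * e x)) <=
  2 * (2 * t * eta + 4 * t^-1 * A) ^+ 2.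
Proof.
move=> i1 mf mg me e1 fA gA fg t0.
have icf := cintegrable_cubic i1 mf me e1 fA.
have icg := cintegrable_cubic i1 mg me e1 gA.
have [if2 f2] := ge0_integrable (measurable_funX 2 (measurable_nsq mf)) (fun x => sqr_ge0 _) fA.
have [ig2 g2] := ge0_integrable (measurable_funX 2 (measurable_nsq mg)) (fun x => sqr_ge0 _) gA.
have [ifg fg1] := ge0_integrable (measurable_nsq (cmfunB mf mg)) (fun x => nsq_ge0 _) fg.
rewrite -cintB//.
have ti0 : 0 < t^-1 by rewrite invr_gt0.
pose h x := 2 * t * nsq (f x - g x) + 2 * t^-1 * (nsq (f x) ^+ 2 + nsq (g x) ^+ 2).
have iZ (k : R) q : mu.-integrable D (EFin \o q) -> mu.-integrable D (EFin \o (fun x => k * q x)).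
  by move=> iq; have := integrableZl mD k iq; apply: eq_integrable => // x _ /=; rewrite EFinM.
have i2 : mu.-integrable D (EFin \o (fun x => nsq (f x) ^+ 2 + nsq (g x) ^+ 2)).
  have := integrableD mD if2 ig2; exact: eq_integrable.
have ih : mu.-integrable D (EFin \o h).
  have := integrableD mD (iZ (2 * t) _ ifg) (iZ (2 * t^-1) _ i2); exact: eq_integrable.
have hval : \int[mu]_(x in D) h x <= 2 * t * eta + 4 * t^-1 * A.
  rewrite (RintegralD mD (iZ (2 * t) _ ifg) (iZ (2 * t^-1) _ i2)).
  rewrite (RintegralZl (2 * t) mD ifg) (RintegralZl (2 * t^-1) mD i2) (RintegralD mD if2 ig2).
  apply: lerD; first by rewrite ler_wpM2l// mulr_ge0// ltW.
  rewrite (_ : 4 * t^-1 * A = 2 * t^-1 * (A + A)); last by ring.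
  by rewrite ler_wpM2l// ?lerD// mulr_ge0// ltW.
have h0 x : 0 <= h x.
  apply: addr_ge0; apply: mulr_ge0; rewrite ?nsq_ge0 ?addr_ge0 ?sqr_ge0//.
    by rewrite mulr_ge0// ltW.
  by rewrite mulr_ge0// ltW.
apply: le_trans (nsq_cint_le _ ih (fun x _ => h0 x) _) _; first exact: cintegrableB.
  move=> x _; rewrite -mulrBl nsqM e1 mulr1; apply: le_trans (nsq_cubicB _ _) _.
  rewrite /h; move: (nsq _) (nsq (f x) ^+ 2 + _) => p q.
  rewrite -subr_ge0 (_ : _ - _ = (2 * t * p - 2 * t^-1 * q) ^+ 2) ?sqr_ge0//.
  by field; rewrite gt_eqF.
rewrite ler_pM2l// ler_pXn2r// nnegrE.
  by apply: Rintegral_ge0.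
by apply: le_trans hval; apply: Rintegral_ge0.
Qed.

End CubicIntegrals.

Section CubicLimit.
Variable R : realType.
Local Notation leb := (@lebesgue_measure R).
Local Notation torus := (@torus R : set (measurableTypeR R)).
Implicit Types (a : nat -> R[i]) (f : R -> R[i]).

Lemma l2_limit_cubic a f (B : R) n : l2_limit a f ->
  (forall M, exists2 K, (M <= K)%N & quartic_energy a K <= B) ->
  forall eps : R, 0 < eps -> exists M, forall K, (M <= K)%N -> quartic_energy a K <= B ->
  nsq (((2 * pi)^-1)%:C%C *
    cint leb torus (fun x => f x * conjc (f x) * f x * expi (- n%:Z) x) - cubic a K n) <= eps.
Proof.
move=> af good eps eps0; have tp := twopi_gt0 R.
have fB := l2_limit_quartic af good.
have [mf l2f] := af.
(* A positive majorant is needed as a numerator, whatever the sign of [B]. *)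
pose C := `|2 * pi * B| + 1; have C0 : 0 < C by rewrite ltr_pwDr.
have leC (x : \bar R) : (x <= (2 * pi * B)%:E)%E -> (x <= C%:E)%E.
  move=> /le_trans; apply; rewrite lee_fin /C (le_trans (ler_norm _))// lerDl//.
(* With [t] and [eta] below, both terms of the closeness bound equal e1 / 2. As e1 <= 1, the bound 2
   e1^2 is at most 2 e1, which the second argument of the minimum keeps below eps (2 pi)^2. *)
pose e1 := Num.min 1 (eps * (2 * pi) ^+ 2 / 2).
have e10 : 0 < e1 by rewrite lt_min ltr01 divr_gt0// mulr_gt0// exprn_gt0.
pose t := 8 * C / e1; have t0 : 0 < t by rewrite divr_gt0// mulr_gt0.
pose eta := e1 / (4 * t); have eta0 : 0 < eta by rewrite divr_gt0// mulr_gt0.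
have [M HM] := l2f eta eta0.
exists M => K MK KB.
have K4 : (\int[leb]_(x in torus) (nsq (trig_sum a K x) ^+ 2)%:E <= C%:E)%E.
  by apply: leC; rewrite integral_quartic lee_fin ler_pM2l.
have := cint_cubic_close (@measurable_torus R) (@integrable_torus_cst R 1) mf
  (cmfun_trig_sum a K) (cmfun_expi R (- n%:Z)) (nsq_expi (- n%:Z)) (leC _ fB) K4 (HM K MK) t0.
have [_ ->] := trig_sum_cint a K n.
have -> : 2 * t * eta + 4 * t^-1 * C = e1.
  by rewrite /eta /t; field; rewrite !gt_eqF.
set I := cint _ _ _ => Ile.
rewrite (_ : _ - _ = ((2 * pi)^-1)%:C%C * (I - (2 * pi)%:C%C * cubic a K n)); last first.
  by rewrite mulrBr mulrA -rmorphM mulVf ?gt_eqF// mul1r.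
rewrite nsqM nsq_real exprVn ler_pdivrMl ?exprn_gt0//; apply: le_trans Ile _.
have e1l : e1 <= 1 by rewrite ge_min lexx.
have e1r : e1 <= eps * (2 * pi) ^+ 2 / 2 by rewrite ge_min lexx orbT.
move: e1r; rewrite ler_pdivlMr// => e1r.
apply: (@le_trans _ _ (2 * e1)); last by rewrite mulrC (le_trans e1r)// mulrC.
by rewrite ler_pM2l// expr2 ler_piMl// ltW.
Qed.

End CubicLimit.

(** * Resonant decomposition and consequences for a fixed sample *)

Section ResonantDecomposition.
Variable R : realType.
Implicit Types a : nat -> R[i].

Definition mass a K : R := \sum_(k < K) nsq (a k).

(** If n2 = n1 the relation forces n3 = n, and if n2 = n3 it forces n1 = n; each family gives the
    mass times a_n. The triad with all frequencies equal to [n] belongs to both and is counted once,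
    whence the subtraction. *)
Lemma cubic_decomposition a K n : (n < K)%N ->
  cubic a K n = (2 * mass a K - nsq (a n))%:C%C * a n + cubic_nr a K n.
Proof.
move=> nK; pose m := Ordinal nK.
rewrite /cubic (bigID (@nonresonant K)) /= addrC; congr (_ + _).
rewrite (bigID (fun t : 'I_K * 'I_K * 'I_K => t.1.2 == t.1.1)) /=.
have -> : \sum_(t : 'I_K * 'I_K * 'I_K | interacts n t && ~~ nonresonant t && (t.1.2 == t.1.1))
    triad a t = \sum_(k < K) (nsq (a k))%:C%C * a n.
  rewrite (reindex_onto (fun k : 'I_K => ((k, k), m)) (fun t => t.1.1)) /=.
    apply: eq_big => [k|k _]; last by rewrite /triad /= mulcJ.
    by rewrite /interacts /nonresonant /= !eqxx /= addnC eqxx.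
  move=> [[i j] k] /= /andP[/andP[/eqP + _] /eqP e]; rewrite /= e => h.
  by congr (_, _); apply/val_inj => /=; lia.
have -> : \sum_(t : 'I_K * 'I_K * 'I_K | interacts n t && ~~ nonresonant t && (t.1.2 != t.1.1))
    triad a t = \sum_(k < K | k != m) (nsq (a k))%:C%C * a n.
  rewrite (reindex_onto (fun k : 'I_K => ((m, k), k)) (fun t => t.2)) /=.
    apply: eq_big => [k|k _]; last by rewrite /triad /= -mulcJ; ring.
    by rewrite /interacts /nonresonant /= !eqxx /= !andbF andbT.
  move=> [[i j] k] /=; rewrite /nonresonant /interacts /= => /andP[/andP[/eqP h +] ne].
  by rewrite ne /= negbK => /eqP e; rewrite e in h *; congr (_, _, _); apply/val_inj => /=; lia.
have -> : \sum_(k < K | k != m) (nsq (a k))%:C%C * a n =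
    \sum_(k < K) (nsq (a k))%:C%C * a n - (nsq (a n))%:C%C * a n.
  by rewrite [in RHS](bigD1 m)//= addrAC subrr add0r.
by rewrite -!mulr_suml -!rmorph_sum /= rmorphB rmorphM /= mulrBl -/(mass a K); ring.
Qed.

Lemma nsq_le_mass a K n : (n < K)%N -> nsq (a n) <= mass a K.
Proof.
move=> nK; rewrite /mass (bigD1 (Ordinal nK))//= lerDl sumr_ge0// => *; exact: nsq_ge0.
Qed.

Lemma mass_ge0 a K : 0 <= mass a K.
Proof. by apply: sumr_ge0 => *; exact: nsq_ge0. Qed.

Lemma weighted_energyE (lam : nat -> R) a K :
  \sum_(n < K) lam n * Re (conjc (a n) * cubic a K n) =
  \sum_(n < K) lam n * ((2 * mass a K - nsq (a n)) * nsq (a n)) + Re (quartic_nr lam a K).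
Proof.
rewrite /quartic_nr Re_sum -big_split /=; apply: eq_bigr => n _.
rewrite (cubic_decomposition _ (ltn_ord n)) mulrDr Re_add mulrDr; congr (_ + _).
  rewrite mulrCA [conjc _ * _]mulrC mulcJ.
  by rewrite -rmorphM.
by rewrite [RHS]Re_mul /= mul0r subr0.
Qed.

(** The resonant part is at most twice the squared mass, so an L^4 bound follows from the mass and
    the nonresonant form; 1 + B comes from q <= 1 + q^2. *)
Lemma quartic_energy_le a K (S B : R) : mass a K <= S -> nsq (quartic_nr (cst 1) a K) <= B ->
  quartic_energy a K <= 2 * S ^+ 2 + (1 + B).
Proof.
move=> aS aB; have S0 := le_trans (mass_ge0 a K) aS.
rewrite /quartic_energy Re_sum.
have := weighted_energyE (cst 1) a K; rewrite (eq_bigr (fun n : 'I_K => Re (conjc (a n) * cubic a K n))).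
  move=> ->; apply: lerD.
    apply: (@le_trans _ _ (\sum_(n < K) 2 * S * nsq (a n))).
      apply: ler_sum => n _; rewrite mul1r ler_wpM2r ?nsq_ge0//.
      have := nsq_ge0 (a n); lra.
    by rewrite -mulr_sumr expr2 mulrA ler_wpM2l// mulr_ge0.
  set q := Re _; have : q ^+ 2 <= B := le_trans (Re_sqr_le _) aB.
  have := sqr_ge0 (q - 1); nra.
by move=> n _; rewrite mul1r.
Qed.

End ResonantDecomposition.

Lemma normr_Re_Jmul_le (R : realType) (x y : R[i]) (t : R) : 0 < t ->
  `|Re (conjc x * y)| <= t / 2 * nsq x + t^-1 / 2 * nsq y.
Proof.
move=> t0; have ti : 0 <= t^-1 / 2 by rewrite divr_ge0// invr_ge0 ltW.
case: x y => a b [a' b']; rewrite /nsq /= ler_norml -subr_ge0 -[X in _ && X]subr_ge0.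
apply/andP; split.
  rewrite (_ : _ - _ = t^-1 / 2 * ((t * a + a') ^+ 2 + (t * b + b') ^+ 2)).
    by rewrite mulr_ge0// addr_ge0// sqr_ge0.
  by field; rewrite gt_eqF.
rewrite (_ : _ - _ = t^-1 / 2 * ((t * a - a') ^+ 2 + (t * b - b') ^+ 2)).
  by rewrite mulr_ge0// addr_ge0// sqr_ge0.
by field; rewrite gt_eqF.
Qed.

Section CubicCoefficientBounds.
Variables (R : realType) (a c : nat -> R[i]) (S : R).
Hypothesis aS : forall K, mass a K <= S.
(** What is retained of the pointwise product: its coefficients are limits of the truncated ones
    along those [K] whose L^4 norms stay bounded. *)
Hypothesis c_lim : forall B : R,
  (forall M, exists2 K, (M <= K)%N & quartic_energy a K <= B) ->
  forall n (eps : R), 0 < eps -> exists M, forall K, (M <= K)%N -> quartic_energy a K <= B ->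
  nsq (c n - cubic a K n) <= eps.

Let S_ge0 : 0 <= S := le_trans (mass_ge0 a 0) (aS 0).

(** Finitely many coefficients can be approximated at one [K] that is also good for [Q]. Both uses
    take for [Q] the quartic form plus the nonnegative quantity to be kept bounded. *)
Let approximation (Q : nat -> R) (B : R) (rho : nat -> R) (N M : nat) :
  (forall n, 0 <= rho n) ->
  (forall K, nsq (quartic_nr (cst 1) a K) <= Q K) ->
  (forall M, exists2 K, (M <= K)%N & Q K <= B) ->
  exists K, [/\ (M <= K)%N, Q K <= B & \sum_(n < N) rho n * nsq (c n - cubic a K n) <= 1].
Proof.
move=> rho0 qQ good; pose B' := 2 * S ^+ 2 + (1 + B).
have QB K : Q K <= B -> quartic_energy a K <= B'.
  by move=> /(le_trans (qQ K)); exact: quartic_energy_le.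
have good' L : exists2 K, (L <= K)%N & quartic_energy a K <= B'.
  by have [K LK /QB] := good L; exists K.
pose W := 1 + \sum_(n < N) rho n; have W0 : 0 < W by rewrite ltr_wpDr// sumr_ge0.
have Wi : 0 < W^-1 by rewrite invr_gt0.
have [L HL] : exists L, forall K, (L <= K)%N -> quartic_energy a K <= B' ->
    forall n, (n < N)%N -> nsq (c n - cubic a K n) <= W^-1.
  elim: (N) => [|n [L HL]]; first by exists 0%N.
  have [L' HL'] := c_lim good' n Wi; exists (maxn L L') => K.
  rewrite geq_max => /andP[LK L'K] KB i; rewrite ltnS leq_eqVlt => /orP[/eqP->|]; first exact: HL'.
  exact: HL.
have [K MK KB] := good (maxn M L); move: MK; rewrite geq_max => /andP[MK LK].
exists K; split=> //; apply: (@le_trans _ _ (\sum_(n < N) rho n * W^-1)).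
  by apply: ler_sum => n _; rewrite ler_wpM2l// HL// QB.
by rewrite -mulr_suml ler_pdivrMr// mul1r lerDr.
Qed.

Lemma cubic_weighted_bounded (rho : nat -> R) (A B : R) : (forall n, 0 <= rho n) ->
  (forall N, \sum_(n < N) rho n * nsq (a n) <= A) ->
  (forall M, exists2 K, (M <= K)%N & nsq (quartic_nr (cst 1) a K) +
    \sum_(n < K) rho n * nsq (cubic_nr a K n) <= B) ->
  forall N, \sum_(n < N) rho n * nsq (c n) <= 2 + 16 * S ^+ 2 * A + 4 * B.
Proof.
move=> rho0 aA good N.
have [K [NK KB KN]] := approximation N N rho0
  (fun K => ler_wpDr (sumr_ge0 _ (fun n _ => mulr_ge0 (rho0 _) (nsq_ge0 _))) (lexx _)) good.
have nr : \sum_(n < N) rho n * nsq (cubic_nr a K n) <= B.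
  apply: le_trans KB; apply: ler_wpDl; first exact: nsq_ge0.
  rewrite -!(big_mkord xpredT (fun n => rho n * nsq (cubic_nr a K n))).
  by rewrite [leRHS](@big_cat_nat _ _ _ N)//= lerDl sumr_ge0// => *; rewrite mulr_ge0// nsq_ge0.
(* Twice |x + y|^2 <= 2 |x|^2 + 2 |y|^2: first for c_n against its truncation, then for the resonant
   and nonresonant parts, with (2 mass - |a_n|^2)^2 <= 4 S^2. *)
apply: (@le_trans _ _ (\sum_(n < N) (2 * (rho n * nsq (c n - cubic a K n)) +
  (16 * S ^+ 2 * (rho n * nsq (a n)) + 4 * (rho n * nsq (cubic_nr a K n)))))).
  apply: ler_sum => n _.
  have nK : (n < K)%N := leq_trans (ltn_ord n) NK.
  have h1 := nsqD_le (c n - cubic a K n) (cubic a K n); rewrite subrK in h1.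
  have h2 := nsqD_le ((2 * mass a K - nsq (a n))%:C%C * a n) (cubic_nr a K n).
  rewrite -cubic_decomposition// nsqM nsq_real in h2.
  have h3 : (2 * mass a K - nsq (a n)) ^+ 2 <= 4 * S ^+ 2.
    rewrite (_ : 4 * S ^+ 2 = (2 * S) ^+ 2); last by rewrite exprMn -natrX.
    have p1 : 0 <= 2 * mass a K - nsq (a n).
      by have := nsq_le_mass a nK; have := mass_ge0 a K; lra.
    have p2 : 2 * mass a K - nsq (a n) <= 2 * S.
      by have := aS K; have := nsq_ge0 (a n); lra.
    by rewrite ler_pXn2r ?nnegrE// mulr_ge0.
  have h4 := ler_wpM2r (nsq_ge0 (a n)) h3.
  rewrite [X in _ <= X](_ : _ = rho n * (2 * nsq (c n - cubic a K n) +
    (16 * S ^+ 2 * nsq (a n) + 4 * nsq (cubic_nr a K n)))); last by ring.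
  by rewrite ler_wpM2l//; lra.
rewrite !big_split /= -!mulr_sumr -addrA; apply: lerD; first by rewrite ler_piMr.
apply: lerD; last by rewrite ler_pM2l.
by apply: ler_wpM2l; [rewrite mulr_ge0// sqr_ge0|exact: aA].
Qed.

(** The blocks start at 4^0 = 1, so frequency 0 belongs to none of them. *)
Lemma block_weight_sum alpha J n : \sum_(j < J) block_weight alpha j n =
  if (0 < n < 4 ^ J)%N then sobolev_weight (alpha - 2^-1) n else 0 :> R.
Proof.
elim: J => [|J ih]; first by rewrite big_ord0; case: ifP => //; case: n => [|[]].
rewrite big_ord_recr /= ih /block_weight.
have p4 : (0 < 4 ^ J)%N by rewrite expn_gt0.
have [n0|n0] := posnP n; first by rewrite n0 /= leqn0 gtn_eqF// addr0.
have [nJ|Jn] := ltnP n (4 ^ J); rewrite /= ?add0r//.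
by rewrite (leq_trans nJ) ?addr0// leq_exp2l.
Qed.

Lemma cubic_critical_unbounded alpha (A B : R) :
  (forall M, exists2 K, (M <= K)%N & nsq (quartic_nr (cst 1) a K) +
    \sum_(j < K) 2 ^+ j * nsq (quartic_nr (block_weight alpha j) a K) <= B) ->
  (forall A : R, exists N, A <= \sum_(1 <= n < N) sobolev_weight (alpha - 2^-1) n * nsq (a n)) ->
  ~ (forall N, \sum_(n < N) sobolev_weight (alpha - 2^-1) n * nsq (c n) <= A).
Proof.
move=> good unbounded cA; set lam := sobolev_weight (alpha - 2^-1) in unbounded cA *.
have lam0 n : 0 <= lam n by exact/ltW/sobolev_weight_gt0.
(* One nonzero coefficient serves as lower bound for the mass: for [m] and [n] below [K], the
   resonant factor 2 mass - |a_n|^2 is at least the mass, hence at least |a_m|^2. *)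
have [m am] : exists m, 0 < nsq (a m).
  apply: contrapT => /forallNP a0; have [N] := unbounded 1.
  rewrite big1 ?leNgt ?ltr01// => n _.
  have := nsq_ge0 (a n); rewrite le_eqVlt => /orP[/eqP<-|/a0 //]; by rewrite mulr0.
set sg := nsq (a m) in am.
(* The estimates below give sg L <= sg / 2 L + (A + 1) / sg + (2 + B). The threshold makes sg / 2 L
   exceed the last two terms by 1. *)
have [N LN] := unbounded (2 / sg * (sg^-1 * (A + 1) + (2 + B) + 1)).
(* As N < 4^N, cutting the weight at 4^J keeps every frequency from 1 to N - 1. *)
pose J := N; pose Lam n := \sum_(j < J) block_weight alpha j n.
have LamE n : Lam n = if (0 < n < 4 ^ J)%N then lam n else 0 by exact: block_weight_sum.
have Lam0 n : 0 <= Lam n by rewrite LamE; case: ifP.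
have qpos K : 0 <= \sum_(j < K) 2 ^+ j * nsq (quartic_nr (block_weight alpha j) a K).
  by apply: sumr_ge0 => j _; rewrite mulr_ge0 ?exprn_ge0// nsq_ge0.
have [K [MK KB KN]] := approximation (4 ^ J) (maxn (maxn J m.+1) (4 ^ J)) lam0
  (fun K => ler_wpDr (qpos K) (lexx _)) good.
move: MK; rewrite !geq_max -andbA => /and3P[JK mK JK4].
(* A block form q_j is at most 2^(-j) + 2^j q_j^2 in modulus; the first terms sum to at most 2
   whatever the cut-off. *)
have quart : `|Re (quartic_nr Lam a K)| <= 2 + B.
  have -> : quartic_nr Lam a K = \sum_(j < J) quartic_nr (block_weight alpha j) a K.
    rewrite /quartic_nr exchange_big /=; apply: eq_bigr => n _.
    by rewrite -mulr_suml -rmorph_sum.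
  rewrite Re_sum; apply: le_trans (ler_norm_sum _ _ _) _.
  apply: (@le_trans _ _ (\sum_(j < J) ((2 ^+ j)^-1 +
      2 ^+ j * nsq (quartic_nr (block_weight alpha j) a K)))).
    apply: ler_sum => j _; set q := quartic_nr _ _ _.
    by apply: le_trans (normr_le_dyadic j _) _; rewrite lerD2l ler_wpM2l ?exprn_ge0// Re_sqr_le.
  rewrite big_split /= lerD ?sum_inv2_le//; apply: le_trans KB.
  apply: ler_wpDl; first exact: nsq_ge0.
  rewrite -!(big_mkord xpredT (fun j => 2 ^+ j * nsq (quartic_nr (block_weight alpha j) a K))).
  rewrite [leRHS](@big_cat_nat _ _ _ J)//= lerDl sumr_ge0// => j _.
  by rewrite mulr_ge0 ?exprn_ge0// nsq_ge0.
have energy := weighted_energyE Lam a K.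
pose L := \sum_(n < K) Lam n * nsq (a n).
have lower : sg * L <= \sum_(n < K) Lam n * ((2 * mass a K - nsq (a n)) * nsq (a n)).
  rewrite mulr_sumr; apply: ler_sum => n _; rewrite mulrCA ler_wpM2l// ler_wpM2r ?nsq_ge0//.
  have := nsq_le_mass a (ltn_ord n); have := nsq_le_mass a mK; rewrite -/sg; lra.
have csum : \sum_(n < K) Lam n * nsq (cubic a K n) <= 2 * (A + 1).
  apply: (@le_trans _ _ (\sum_(n < 4 ^ J) lam n * nsq (cubic a K n))).
    rewrite -(big_mkord xpredT (fun n => Lam n * nsq (cubic a K n))).
    rewrite -(big_mkord xpredT (fun n => lam n * nsq (cubic a K n))).
    rewrite (@big_cat_nat _ _ _ (4 ^ J))//= [X in _ + X]big_nat [X in _ + X]big1 ?addr0.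
      by apply: ler_sum => n _; rewrite ler_wpM2r ?nsq_ge0// LamE; case: ifP.
    by move=> n /andP[Jn _]; rewrite LamE (ltnNge n) Jn andbF mul0r.
  apply: (@le_trans _ _ (\sum_(n < 4 ^ J) (2 * (lam n * nsq (c n)) +
      2 * (lam n * nsq (c n - cubic a K n))))).
    apply: ler_sum => n _; rewrite mulrCA [2 * (lam n * nsq (_ - _))]mulrCA -mulrDr ler_wpM2l//.
    have := nsqD_le (c n) (- (c n - cubic a K n)); rewrite nsqN.
    by rewrite opprB addrC subrK.
  rewrite big_split /= -!mulr_sumr mulrDr; apply: lerD; rewrite ler_pM2l//; exact: cA.
(* The parameter in the quadratic inequality is [sg], so that only half of the resonant lower bound
   is spent on the a_n. *)
have upper : \sum_(n < K) Lam n * Re (conjc (a n) * cubic a K n) <=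
    sg / 2 * L + sg^-1 * (A + 1).
  apply: (@le_trans _ _ (\sum_(n < K) (sg / 2 * (Lam n * nsq (a n)) +
      sg^-1 / 2 * (Lam n * nsq (cubic a K n))))).
    apply: ler_sum => n _.
    rewrite mulrCA [sg^-1 / 2 * _]mulrCA -mulrDr ler_wpM2l//.
    apply: le_trans (ler_norm _) _.
    exact: normr_Re_Jmul_le.
  rewrite big_split /= -!mulr_sumr lerD2l -mulrA ler_pM2l ?invr_gt0//.
  by rewrite ler_pdivrMl.
have LNL : \sum_(1 <= n < N) lam n * nsq (a n) <= L.
  have NK : (N <= K)%N by exact: JK.
  rewrite /L -(big_mkord xpredT (fun n => Lam n * nsq (a n))).
  have [N1|N1] := leqP N 1; first by rewrite [leLHS]big_geq//; apply: sumr_ge0 => n _; rewrite mulr_ge0// nsq_ge0.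
  rewrite [leRHS](@big_cat_nat _ _ _ N)//= [X in _ <= X + _](@big_cat_nat _ _ _ 1%N _ N)// 1?ltnW//=.
  have pos i j : 0 <= \sum_(i <= n < j) Lam n * nsq (a n).
    by apply: sumr_ge0 => n _; rewrite mulr_ge0// nsq_ge0.
  rewrite -[leLHS]addr0; apply: lerD => //; rewrite -[leLHS]add0r; apply: lerD => //.
  apply: ler_sum_nat => n /andP[n1 nN]; rewrite LamE n1 /=.
  by rewrite (leq_trans nN)// ltnW// ltn_expl.
have {}LN := le_trans LN LNL.
have sq : 2 / sg * (sg^-1 * (A + 1) + (2 + B) + 1) * (sg / 2) = sg^-1 * (A + 1) + (2 + B) + 1.
  by field; rewrite gt_eqF.
have := ler_wpM2r (ltW (divr_gt0 am (ltr0n R 2) : 0 < sg / 2)) LN; rewrite sq.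
move: quart; rewrite ler_norml => /andP[q1 q2].
lra.
Qed.

End CubicCoefficientBounds.

(** * Sobolev norms of the Duhamel term and of the second iterate *)

Section SobolevNorms.
Variable R : realType.
Implicit Types (c : distr R) (s T : R).

Lemma sobolev_normE s c : (forall n : int, n < 0 -> c n = 0) ->
  sobolev_norm s c = sqrte (\sum_(n <oo) (sobolev_weight s n * nsq (c n%:Z))%:E)%E.
Proof.
move=> c0; rewrite /sobolev_norm; congr sqrte.
rewrite (_ : (fun n : int => _) = (fun n : int => if n \in range Posz then
    ((1 + n%:~R ^+ 2) `^ s * nsq (c n))%:E else 0%E)); last first.
  apply/funext => n; rewrite normc_sqr; case: ifPn => // nn.
  rewrite c0 ?nsq0 ?mulr0// ltNge; apply: contra nn.
  by case: n => // k _; rewrite inE; exists k.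
rewrite -esum_mkcond nneseries_esumT => [|n]; last first.
  by rewrite lee_fin mulr_ge0 ?nsq_ge0// ltW// sobolev_weight_gt0.
rewrite (@reindex_esum _ _ _ setT _ Posz)//.
split; [by move=> n _; exists n|by move=> m n _ _ []|by []].
Qed.

Lemma sobolev_norm_le s c (B : R) : (forall n : int, n < 0 -> c n = 0) ->
  (forall N, \sum_(n < N) sobolev_weight s n * nsq (c n%:Z) <= B) ->
  (sobolev_norm s c <= (Num.sqrt B)%:E)%E.
Proof.
move=> c0 cB; have B0 : 0 <= B by have := cB 0%N; rewrite big_ord0.
have t0 n : 0 <= sobolev_weight s n * nsq (c n%:Z).
  by rewrite mulr_ge0 ?nsq_ge0// ltW// sobolev_weight_gt0.
rewrite sobolev_normE// (_ : (Num.sqrt B)%:E = sqrte B%:E)// lee_sqrt ?lee_fin//.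
apply: lime_le; first by apply: is_cvg_nneseries => n _ _; rewrite lee_fin.
by apply: nearW => N; rewrite sumEFin lee_fin big_mkord.
Qed.

Lemma sobolev_norm_fin s c : (forall n : int, n < 0 -> c n = 0) ->
  (sobolev_norm s c < +oo)%E ->
  exists A : R, forall N, \sum_(n < N) sobolev_weight s n * nsq (c n%:Z) <= A.
Proof.
move=> c0; rewrite sobolev_normE//.
have t0 n : 0 <= sobolev_weight s n * nsq (c n%:Z).
  by rewrite mulr_ge0 ?nsq_ge0// ltW// sobolev_weight_gt0.
set S := (\sum_(n <oo) _)%E => Soo.
have S0 : (0 <= S)%E by apply: nneseries_ge0 => n _ _; rewrite lee_fin.
have Sfin : S \is a fin_num by rewrite -sqrte_fin_num// ge0_fin_numE// sqrte_ge0.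
exists (fine S) => N; rewrite -lee_fin fineK//.
have := @nneseries_lim_ge R (fun n => (sobolev_weight s n * nsq (c n%:Z))%:E) xpredT 0%N N.
by rewrite sumEFin big_mkord; apply=> n _ _; rewrite lee_fin.
Qed.

Lemma Csobolev_norm_pinfty T s (v : R -> distr R) t : - T <= t <= T ->
  ~ (sobolev_norm s (v t) < +oo)%E -> Csobolev_norm T s v = +oo%E.
Proof.
move=> tT vt; rewrite /Csobolev_norm; case: ifPn => // /asboolP /(_ t).
by rewrite in_itv /= tT => /(_ isT)[].
Qed.

Lemma Csobolev_norm_lt_pinfty T s (v : R -> distr R) (B : R) :
  (forall t (n : int), n < 0 -> v t n = 0) ->
  (forall t, - T <= t <= T -> forall N, \sum_(n < N) sobolev_weight s n * nsq (v t n%:Z) <= B) ->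
  (Csobolev_norm T s v < +oo)%E.
Proof.
move=> v0 vB.
have le t : t \in `[- T, T] -> (sobolev_norm s (v t) <= (Num.sqrt B)%:E)%E.
  by rewrite in_itv /= => tT; apply: sobolev_norm_le; [exact: v0|exact: vB].
rewrite /Csobolev_norm asboolT.
  apply: (@le_lt_trans _ _ (Num.sqrt B)%:E); last exact: ltry.
  by apply: ge_ereal_sup => _ [t tT <-]; exact: le.
by move=> t tT; split; [apply: le_lt_trans (le t tT) (ltry _)|exact: v0].
Qed.

Lemma cintegral_oriented_cst (t : R) (z : R[i]) : cintegral_oriented 0 t (fun=> z) = t%:C%C * z.
Proof.
have leb_itv (x y : R) : x <= y -> fine (@lebesgue_measure R `[x, y]) = y - x.
  rewrite lebesgue_measure_itv /= lte_fin -EFinB le_eqVlt => /orP[/eqP->|->] //.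
  by rewrite ltxx subrr.
rewrite /cintegral_oriented /cintegral; case: z => p q /=; case: ifPn => [t0|].
  by rewrite !Rintegral_cst// leb_itv// subr0; apply: complex_eqP => /=; ring.
rewrite -ltNge => /ltW t0.
by rewrite !Rintegral_cst// leb_itv// sub0r; apply: complex_eqP => /=; ring.
Qed.

(** The integrand does not depend on time; the oriented integral makes the factor [t] correct for
    negative times too. *)
Lemma duhamel_cst c (t : R) (n : int) :
  duhamel (fun=> c) (fun=> c) (fun=> c) t n = t%:C%C * szego_proj (cubic_prod c c c) n.
Proof. exact: cintegral_oriented_cst. Qed.

Lemma sobolev_weight_homo (s s' : R) n : s <= s' -> sobolev_weight s n <= sobolev_weight s' n.
Proof. by move=> ss; apply: ler_powR => //; rewrite lerDl sqr_ge0. Qed.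

Lemma Csobolev_norm_duhamel_pinfty c T s s0 : 0 < T -> s0 <= s ->
  (forall A : R, ~ (forall N, \sum_(n < N) sobolev_weight s0 n *
    nsq (cubic_prod c c c n%:Z) <= A)) ->
  Csobolev_norm T s (duhamel (fun=> c) (fun=> c) (fun=> c)) = +oo%E.
Proof.
(* The time [T] is tested, where the coefficients are those of the nonlinearity multiplied by a
   positive number. *)
move=> T0 ss unb; apply: (@Csobolev_norm_pinfty _ _ _ T); first by rewrite lexx andbT ge0_cp ?ltW.
move=> /sobolev_norm_fin[n n0|A HA].
  by rewrite duhamel_cst /szego_proj leNgt n0 mulr0.
apply: (unb (A / T ^+ 2)) => N; rewrite ler_pdivlMr ?exprn_gt0// mulr_suml.
apply: le_trans (HA N); apply: ler_sum => n _.
rewrite duhamel_cst /szego_proj /= nsqM nsq_real -mulrA [_ * T ^+ 2]mulrC.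
by rewrite ler_wpM2r ?sobolev_weight_homo// mulr_ge0 ?sqr_ge0 ?nsq_ge0.
Qed.

Lemma second_iterate0 c : second_iterate c 0 = c.
Proof. by apply/funext => n; rewrite /second_iterate duhamel_cst mul0r mulr0 subr0. Qed.

(** The interval contains t = 0, where the iterate is the datum itself, so the infinite critical
    norm of the datum decides. *)
Lemma Csobolev_norm_second_iterate_pinfty c T s : 0 < T -> (forall n : int, n < 0 -> c n = 0) ->
  (forall A : R, exists N, A <= \sum_(1 <= n < N) sobolev_weight s n * nsq (c n%:Z)) ->
  Csobolev_norm T s (second_iterate c) = +oo%E.
Proof.
move=> T0 c0 unb; apply: (@Csobolev_norm_pinfty _ _ _ 0); first by rewrite oppr_le0 !ltW.
rewrite second_iterate0 => /(sobolev_norm_fin c0)[A HA].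
have [N] := unb (A + 1); rewrite leNgt => /negP; apply.
apply: (@le_lt_trans _ _ A); last by rewrite ltrDl.
apply: le_trans (HA N.+1).
rewrite -(big_mkord xpredT (fun n => sobolev_weight s n * nsq (c n%:Z))).
have t0 n : 0 <= sobolev_weight s n * nsq (c n%:Z).
  by rewrite mulr_ge0 ?nsq_ge0// ltW// sobolev_weight_gt0.
case: N => [|N]; first by rewrite [leLHS]big_geq// sumr_ge0.
rewrite [leRHS](@big_cat_nat _ _ _ 1%N)//= -[leLHS]add0r lerD ?sumr_ge0//.
by rewrite [leRHS]big_nat_recr//= lerDl.
Qed.

Lemma Csobolev_norm_second_iterate_lt_pinfty c T s (A B : R) : (forall n : int, n < 0 -> c n = 0) ->
  (forall N, \sum_(n < N) sobolev_weight s n * nsq (c n%:Z) <= A) ->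
  (forall N, \sum_(n < N) sobolev_weight s n * nsq (cubic_prod c c c n%:Z) <= B) ->
  (Csobolev_norm T s (second_iterate c) < +oo)%E.
Proof.
move=> c0 cA cB; apply: (@Csobolev_norm_lt_pinfty _ _ _ (2 * A + 2 * T ^+ 2 * B)).
  by move=> t n n0; rewrite /second_iterate duhamel_cst /szego_proj leNgt n0 c0// !mulr0 subr0.
move=> t tT N.
have t2 : t ^+ 2 <= T ^+ 2.
  by move: tT; rewrite -ler_norml -[t ^+ 2]real_normK ?num_real// => tT; rewrite lerXn2r ?nnegrE// (le_trans _ tT).
apply: (@le_trans _ _ (\sum_(n < N) (2 * (sobolev_weight s n * nsq (c n%:Z)) +
    2 * T ^+ 2 * (sobolev_weight s n * nsq (cubic_prod c c c n%:Z))))).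
  apply: ler_sum => n _.
  have w0 : 0 <= sobolev_weight s n by exact/ltW/sobolev_weight_gt0.
  rewrite !(mulrCA _ (sobolev_weight s n)) -mulrDr ler_wpM2l//.
  apply: le_trans (nsqD_le _ _) _; rewrite nsqN lerD2l -mulrA ler_pM2l//.
  rewrite duhamel_cst /szego_proj /= 2!nsqM nsq_real.
  rewrite (_ : nsq (0 +i* 1)%C = 1 :> R); last by rewrite /nsq /= expr0n expr1n add0r.
  by rewrite mul1r ler_wpM2r// nsq_ge0.
rewrite big_split /= -!mulr_sumr; apply: lerD; first by apply: ler_wpM2l; [|exact: cA].
by apply: ler_wpM2l; [rewrite mulr_ge0// sqr_ge0|exact: cB].
Qed.

End SobolevNorms.

(** Supplies, for the pointwise product of the chosen L^2 sums, the approximation property on which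
    the estimates for a fixed sample rest. *)
Lemma cubic_prod_limit (R : realType) (c : distr R) (S : R) :
  (forall n : int, n < 0 -> c n = 0) -> (forall K, mass (fun k => c k%:Z) K <= S) ->
  forall B : R, (forall M, exists2 K, (M <= K)%N & quartic_energy (fun k => c k%:Z) K <= B) ->
  forall n (eps : R), 0 < eps -> exists M, forall K, (M <= K)%N ->
    quartic_energy (fun k => c k%:Z) K <= B ->
    nsq (cubic_prod c c c n%:Z - cubic (fun k => c k%:Z) K n) <= eps.
Proof.
move=> c0 cS B good n eps eps0.
have l2 : l2_limit (fun k => c k%:Z) (fun_of_distr c) := fun_of_distr_l2_limit c0 cS.
have [M HM] := l2_limit_cubic n l2 good eps0; exists M => K MK KB.
exact: HM K MK KB.
Qed.

(** * Almost sure conclusions for the random datum *)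

Section RandomDatum.
Context {d : measure_display} {Omega : measurableType d} {R : realType}.
Variables (P : probability Omega R) (g : nat -> Omega -> R[i]).
Hypothesis g_gauss : forall n, std_complex_gaussian P (g n).
Hypothesis g_indep : independent P g.
Variable alpha : R.
Hypothesis alpha_gt : 2^-1 < alpha.

Lemma random_datum_neg w (n : int) : n < 0 -> random_datum alpha g w n = 0.
Proof. by case: n. Qed.

Lemma random_datumE w : (fun k : nat => random_datum alpha g w k%:Z) = datum g alpha w.
Proof.
apply/funext => k; rewrite /random_datum /datum /scaled /vweight fmorphV.
by rewrite mulrC.
Qed.

Let ae_mass_bounded :
  {ae P, forall w, exists S : R, forall K, mass (datum g alpha w) K <= S}.
Proof.
have [W HW] := sum_wweight_le alpha_gt.
have W1 : exists C : R, forall N, \sum_(n < N) cst (1 : R) n * wweight alpha n <= C.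
  by exists W => N; under eq_bigr do rewrite mul1r; exact: HW.
apply: filterS (ae_weighted_bounded g_gauss (fun=> ler01) W1) => w [S HS].
by exists S => K; rewrite /mass; under eq_bigr do rewrite -[nsq _]mul1r; exact: HS.
Qed.

Let cubic_limit w (S : R) := @cubic_prod_limit R (random_datum alpha g w) S (@random_datum_neg w).

Lemma ae_duhamel_pinfty (s : R) : alpha - 2^-1 <= s -> {ae P, forall w (T : R), 0 < T ->
  let u0 := fun=> random_datum alpha g w in Csobolev_norm T s (duhamel u0 u0 u0) = +oo%E}.
Proof.
move=> hs; have q := ae_quartic_bounded g_gauss g_indep alpha_gt.
have u := ae_critical_norm_unbounded g_gauss g_indep alpha_gt.
apply: filterS3 ae_mass_bounded q u => w [S HS] [B HB] HU T T0.
have := @cubic_limit w S; rewrite random_datumE => /(_ HS) lim.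
have unb A := @cubic_critical_unbounded _ _ _ _ HS lim alpha A B HB HU.
exact: Csobolev_norm_duhamel_pinfty T0 hs unb.
Qed.

Lemma ae_second_iterate_lt_pinfty (s : R) : s < alpha - 2^-1 -> {ae P, forall w (T : R), 0 < T ->
  (Csobolev_norm T s (second_iterate (random_datum alpha g w)) < +oo)%E}.
Proof.
move=> hs; have rho0 n : 0 <= sobolev_weight s n by exact/ltW/sobolev_weight_gt0.
have sw := sum_sobolev_weight_le hs.
have b := ae_weighted_bounded g_gauss rho0 sw.
have q := ae_cubic_bounded g_gauss g_indep alpha_gt rho0 sw.
apply: filterS3 ae_mass_bounded b q => w [S HS] [A HA] [B HB] T T0.
have := @cubic_limit w S; rewrite random_datumE => /(_ HS) lim.
apply: (Csobolev_norm_second_iterate_lt_pinfty T (@random_datum_neg w) (A := A)).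
  by move=> N; have := HA N; rewrite -random_datumE.
exact: (cubic_weighted_bounded HS lim rho0 HA HB).
Qed.

Lemma ae_second_iterate_pinfty : {ae P, forall w (T : R), 0 < T ->
  Csobolev_norm T (alpha - 2^-1) (second_iterate (random_datum alpha g w)) = +oo%E}.
Proof.
apply: filterS (ae_critical_norm_unbounded g_gauss g_indep alpha_gt) => w HU T T0.
apply: Csobolev_norm_second_iterate_pinfty => //; first exact: random_datum_neg.
by move=> A; have := HU A; rewrite -random_datumE.
Qed.

End RandomDatum.

Theorem proposition1p6 (R : realType) (d : measure_display)
    (Omega : measurableType d) (P : probability Omega R)
    (g : nat -> Omega -> R[i])
    (g_gauss : forall n, std_complex_gaussian P (g n))
    (g_indep : independent P g) :
  [/\ forall alpha s : R, 2^-1 < alpha -> alpha <= 1 -> alpha - 2^-1 <= s ->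
        {ae P, forall w, forall T : R, 0 < T ->
          let u0 := fun=> random_datum alpha g w in
          Csobolev_norm T s (duhamel u0 u0 u0) = +oo%E},
      {ae P, forall w, forall T : R, 0 < T ->
        Csobolev_norm T 2^-1 (second_iterate (random_datum 1 g w)) = +oo%E}
    & forall alpha eps s : R, 2^-1 < alpha -> 0 < eps ->
        s < alpha - 2^-1 - eps ->
        {ae P, forall w, forall T : R, 0 < T ->
          (Csobolev_norm T s (second_iterate (random_datum alpha g w)) < +oo)%E}].
Proof.
split.
- by move=> alpha s alpha_gt _ hs; exact: ae_duhamel_pinfty.
- have half1 : 2^-1 < 1 :> R by rewrite invf_lt1 ?ltr1n.
  have -> : 2^-1 = 1 - 2^-1 :> R by field.
  exact: ae_second_iterate_pinfty.
- move=> alpha eps s alpha_gt eps0 hs; apply: ae_second_iterate_lt_pinfty => //.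
  by rewrite (lt_trans hs)// gtrBl.
Qed.
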